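(* Let $\Omega\subset\mathbb{C}^d$ be a bounded open set which is locally convexifiable and has finite local line type $L$, and let $\{(V_\xi,\Phi_\xi):\xi\in\partial\Omega\}$ be a good locally convex atlas. Then there exist $K,\delta>0$ such that for every $\xi\in\partial\Omega$ and all $p,q\in B_\delta(\xi)\cap\Omega$, $$d_\Omega(p,q)\le d_{\Omega\cap V_\xi}(p,q)\le d_\Omega(p,q)+K.$$
   Context: $d_\Omega$ is the Kobayashi distance. $\delta_\Omega(p)$ is the Euclidean distance to $\mathbb{C}^d\setminus\Omega$, and $\delta_\Omega(p;v)=\inf\{\|q-p\|:q\in(p+\mathbb{C}v)\setminus\Omega\}$. A local convex chart at $\xi\in\partial\Omega$ is a pair $(V_\xi,\Phi_\xi)$ with $V_\xi$ a neighborhood of $\xi$ and $\Phi_\xi:V_\xi\to\mathbb{C}^d$ a biholomorphism onto its image with $\Omega_\xi:=\Phi_\xi(V_\xi\cap\Omega)$ convex; a locally convex atlas is a choice of one for each $\xi\in\partial\Omega$. $\Omega$ has finite local line type $L$ if $\partial\Omega$ is a $C^L$ hypersurface and there is a locally convex atlas such that each $\Phi_\xi(\partial\Omega\cap V_\xi)$ has line type at most $L$ near $\Phi_\xi(\xi)$, with equality attained for some $\xi$ (line type at $x$ of $\{r=0\}$: supremum over non-trivial complex affine $\ell:\mathbb{C}\to\mathbb{C}^d$, $\ell(0)=x$, of the order of vanishing of $r\circ\ell$ at $0$). The atlas is good if there are $C,\tau>0$ such that for every $\xi$: $B_\tau(\xi)\subset V_\xi$; $\delta_{\Omega_\xi}(p;v)\le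 C\delta_{\Omega_\xi}(p)^{1/L}$ for all $p\in\Omega_\xi$, $v\neq0$; and $C^{-1}\|p-q\|\le\|\Phi_\xi(p)-\Phi_\xi(q)\|\le C\|p-q\|$ for $p,q\in V_\xi$. *)

(* Defs.v *)
(* C^d is modelled as 'rV[R[i]]_d
   for an abstract R : realType (R[i] = complex R from mathcomp-real-closed).
   All metric/topological notions on C^d are taken w.r.t. the Euclidean norm
   [enorm], written out explicitly. *)
From HB Require Import structures.
From mathcomp Require Import all_boot all_order all_algebra.
From mathcomp Require Import complex.
From mathcomp Require Import all_classical all_reals.
From mathcomp Require Import ereal topology normedtype derive exp.
Set Implicit Arguments.
Unset Strict Implicit.
Unset Printing Implicit Defensive.
Import Order.TTheory GRing.Theory Num.Theory.
Import numFieldNormedType.Exports.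
Local Open Scope classical_set_scope.
Local Open Scope ring_scope.

Section Defs.
Variable R : realType.
Variable d : nat.

Definition Cd := 'rV[R[i]]_d.

Definition cabs (z : R[i]) : R :=
  match z with Complex a b => Num.sqrt (a ^+ 2 + b ^+ 2) end.

Definition rC (s : R) : R[i] := Complex s 0.

Definition enorm (x : Cd) : R := Num.sqrt (\sum_(i < d) cabs (x ord0 i) ^+ 2).

Definition eball (x : Cd) (e : R) : set Cd := [set y | enorm (y - x) < e].

Definition eopen (A : set Cd) : Prop :=
  forall x, A x -> exists2 e : R, 0 < e & eball x e `<=` A.

Definition einterior (A : set Cd) : set Cd :=
  [set x | exists2 e : R, 0 < e & eball x e `<=` A].

Definition eclosure (A : set Cd) : set Cd :=
  [set x | forall e : R, 0 < e -> exists y, A y /\ enorm (y - x) < e].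

Definition ebdry (A : set Cd) : set Cd := eclosure A `\` einterior A.

Definition ebounded (A : set Cd) : Prop :=
  exists M : R, forall x, A x -> enorm x <= M.

Definition convex_set (A : set Cd) : Prop :=
  forall x y, A x -> A y -> forall t : R, 0 <= t <= 1 ->
    A (rC t *: x + rC (1 - t) *: y).

Definition econt_on (U : set Cd) (f : Cd -> R) : Prop :=
  forall x, U x -> forall e : R, 0 < e -> exists2 del : R, 0 < del &
    forall y, U y -> enorm (y - x) < del -> `|f y - f x| < e.

Definition dD (w : Cd) (f : Cd -> R) : Cd -> R :=
  fun y => derive1 (fun s : R => f (y + rC s *: w)) 0.

Definition dderivable (w : Cd) (f : Cd -> R) (y : Cd) : Prop :=
  derivable (fun s : R => f (y + rC s *: w)) 0 1.

Fixpoint Ck (U : set Cd) (k : nat) (f : Cd -> R) : Prop :=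
  match k with
  | 0 => econt_on U f
  | k'.+1 => econt_on U f /\ (forall w y, U y -> dderivable w f y) /\
             (forall w, Ck U k' (dD w f))
  end.

Definition iterD (j : nat) (w : Cd) (f : Cd -> R) : Cd -> R := iter j (dD w) f.

Definition defining_fun (S : set Cd) (x : Cd) (U : set Cd) (r : Cd -> R)
  (L : nat) : Prop :=
  [/\ eopen U, U x, Ck U L r,
      (forall y, U y -> (S y <-> r y = 0)) &
      (forall y, U y -> S y -> exists w, dderivable w r y /\ dD w r y != 0)].

Definition CL_hypersurface (S : set Cd) (L : nat) : Prop :=
  forall x, S x -> exists U r, defining_fun S x U r L.

(* Line type via the order of vanishing at 0 of r o l, l(t) = x + t v.
   Order of vanishing >= k  iff  all real derivatives of order < k of the
   one-complex-variable function t |-> r(x + t v) vanish at 0, i.e. for every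
   real direction c in C (c <> 0) the derivatives of order < k of
   s |-> r (x + s (c v)) vanish at 0. *)
Definition line_type_le (S : set Cd) (x : Cd) (L : nat) : Prop :=
  exists U r, defining_fun S x U r L /\
    forall v : Cd, v != 0 -> exists c : R[i], c != 0 /\
      exists2 j, (j <= L)%N & iterD j (c *: v) r x != 0.

Definition line_type_ge (S : set Cd) (x : Cd) (L : nat) : Prop :=
  exists U r, defining_fun S x U r L /\
    exists2 v : Cd, v != 0 & forall (c : R[i]) j, (j < L)%N ->
      iterD j (c *: v) r x = 0.

Definition holo_on (U : set Cd) (F : Cd -> Cd) : Prop :=
  forall x, U x -> exists A : 'M[R[i]]_d, forall e : R, 0 < e ->
    exists2 del : R, 0 < del & forall h : Cd, enorm h < del ->
      enorm (F (x + h) - F x - h *m A) <= e * enorm h.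

Definition disc_holo (f : R[i] -> Cd) : Prop :=
  forall z, cabs z < 1 -> exists a : Cd, forall e : R, 0 < e ->
    exists2 del : R, 0 < del & forall h : R[i], cabs h < del ->
      enorm (f (z + h) - f z - h *: a) <= e * cabs h.

(* Poincare distance from 0 to b in the unit disc *)
Definition rho0 (b : R[i]) : R := ln ((1 + cabs b) / (1 - cabs b)) / 2.

Definition kob (Om : set Cd) (p q : Cd) : \bar R :=
  ereal_inf [set t : \bar R | exists (n : nat) (z : nat -> Cd)
      (f : nat -> R[i] -> Cd) (b : nat -> R[i]),
    [/\ z 0%N = p, z n = q,
        (forall i, (i < n)%N ->
           [/\ disc_holo (f i), (forall w, cabs w < 1 -> Om (f i w)),
               cabs (b i) < 1, f i 0 = z i & f i (b i) = z i.+1]) &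
        t = (\sum_(i < n) rho0 (b i))%:E]].

Definition edist_c (A : set Cd) (p : Cd) : \bar R :=
  ereal_inf [set (enorm (q - p))%:E | q in ~` A].

Definition edist_line (A : set Cd) (p v : Cd) : \bar R :=
  ereal_inf [set (enorm (q - p))%:E |
              q in [set q | exists c : R[i], q = p + c *: v] `&` ~` A].

Definition biholo (V : set Cd) (Phi : Cd -> Cd) : Prop :=
  [/\ eopen V, holo_on V Phi, {in V &, injective Phi}, eopen (Phi @` V) &
      exists Psi, holo_on (Phi @` V) Psi /\ (forall x, V x -> Psi (Phi x) = x)].

Definition convex_chart (Om : set Cd) (xi : Cd) (V : set Cd) (Phi : Cd -> Cd)
  : Prop := [/\ eopen V, V xi, biholo V Phi & convex_set (Phi @` (V `&` Om))].

Definition lc_atlas (Om : set Cd) (Vf : Cd -> set Cd) (Phif : Cd -> Cd -> Cd)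
  : Prop := forall xi, ebdry Om xi -> convex_chart Om xi (Vf xi) (Phif xi).

Definition locally_convexifiable (Om : set Cd) : Prop :=
  exists Vf Phif, lc_atlas Om Vf Phif.

Definition finite_local_line_type (Om : set Cd) (L : nat) : Prop :=
  CL_hypersurface (ebdry Om) L /\
  exists Vf Phif, lc_atlas Om Vf Phif /\
    exists W : Cd -> set Cd,
      (forall xi, ebdry Om xi ->
        [/\ eopen (W xi), W xi (Phif xi xi) &
            forall x, W xi x -> (Phif xi @` (ebdry Om `&` Vf xi)) x ->
              line_type_le (Phif xi @` (ebdry Om `&` Vf xi)) x L]) /\
      (exists xi, ebdry Om xi /\ exists x, [/\ W xi x,
          (Phif xi @` (ebdry Om `&` Vf xi)) x &
          line_type_ge (Phif xi @` (ebdry Om `&` Vf xi)) x L]).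

Definition good_atlas (Om : set Cd) (Vf : Cd -> set Cd) (Phif : Cd -> Cd -> Cd)
  (L : nat) : Prop :=
  exists (C tau : R), [/\ 0 < C, 0 < tau &
    forall xi, ebdry Om xi ->
      [/\ eball xi tau `<=` Vf xi,
          (forall p v, (Phif xi @` (Vf xi `&` Om)) p -> v != 0 ->
             (edist_line (Phif xi @` (Vf xi `&` Om)) p v <=
              C%:E * poweR (edist_c (Phif xi @` (Vf xi `&` Om)) p) (L%:R^-1))%E) &
          (forall p q, Vf xi p -> Vf xi q ->
             C^-1 * enorm (p - q) <= enorm (Phif xi p - Phif xi q) /\
             enorm (Phif xi p - Phif xi q) <= C * enorm (p - q))]].

End Defs.

(* Main.v *)
(** Let [f] be a disc in [Om] whose centre lies at depth about [2^-n] near a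
    boundary point [xi]. In the convex image of the chart, a complex supporting
    functional and Harnack's inequality bound the growth of the depth along
    [f], and the line-type estimate bounds the speed of [f] by a power of the
    depth; the resulting geometric series shows that [f] stays in the chart on
    a radius [1 - O(theta^n)]. So a short hop of a Kobayashi chain of [Om] is a
    hop of [Om `&` V] at the cost of a factor [1 + O(lam^n)], [lam < 1].
    In a nearly minimal chain, the points of depth about [2^-n] span a stretch
    of length [O(n)], because the first and the last of them can be joined
    inside the convex chart at cost [O(n)]. Hence the total extra cost is
    [O(sum n lam^n)], and so is the Euclidean displacement: the chain can only
    leave the chart after it has reached a fixed depth. Following the chain from
    both ends, one is left with two points of fixed depth, which are joined
    inside the chart at bounded cost.
    The only complex analysis needed is Cauchy's estimate, which is derived from
    Goursat's theorem on rectangles. *)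
Require Import Defs.
From HB Require Import structures.
From mathcomp Require Import all_boot all_order all_algebra.
From mathcomp Require Import complex ring lra.
From mathcomp Require Import all_classical all_reals.
From mathcomp Require Import ereal topology normedtype derive exp.
From mathcomp Require Import measure lebesgue_measure lebesgue_integral ftc sequences.
Import Order.TTheory GRing.Theory Num.Theory.
Import numFieldNormedType.Exports.
Local Open Scope classical_set_scope.
Local Open Scope ring_scope.

Set Implicit Arguments.
Unset Strict Implicit.
Unset Printing Implicit Defensive.

(** The extra cost of a localized hop is relative to the cost of that hop, and a chain may return to
    a given depth arbitrarily often. Near-minimality makes the errors summable: a chain within 1 of
    the infimum is also within 1 of optimal between any two of its own points, so one cheap detour
    inside the chart bounds all that happens between two visits to a level. A circularity has to be
    broken: [Phi] composed with a disc makes sense only while the disc stays in the chart, which is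
    what must be shown. Boundedness of [Om] gives the small gain in radius on which a continuity
    argument runs. Hops must be short because shrinking a disc to radius [r] multiplies the cost by
    [1 + O(1 - r)] only for parameters away from the unit circle. Cutting a long hop is free, since
    the Poincare distance is additive along a radius. All constants have to be uniform in [xi]; they
    are fixed before a boundary point is chosen, which requires one radius of interior balls that
    serves near every point of [Om]. *)

(** * The modulus on C and the Hermitian norm on C^d *)

Section Modulus.
Variable R : realType.
Implicit Types (z w : R[i]) (s : R).

Lemma cabs0 : cabs (0 : R[i]) = 0.
Proof. exact: ComplexField.Normc.normc0. Qed.

Lemma cabs1 : cabs (1 : R[i]) = 1.
Proof. exact: ComplexField.Normc.normc1. Qed.

Lemma cabs_ge0 z : 0 <= cabs z.
Proof. by case: z => a b; exact: sqrtr_ge0. Qed.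

Lemma cabs0_eq0 z : cabs z = 0 -> z = 0.
Proof. exact: ComplexField.Normc.eq0_normc. Qed.

Lemma cabs_gt0 z : z != 0 -> 0 < cabs z.
Proof.
move=> z0; rewrite lt_neqAle cabs_ge0 andbT eq_sym.
by apply: contra z0 => /eqP/cabs0_eq0 ->.
Qed.

Lemma cabsM z w : cabs (z * w) = cabs z * cabs w.
Proof. exact: ComplexField.Normc.normcM. Qed.

Lemma cabsV z : cabs z^-1 = (cabs z)^-1.
Proof. exact: ComplexField.Normc.normcV. Qed.

Lemma cabsD z w : cabs (z + w) <= cabs z + cabs w.
Proof. exact: le_normcD. Qed.

Lemma cabsN z : cabs (- z) = cabs z.
Proof. exact: normcN. Qed.

Lemma cabsBC z w : cabs (z - w) = cabs (w - z).
Proof. by rewrite -cabsN opprB. Qed.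

Lemma cabsB z w : cabs z - cabs w <= cabs (z - w).
Proof. by rewrite lerBlDr -{1}(subrK w z) cabsD. Qed.

Lemma cabs_rC s : cabs (rC s) = `|s|.
Proof. by rewrite /cabs /rC expr0n addr0 sqrtr_sqr. Qed.

Lemma cabsX z n : cabs (z ^+ n) = cabs z ^+ n.
Proof. by elim: n => [|n IH]; rewrite ?expr0 ?cabs1 // !exprS cabsM IH. Qed.

Lemma normRe_le z : `|complex.Re z| <= cabs z.
Proof.
case: z => a b /=; rewrite -sqrtr_sqr ler_sqrt ?lerDl ?sqr_ge0 //.
by rewrite addr_ge0 ?sqr_ge0.
Qed.

Lemma normIm_le z : `|complex.Im z| <= cabs z.
Proof.
case: z => a b /=; rewrite -sqrtr_sqr ler_sqrt ?lerDr ?sqr_ge0 //.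
by rewrite addr_ge0 ?sqr_ge0.
Qed.

Lemma Re_le_cabs z : complex.Re z <= cabs z.
Proof. exact: le_trans (ler_norm _) (normRe_le z). Qed.

Lemma cabs_le_ReIm z : cabs z <= `|complex.Re z| + `|complex.Im z|.
Proof.
case: z => a b /=.
have h : 0 <= `|a| + `|b| by rewrite addr_ge0.
rewrite -[leRHS]ger0_norm // -sqrtr_sqr ler_sqrt ?sqr_ge0 //.
rewrite -(real_normK (num_real a)) -(real_normK (num_real b)).
by have := normr_ge0 a; have := normr_ge0 b; nra.
Qed.

Lemma cabs_sqr z : cabs z ^+ 2 = complex.Re z ^+ 2 + complex.Im z ^+ 2.
Proof. by case: z => a b /=; rewrite sqr_sqrtr // addr_ge0 ?sqr_ge0. Qed.

Lemma cReD z w : complex.Re (z + w) = complex.Re z + complex.Re w.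
Proof. by case: z; case: w. Qed.
Lemma cImD z w : complex.Im (z + w) = complex.Im z + complex.Im w.
Proof. by case: z; case: w. Qed.
Lemma cReN z : complex.Re (- z) = - complex.Re z.
Proof. by case: z. Qed.
Lemma cImN z : complex.Im (- z) = - complex.Im z.
Proof. by case: z. Qed.
Lemma cReM z w :
  complex.Re (z * w) = complex.Re z * complex.Re w - complex.Im z * complex.Im w.
Proof. by case: z; case: w. Qed.
Lemma cImM z w :
  complex.Im (z * w) = complex.Re z * complex.Im w + complex.Im z * complex.Re w.
Proof. by case: z; case: w. Qed.

Definition cReImE := (cReD, cImD, cReN, cImN, cReM, cImM).

Lemma rCD s t : rC (s + t) = rC s + rC t.
Proof. by rewrite /rC; simpc. Qed.
Lemma rCN s : rC (- s) = - rC s.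
Proof. by rewrite /rC; simpc. Qed.
Lemma rCB s t : rC (s - t) = rC s - rC t.
Proof. by rewrite rCD rCN. Qed.
Lemma rCM s t : rC (s * t) = rC s * rC t.
Proof. by rewrite /rC; simpc. Qed.
Lemma rC1 : rC 1 = 1 :> R[i].
Proof. by []. Qed.
Lemma rC0 : rC 0 = 0 :> R[i].
Proof. by []. Qed.
Lemma rC_eq0 s : (rC s == 0) = (s == 0).
Proof. by rewrite /rC eq_complex /= eqxx andbT. Qed.
Lemma rCV s : rC s^-1 = (rC s)^-1.
Proof.
have [->|s0] := eqVneq s 0; first by rewrite invr0 rC0 invr0.
apply: (@mulfI _ (rC s)); first by rewrite rC_eq0.
by rewrite -rCM !divff ?rC_eq0 // .
Qed.

Lemma cabs_conj z : cabs (conjc z) = cabs z.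
Proof. by case: z => a b /=; rewrite sqrrN. Qed.

Lemma mul_conjc z : z * conjc z = rC (cabs z ^+ 2).
Proof.
rewrite cabs_sqr; case: z => a b; rewrite /rC; simpc => /=.
by congr Complex; ring.
Qed.

Lemma cabs_sum (I : finType) (F : I -> R[i]) :
  cabs (\sum_i F i) <= \sum_i cabs (F i).
Proof.
elim/big_ind2: _ => [|x1 x2 y1 y2 h1 h2|//]; first by rewrite cabs0.
exact: le_trans (cabsD _ _) (lerD h1 h2).
Qed.

End Modulus.

(** Summing [(x a_i - y b_i)^2 >= 0] with [x] the norm of [b] and [y] the norm of [a] gives the
    claim multiplied by both norms, so a vanishing norm is treated apart. *)
Lemma sum_CauchySchwarz (R : rcfType) (I : finType) (a b : I -> R) :
  \sum_i a i * b i <= Num.sqrt (\sum_i a i ^+ 2) * Num.sqrt (\sum_i b i ^+ 2).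
Proof.
set A := \sum_i a i ^+ 2; set B := \sum_i b i ^+ 2; set S := \sum_i a i * b i.
have A0 : 0 <= A by apply: sumr_ge0 => i _; exact: sqr_ge0.
have B0 : 0 <= B by apply: sumr_ge0 => i _; exact: sqr_ge0.
have key x y : 2 * x * y * S <= x ^+ 2 * A + y ^+ 2 * B.
  rewrite !mulr_sumr -big_split /=; apply: ler_sum => i _.
  by have := sqr_ge0 (x * a i - y * b i); nra.
set p := Num.sqrt A; set q := Num.sqrt B.
have pA : A = p ^+ 2 by rewrite sqr_sqrtr.
have qB : B = q ^+ 2 by rewrite sqr_sqrtr.
have p0 : 0 <= p by exact: sqrtr_ge0.
have q0 : 0 <= q by exact: sqrtr_ge0.
have zero (u v : I -> R) : \sum_i u i ^+ 2 = 0 -> \sum_i u i * v i = 0.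
  move=> /eqP; rewrite psumr_eq0 => [/allP h|i _]; last exact: sqr_ge0.
  rewrite big1 // => i _; have := h i (mem_index_enum _).
  by rewrite sqrf_eq0 => /eqP ->; rewrite mul0r.
have [p00|p1] := eqVneq p 0.
  by rewrite p00 mul0r /S zero // -/A pA p00 expr0n.
have [q00|q1] := eqVneq q 0.
  rewrite q00 mulr0 /S (eq_bigr (fun i => b i * a i)).
    by rewrite zero // -/B qB q00 expr0n.
  by move=> i _; rewrite mulrC.
have pq : 0 < p * q by rewrite mulr_gt0 // lt_neqAle eq_sym ?p1 ?q1.
have := key q p; rewrite pA qB => k.
have : (p * q) * S <= (p * q) * (p * q) by nra.
by rewrite ler_pM2l.
Qed.

Section EuclideanNorm.
Variables (R : realType) (d : nat).
Implicit Types (x y z : Cd R d) (c : R[i]) (s : R).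

(** The Hermitian inner product, linear in the first slot: pairing a holomorphic map with a fixed
    vector in the second slot gives a holomorphic function. *)
Definition hip x y : R[i] := \sum_(i < d) x ord0 i * conjc (y ord0 i).

Lemma hipDl x y z : hip (x + y) z = hip x z + hip y z.
Proof. by rewrite /hip -big_split; apply: eq_bigr => i _; rewrite mxE mulrDl. Qed.

Lemma hipZl c x y : hip (c *: x) y = c * hip x y.
Proof. by rewrite /hip mulr_sumr; apply: eq_bigr => i _; rewrite mxE mulrA. Qed.

Lemma hipNl x y : hip (- x) y = - hip x y.
Proof. by rewrite -scaleN1r hipZl mulN1r. Qed.

Lemma hipBl x y z : hip (x - y) z = hip x z - hip y z.
Proof. by rewrite hipDl hipNl. Qed.

Lemma hipC x y : hip y x = conjc (hip x y).
Proof.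
rewrite /hip rmorph_sum; apply: eq_bigr => i _.
by rewrite rmorphM /= conjcK mulrC.
Qed.

Lemma enorm_ge0 x : 0 <= enorm x.
Proof. exact: sqrtr_ge0. Qed.

Lemma enorm_sqr x : enorm x ^+ 2 = \sum_(i < d) cabs (x ord0 i) ^+ 2.
Proof. by rewrite sqr_sqrtr // sumr_ge0 // => i _; exact: sqr_ge0. Qed.

Lemma hipxx x : hip x x = rC (enorm x ^+ 2).
Proof.
rewrite enorm_sqr (big_morph (@rC R) (@rCD R) (@rC0 R)).
by apply: eq_bigr => i _; rewrite mul_conjc.
Qed.

Lemma cabs_hip x y : cabs (hip x y) <= enorm x * enorm y.
Proof.
apply: le_trans (cabs_sum _) _.
under eq_bigr do rewrite cabsM cabs_conj.
exact: sum_CauchySchwarz.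
Qed.

Lemma enormZ c x : enorm (c *: x) = cabs c * enorm x.
Proof.
rewrite /enorm; under eq_bigr do rewrite mxE cabsM exprMn.
by rewrite -mulr_sumr sqrtrM ?sqr_ge0 // sqrtr_sqr ger0_norm // cabs_ge0.
Qed.

Lemma enorm0 : enorm (0 : Cd R d) = 0.
Proof. by rewrite -(scale0r (0 : Cd R d)) enormZ cabs0 mul0r. Qed.

Lemma enormN x : enorm (- x) = enorm x.
Proof. by rewrite -scaleN1r enormZ cabsN cabs1 mul1r. Qed.

Lemma enormBC x y : enorm (x - y) = enorm (y - x).
Proof. by rewrite -enormN opprB. Qed.

Lemma enormD_sqr x y :
  enorm (x + y) ^+ 2 = enorm x ^+ 2 + 2 * complex.Re (hip x y) + enorm y ^+ 2.
Proof.
have h : rC (enorm (x + y) ^+ 2) = hip x x + hip x y + conjc (hip x y) + hip y y.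
  rewrite -hipxx hipDl (hipC (x + y) x) (hipC (x + y) y) !hipDl.
  by rewrite !rmorphD /= -!hipC; ring.
move: h; rewrite !hipxx => /(congr1 (@complex.Re R)); rewrite !cReD /=.
by case: (hip x y) => a b /= ->; ring.
Qed.

Lemma enormD x y : enorm (x + y) <= enorm x + enorm y.
Proof.
rewrite -(ler_pXn2r (_ : 0 < 2)%N) ?nnegrE ?addr_ge0 ?enorm_ge0 //.
rewrite enormD_sqr sqrrD; have := Re_le_cabs (hip x y); have := cabs_hip x y.
lra.
Qed.

Lemma enormB_le x y z : enorm (x - z) <= enorm (x - y) + enorm (y - z).
Proof. by rewrite -{1}(subrK y x) -addrA enormD. Qed.

Lemma enorm0_eq0 x : enorm x = 0 -> x = 0.
Proof.
move=> x0; have : enorm x ^+ 2 = 0 by rewrite x0 expr0n.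
rewrite enorm_sqr => /eqP; rewrite psumr_eq0 => [/allP h|i _]; last exact: sqr_ge0.
apply/rowP => i; rewrite mxE; have := h i (mem_index_enum _).
by rewrite sqrf_eq0 => /eqP/cabs0_eq0.
Qed.

Lemma enorm_gt0 x : x != 0 -> 0 < enorm x.
Proof.
move=> x0; rewrite lt_neqAle enorm_ge0 andbT eq_sym.
by apply: contra x0 => /eqP/enorm0_eq0 ->.
Qed.

End EuclideanNorm.

(** * Integration on segments and Goursat's theorem *)

Section SegmentIntegral.
Variable R : realType.
Implicit Types (p : R -> R) (a b c : R).

Definition sint p a b : R := (\int[@lebesgue_measure R]_(x in `[a, b]) p x)%R.

(** Continuity is two-sided even at the end points. Functions on the edges of a rectangle have it,
    since they restrict functions that are differentiable in C at each point of the edge. *)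
Definition cont_seg p a b := forall x, a <= x <= b -> {for x, continuous p}.

Lemma cont_seg_within p a b : cont_seg p a b -> {within `[a, b], continuous p}.
Proof.
move=> h; apply: continuous_in_subspaceT => x; rewrite inE /= in_itv /=.
exact: h.
Qed.

Lemma cont_seg_integrable p a b : cont_seg p a b ->
  (@lebesgue_measure R).-integrable `[a, b] (EFin \o p).
Proof.
move=> h; apply: continuous_compact_integrable; first exact: segment_compact.
exact: cont_seg_within.
Qed.

Lemma sint_split p a b c : a <= b -> b <= c -> cont_seg p a c ->
  sint p a c = sint p a b + sint p b c.
Proof.
move=> ab bc h; have hi := cont_seg_integrable h.
have := @Rintegral_itvB R p (BLeft a) (BRight c) b hi.
rewrite !bnd_simp => /(_ ab bc).
rewrite Rintegral_itv_obnd_cbnd.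
  by rewrite /sint => /eqP; rewrite subr_eq addrC => /eqP.
apply: integrableS hi => //; apply: subset_itvr; rewrite bnd_simp //.
Qed.

Lemma sint_affine (u v a b : R) : a <= b ->
  sint (fun x => u + v * x) a b = u * (b - a) + v * (b ^+ 2 - a ^+ 2) / 2.
Proof.
rewrite le_eqVlt => /predU1P[<-|ab].
  by rewrite /sint set_itv1 Rintegral_set1 !subrr !mulr0 mul0r addr0.
pose F x := u * x + v * (x ^+ 2) / 2.
have dF (x : R) : is_derive x 1 F (u + v * x).
  rewrite /F; apply: is_derive_eq.
  rewrite /GRing.scale /=. by field.
have cF (x : R) : {for x, continuous F}.
  by apply: differentiable_continuous; apply/derivable1_diffP; case: (dF x).
have cf (x : R) : {for x, continuous (fun x => u + v * x)}.
  apply: cvgD; first exact: cvg_cst.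
  by apply: cvgM; [exact: cvg_cst|exact: cvg_id].
rewrite /sint /Rintegral (@continuous_FTC2 _ _ F) //=.
- by rewrite /F; ring.
- by apply: continuous_in_subspaceT => x _; exact: cf.
- split => [x _||]; first by case: (dF x).
    by apply: cvg_at_right_filter; exact: cF.
  by apply: cvg_at_left_filter; exact: cF.
- by move=> x _; rewrite derive1E; case: (dF x).
Qed.

Lemma sint_le_affine p (u v a b : R) : a <= b -> cont_seg p a b ->
  (forall x, a <= x <= b -> p x <= u + v * x) ->
  sint p a b <= u * (b - a) + v * (b ^+ 2 - a ^+ 2) / 2.
Proof.
move=> ab cp h; rewrite -sint_affine //; apply: le_Rintegral.
- exact: measurable_itv.
- exact: cont_seg_integrable.
- apply: cont_seg_integrable => x _.
  apply: cvgD; first exact: cvg_cst.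
  by apply: cvgM; [exact: cvg_cst|exact: cvg_id].
by move=> x /=; rewrite in_itv /=; exact: h.
Qed.

Lemma sint_ge_affine p (u v a b : R) : a <= b -> cont_seg p a b ->
  (forall x, a <= x <= b -> u + v * x <= p x) ->
  u * (b - a) + v * (b ^+ 2 - a ^+ 2) / 2 <= sint p a b.
Proof.
move=> ab cp h; rewrite -sint_affine //; apply: le_Rintegral.
- exact: measurable_itv.
- apply: cont_seg_integrable => x _.
  apply: cvgD; first exact: cvg_cst.
  by apply: cvgM; [exact: cvg_cst|exact: cvg_id].
- exact: cont_seg_integrable.
by move=> x /=; rewrite in_itv /=; exact: h.
Qed.

(** On an edge of a rectangle the first-order expansion of a holomorphic function is affine in the
    real parameter, and the integral of an affine function is explicit. *)
Lemma sint_approx p (u v e a b : R) : a <= b -> cont_seg p a b ->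
  (forall x, a <= x <= b -> `|p x - (u + v * x)| <= e) ->
  `|sint p a b - (u * (b - a) + v * (b ^+ 2 - a ^+ 2) / 2)| <= e * (b - a).
Proof.
move=> ab cp h; rewrite ler_norml; apply/andP; split.
  have := @sint_ge_affine p (u - e) v a b ab cp.
  suff H : forall x, a <= x <= b -> u - e + v * x <= p x by move=> /(_ H); lra.
  by move=> x /h; rewrite ler_norml; lra.
have := @sint_le_affine p (u + e) v a b ab cp.
suff H : forall x, a <= x <= b -> p x <= u + e + v * x by move=> /(_ H); lra.
by move=> x /h; rewrite ler_norml; lra.
Qed.

End SegmentIntegral.

(** * Calculus of complex derivatives *)

Section ComplexDerivative.
Variable R : realType.
Implicit Types (f g : R[i] -> R[i]) (z a b h : R[i]).

Definition cderiv f z a := forall e : R, 0 < e -> exists2 del : R, 0 < del &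
  forall h, cabs h < del -> cabs (f (z + h) - f z - h * a) <= e * cabs h.

Definition cdiff f z := exists a, cderiv f z a.

Lemma cderiv_lipschitz f z a : cderiv f z a -> exists2 del : R, 0 < del &
  forall h, cabs h < del -> cabs (f (z + h) - f z) <= (1 + cabs a) * cabs h.
Proof.
move=> /(_ 1 ltr01) [del del0 H]; exists del => // h /H k.
have := cabsD (f (z + h) - f z - h * a) (h * a); rewrite subrK cabsM.
by nra.
Qed.

Lemma cdiff_continuous f z : cdiff f z ->
  forall e : R, 0 < e -> exists2 del : R, 0 < del &
  forall h, cabs h < del -> cabs (f (z + h) - f z) < e.
Proof.
move=> [a /cderiv_lipschitz [del del0 H]] e e0.
have a1 : 0 < 1 + cabs a by have := cabs_ge0 a; lra.
exists (Num.min del (e / (1 + cabs a))); first by rewrite lt_min del0 divr_gt0.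
move=> h; rewrite lt_min => /andP[h1 h2].
by apply: le_lt_trans (H _ h1) _; rewrite mulrC -ltr_pdivlMr.
Qed.

Lemma cderivD f g z a b : cderiv f z a -> cderiv g z b ->
  cderiv (fun w => f w + g w) z (a + b).
Proof.
move=> Hf Hg e e0.
have e2 : 0 < e / 2 by rewrite divr_gt0.
have [d1 d10 H1] := Hf _ e2; have [d2 d20 H2] := Hg _ e2.
exists (Num.min d1 d2); first by rewrite lt_min d10.
move=> h; rewrite lt_min => /andP[/H1 h1 /H2 h2].
have -> : f (z + h) + g (z + h) - (f z + g z) - h * (a + b) =
  (f (z + h) - f z - h * a) + (g (z + h) - g z - h * b) by ring.
apply: le_trans (cabsD _ _) _; lra.
Qed.

Lemma cderivM f g z a b : cderiv f z a -> cderiv g z b ->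
  cderiv (fun w => f w * g w) z (a * g z + f z * b).
Proof.
move=> Hf Hg e e0.
have [d0 d00 H0] := cderiv_lipschitz Hg.
set B := 1 + cabs b in H0.
have B0 : 0 < B by have := cabs_ge0 b; rewrite /B; lra.
(* [M] dominates every modulus in the four error terms below; each of them is then allotted a
   quarter of [e]. *)
set M := cabs (f z) + cabs (g z) + cabs a + B + 1.
have M0 : 0 < M.
  by have := cabs_ge0 (f z); have := cabs_ge0 (g z); have := cabs_ge0 a; rewrite /M; lra.
set e1 := Num.min 1 (e / (4 * M)).
have e10 : 0 < e1 by rewrite lt_min ltr01 divr_gt0 // mulr_gt0.
have [d1 d10 H1] := Hf _ e10; have [d2 d20 H2] := Hg _ e10.
set d3 := Num.min 1 (e / (4 * (M * M))).
have d30 : 0 < d3 by rewrite lt_min ltr01 divr_gt0 // !mulr_gt0.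
exists (Num.min (Num.min d0 d1) (Num.min d2 d3)); first by rewrite 3!lt_min d00 d10 d20 d30.
move=> h; rewrite !lt_min => /andP[/andP[h0 h1] /andP[h2 /andP[h3 h4]]].
have k0 := H0 _ h0; have k1 := H1 _ h1; have k2 := H2 _ h2.
have -> : f (z + h) * g (z + h) - f z * g z - h * (a * g z + f z * b) =
  (f (z + h) - f z - h * a) * g z + (f (z + h) - f z - h * a) * (g (z + h) - g z)
  + h * (a * (g (z + h) - g z)) + f z * (g (z + h) - g z - h * b) by ring.
set u := f (z + h) - f z - h * a in k1 *; set v := g (z + h) - g z in k0 k2 *.
set w := v - h * b in k2 *.
have T : cabs (u * g z + u * v + h * (a * v) + f z * w) <=
   cabs u * cabs (g z) + cabs u * cabs v + cabs h * (cabs a * cabs v) + cabs (f z) * cabs w.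
  do 3![apply: le_trans (cabsD _ _) _; rewrite !cabsM; apply: lerD => //].
apply: le_trans T _.
have hh := cabs_ge0 h; have hu := cabs_ge0 u; have hv := cabs_ge0 v; have hw := cabs_ge0 w.
have hf := cabs_ge0 (f z); have hg := cabs_ge0 (g z); have ha := cabs_ge0 a.
have e1M : e1 * M <= e / 4.
  have : e1 <= e / (4 * M) by rewrite ge_min lexx orbT.
  rewrite ler_pdivlMr ?mulr_gt0 //; lra.
have e11 : e1 <= 1 by rewrite ge_min lexx.
have hM : cabs h * (M * M) <= e / 4.
  move: h4; rewrite ltr_pdivlMr ?mulr_gt0 //; lra.
have t1 : cabs u * cabs (g z) <= (e / 4) * cabs h.
  apply: le_trans (_ : (e1 * cabs h) * M <= _); last by nra.
  by apply: ler_pM => //; rewrite /M; lra.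
have t2 : cabs u * cabs v <= (e / 4) * cabs h.
  apply: le_trans (_ : (e1 * cabs h) * (B * cabs h) <= _); first by apply: ler_pM.
  apply: le_trans (_ : (e1 * cabs h) * M <= _); last by nra.
  rewrite ler_pM // ?mulr_ge0 // ltW //.
  apply: lt_le_trans (_ : B * 1 <= _); first by rewrite ltr_pM2l.
  by rewrite /M; lra.
have t3 : cabs h * (cabs a * cabs v) <= (e / 4) * cabs h.
  rewrite [leRHS]mulrC ler_wpM2l //.
  apply: le_trans (_ : M * (M * cabs h) <= _); last by nra.
  apply: ler_pM => //; first by rewrite /M; lra.
  by apply: le_trans k0 _; rewrite ler_wpM2r // /M; lra.
have t4 : cabs (f z) * cabs w <= (e / 4) * cabs h.
  rewrite mulrC; apply: le_trans (_ : (e1 * cabs h) * M <= _); last by nra.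
  by apply: ler_pM => //; rewrite /M; lra.
lra.
Qed.

Lemma cderiv_affine (a b z : R[i]) : cderiv (fun w => a * w + b) z a.
Proof.
move=> e e0; exists 1 => // h _.
have -> : a * (z + h) + b - (a * z + b) - h * a = 0 by ring.
by rewrite cabs0 mulr_ge0 ?cabs_ge0 ?ltW.
Qed.

Lemma cderivV f z a : cderiv f z a -> f z != 0 ->
  cderiv (fun w => (f w)^-1) z (- a / (f z) ^+ 2).
Proof.
move=> Hf f0 e e0.
have [d0 d00 H0] := cderiv_lipschitz Hf.
set B := 1 + cabs a in H0.
have B0 : 0 < B by have := cabs_ge0 a; rewrite /B; lra.
have m0 := cabs_gt0 f0; set m := cabs (f z) in m0.
have e10 : 0 < e * m ^+ 2 / 4 by rewrite divr_gt0 // mulr_gt0 // exprn_gt0.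
have [d1 d10 H1] := Hf _ e10.
(* [d2] keeps [cabs (f (z + h))] above [m / 2]; [d3] controls the second-order term. *)
set d2 := m / (2 * B).
have d20 : 0 < d2 by rewrite divr_gt0 // mulr_gt0.
set d3 := e * m ^+ 3 / (4 * (B * B)).
have d30 : 0 < d3 by rewrite divr_gt0 ?mulr_gt0 // exprn_gt0.
exists (Num.min (Num.min d0 d1) (Num.min d2 d3)); first by rewrite !lt_min d00 d10 d20 d30.
move=> h; rewrite !lt_min => /andP[/andP[/H0 k0 /H1 k1] /andP[h2 h3]].
have hh := cabs_ge0 h.
have hB : cabs h * (2 * B) < m by rewrite -ltr_pdivlMr // mulr_gt0.
have hB2 : cabs h * (4 * (B * B)) < e * m ^+ 3 by rewrite -ltr_pdivlMr // ?mulr_gt0.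
set w := f (z + h) in k0 k1 *.
have wm : m / 2 <= cabs w.
  by have := cabsB (f z) (f z - w); rewrite subKr -/m (cabsBC (f z)); nra.
have w0 : w != 0.
  by apply: contraTneq wm => ->; rewrite cabs0 -ltNge divr_gt0.
have -> : w^-1 - (f z)^-1 - h * (- a / f z ^+ 2) =
  (- (f z * (w - f z - h * a)) + h * a * (w - f z)) / (w * f z ^+ 2).
  by field; rewrite f0 w0.
rewrite cabsM cabsV ler_pdivrMr; last first.
  by rewrite cabsM cabsX mulr_gt0 ?exprn_gt0 // (lt_le_trans _ wm) // divr_gt0.
apply: le_trans (cabsD _ _) _; rewrite cabsN !(cabsM (f z) (w - f z - h * a), cabsM (h * a), cabsM h a, cabsM w) cabsX -/m.
set u := cabs (w - f z - h * a) in k1 *; set v := cabs (w - f z) in k0 *.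
have u0 : 0 <= u by exact: cabs_ge0.
have v0 : 0 <= v by exact: cabs_ge0.
have a0 := cabs_ge0 a.
have t1 : m * u <= m * (e * m ^+ 2 / 4 * cabs h) by rewrite ler_pM2l.
have t2 : cabs h * cabs a * v <= cabs h * (e * m ^+ 3 / 4).
  rewrite -mulrA ler_wpM2l //; apply: le_trans (_ : B * (B * cabs h) <= _); last by nra.
  by apply: ler_pM => //; rewrite /B; lra.
have t3 : e * cabs h * ((m / 2) * m ^+ 2) <= e * cabs h * (cabs w * m ^+ 2).
  by rewrite ler_wpM2l ?mulr_ge0 ?(ltW e0) // ler_wpM2r // exprn_ge0 // ltW.
move: t1 t2 t3; rewrite !exprS expr0 mulr1; lra.
Qed.

Lemma cderiv_comp f g z a b : cderiv g z a -> cderiv f (g z) b ->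
  cderiv (fun w => f (g w)) z (a * b).
Proof.
move=> Hg Hf e e0.
have [d0 d00 H0] := cderiv_lipschitz Hg.
set B := 1 + cabs a in H0.
have B0 : 0 < B by have := cabs_ge0 a; rewrite /B; lra.
set M := 1 + cabs b.
have M0 : 0 < M by have := cabs_ge0 b; rewrite /M; lra.
have e1 : 0 < e / (2 * B) by rewrite divr_gt0 ?mulr_gt0.
have e2 : 0 < e / (2 * M) by rewrite divr_gt0 ?mulr_gt0.
have [d1 d10 H1] := Hf _ e1; have [d2 d20 H2] := Hg _ e2.
have d30 : 0 < d1 / B by rewrite divr_gt0.
exists (Num.min (Num.min d0 d2) (d1 / B)); first by rewrite !lt_min d00 d20 d30.
move=> h; rewrite !lt_min => /andP[/andP[/H0 k0 /H2 k2] h1].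
have hB : B * cabs h < d1 by rewrite mulrC -ltr_pdivlMr.
have := H1 _ (le_lt_trans k0 hB); rewrite subrKC => k1.
have -> : f (g (z + h)) - f (g z) - h * (a * b) =
  (f (g (z + h)) - f (g z) - (g (z + h) - g z) * b) + (g (z + h) - g z - h * a) * b.
  by ring.
apply: le_trans (cabsD _ _) _; rewrite cabsM.
have hh := cabs_ge0 h; have b0 := cabs_ge0 b.
have t1 : e / (2 * B) * cabs (g (z + h) - g z) <= e / 2 * cabs h.
  apply: le_trans (_ : e / (2 * B) * (B * cabs h) <= _).
    by rewrite ler_wpM2l // ltW.
  by rewrite le_eqVlt; apply/orP; left; apply/eqP; field; rewrite gt_eqF.
have t2 : cabs (g (z + h) - g z - h * a) * cabs b <= e / 2 * cabs h.
  apply: le_trans (_ : e / (2 * M) * cabs h * M <= _).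
    by apply: ler_pM => //; rewrite ?cabs_ge0 // /M; lra.
  by rewrite le_eqVlt; apply/orP; left; apply/eqP; field; rewrite gt_eqF.
lra.
Qed.

End ComplexDerivative.

(** * Goursat's theorem for rectangles and for punctured squares *)

Section Goursat.
Variable R : realType.
Implicit Types (f : R[i] -> R[i]) (a b c e : R).

Lemma nested_point (a l : nat -> R) :
  (forall n, a n <= a n.+1) -> (forall n, a n.+1 + l n.+1 <= a n + l n) ->
  (forall n, 0 <= l n) -> exists x, forall n, a n <= x <= a n + l n.
Proof.
move=> ha hl l0.
have ma m k : a m <= a (m + k)%N.
  by elim: k => [|k IH]; rewrite ?addn0 // addnS (le_trans IH).
have ml m k : a (m + k)%N + l (m + k)%N <= a m + l m.
  by elim: k => [|k IH]; rewrite ?addn0 // addnS (le_trans (hl _)).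
have am m n : a m <= a n + l n.
  case: (leqP m n) => [|/ltnW] /subnKC <-.
    by apply: le_trans (ma m (n - m)%N) _; rewrite lerDl.
  by apply: le_trans (ml n (m - n)%N); rewrite lerDl.
have S : has_sup [set a n | n in setT].
  by split; [exists (a 0%N), 0%N|exists (a 0%N + l 0%N) => _ [m _ <-]].
exists (sup [set a n | n in setT]) => n; apply/andP; split.
  by apply: sup_upper_bound => //; exists n.
by apply: ge_sup => [|_ [m _ <-]]; [exists (a 0%N), 0%N|].
Qed.

Lemma cont_epsilon (p : R -> R) (x : R) :
  (forall e, 0 < e -> exists2 del, 0 < del & forall y, `|y - x| < del -> `|p y - p x| < e) ->
  {for x, continuous p}.
Proof.
move=> H; apply/cvgrPdist_lt => e /H [del del0 K]; apply/nbhs_ballP.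
exists del => //= y; rewrite /ball /= distrC => /K; by rewrite distrC.
Qed.

Lemma cdiff_edge f (p : R -> R[i]) (x : R) (v : R[i]) :
  (forall y, p y = p x + rC (y - x) * v) -> cabs v = 1 -> cdiff f (p x) ->
  {for x, continuous (fun y => complex.Re (f (p y)))} /\
  {for x, continuous (fun y => complex.Im (f (p y)))}.
Proof.
move=> pE v1 fd.
have H e : 0 < e -> exists2 del : R, 0 < del &
    forall y, `|y - x| < del -> cabs (f (p y) - f (p x)) < e.
  move=> e0; have [del del0 K] := cdiff_continuous fd e0; exists del => // y yx.
  by rewrite pE; apply: K; rewrite cabsM v1 mulr1 cabs_rC.
split; apply: cont_epsilon => e /H [del del0 K]; exists del => // y /K;
  apply: le_lt_trans.
  by rewrite -cReN -cReD normRe_le.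
by rewrite -cImN -cImD normIm_le.
Qed.

Lemma cdiff_edge_re f (b y : R) : cdiff f (Complex b y) ->
  {for y, continuous (fun t => complex.Re (f (Complex b t)))}.
Proof.
move=> fd; apply: (proj1 (@cdiff_edge f (Complex b) y (Complex 0 1) _ _ fd)).
  by move=> t; rewrite /rC; simpc; rewrite subrKC.
by rewrite /cabs expr0n add0r expr1n sqrtr1.
Qed.

Lemma cdiff_edge_im f (c x : R) : cdiff f (Complex x c) ->
  {for x, continuous (fun t => complex.Im (f (Complex t c)))}.
Proof.
move=> fd; apply: (proj2 (@cdiff_edge f (fun t => Complex t c) x 1 _ (cabs1 _) fd)).
by move=> t; rewrite mulr1 /rC; simpc; rewrite subrKC.
Qed.

Definition diff_rect f a b c e :=
  forall x y, a <= x <= b -> c <= y <= e -> cdiff f (Complex x y).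

(* The imaginary part of the contour integral of f along the boundary of
   [a, b] x [c, e]; the real part is never needed. *)
Definition rect_int f a b c e : R :=
  sint (fun x => complex.Im (f (Complex x c))) a b
  - sint (fun x => complex.Im (f (Complex x e))) a b
  + sint (fun y => complex.Re (f (Complex b y))) c e
  - sint (fun y => complex.Re (f (Complex a y))) c e.

Lemma rect_int_splitx f a m b c e : a <= m -> m <= b -> c <= e ->
  (forall x, a <= x <= b -> cdiff f (Complex x c) /\ cdiff f (Complex x e)) ->
  rect_int f a b c e = rect_int f a m c e + rect_int f m b c e.
Proof.
move=> am mb ce fd; rewrite /rect_int.
rewrite (@sint_split _ (fun x => complex.Im (f (Complex x c))) a m b) //; last first.
  by move=> x /fd [h _]; exact: cdiff_edge_im.
rewrite (@sint_split _ (fun x => complex.Im (f (Complex x e))) a m b) //; last first.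
  by move=> x /fd [_ h]; exact: cdiff_edge_im.
ring.
Qed.

Lemma rect_int_splity f a b c m e : a <= b -> c <= m -> m <= e ->
  (forall y, c <= y <= e -> cdiff f (Complex a y) /\ cdiff f (Complex b y)) ->
  rect_int f a b c e = rect_int f a b c m + rect_int f a b m e.
Proof.
move=> ab cm me fd; rewrite /rect_int.
rewrite (@sint_split _ (fun y => complex.Re (f (Complex b y))) c m e) //; last first.
  by move=> x /fd [_ h]; exact: cdiff_edge_re.
rewrite (@sint_split _ (fun y => complex.Re (f (Complex a y))) c m e) //; last first.
  by move=> x /fd [h _]; exact: cdiff_edge_re.
ring.
Qed.

(** The contour integral of [A + B z] vanishes ([Z] below), so only the deviation from it counts,
    integrated over the perimeter. The hypotheses concern the boundary alone, so that the bound also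
    applies around a singularity. *)
Lemma rect_int_approx f a b c e (A B : R[i]) (eps : R) : a <= b -> c <= e ->
  (forall x y, a <= x <= b -> c <= y <= e -> [|| x == a, x == b, y == c | y == e] ->
     cdiff f (Complex x y)) ->
  (forall x y, a <= x <= b -> c <= y <= e -> [|| x == a, x == b, y == c | y == e] ->
     cabs (f (Complex x y) - (A + B * Complex x y)) <= eps) ->
  `|rect_int f a b c e| <= 2 * eps * ((b - a) + (e - c)).
Proof.
move=> ab ce fd H; case: A B H => [A1 A2] [B1 B2] H.
have aab : a <= a <= b by rewrite lexx.
have bab : a <= b <= b by rewrite lexx andbT.
have cce : c <= c <= e by rewrite lexx.
have ece : c <= e <= e by rewrite lexx andbT.
have HI x y : a <= x <= b -> c <= y <= e -> [|| x == a, x == b, y == c | y == e] ->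
    `|complex.Im (f (Complex x y)) - ((A2 + B1 * y) + B2 * x)| <= eps.
  move=> hx hy xy; apply: le_trans (H x y hx hy xy); apply: le_trans (normIm_le _).
  rewrite cImD cImN /= le_eqVlt; apply/orP; left; apply/eqP; congr `|_|; ring.
have HR x y : a <= x <= b -> c <= y <= e -> [|| x == a, x == b, y == c | y == e] ->
    `|complex.Re (f (Complex x y)) - ((A1 + B1 * x) + (- B2) * y)| <= eps.
  move=> hx hy xy; apply: le_trans (H x y hx hy xy); apply: le_trans (normRe_le _).
  rewrite cReD cReN /= le_eqVlt; apply/orP; left; apply/eqP; congr `|_|; ring.
have oc x : [|| x == a, x == b, c == c | c == e] by rewrite eqxx !orbT.
have oe x : [|| x == a, x == b, e == c | e == e] by rewrite eqxx !orbT.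
have oa y : [|| a == a, a == b, y == c | y == e] by rewrite eqxx.
have ob y : [|| b == a, b == b, y == c | y == e] by rewrite eqxx !orbT.
have i1 := sint_approx ab (fun x hx => cdiff_edge_im (fd x c hx cce (oc x)))
  (fun x hx => HI x c hx cce (oc x)).
have i2 := sint_approx ab (fun x hx => cdiff_edge_im (fd x e hx ece (oe x)))
  (fun x hx => HI x e hx ece (oe x)).
have i3 := sint_approx ce (fun y hy => cdiff_edge_re (fd b y bab hy (ob y)))
  (fun y hy => HR b y bab hy (ob y)).
have i4 := sint_approx ce (fun y hy => cdiff_edge_re (fd a y aab hy (oa y)))
  (fun y hy => HR a y aab hy (oa y)).
rewrite /rect_int; move: i1 i2 i3 i4.
set s1 := sint _ _ _; set s2 := sint _ _ _; set s3 := sint _ _ _; set s4 := sint _ _ _.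
set t1 := _ + _ / 2; set t2 := _ + _ / 2; set t3 := _ + _ / 2; set t4 := _ + _ / 2.
have Z : t1 - t2 + t3 - t4 = 0 by rewrite /t1 /t2 /t3 /t4; field.
by rewrite !ler_norml; lra.
Qed.

(** The integrals over the inner edges cancel, so the four quarters add up to the whole and one of
    them carries at least a fourth of it. *)
Lemma rect_int_quarter f a c w h : 0 <= w -> 0 <= h ->
  diff_rect f a (a + w) c (c + h) ->
  exists a' c', [/\ a <= a', a' + w / 2 <= a + w, c <= c', c' + h / 2 <= c + h &
    `|rect_int f a (a + w) c (c + h)| <=
    4 * `|rect_int f a' (a' + w / 2) c' (c' + h / 2)|].
Proof.
move=> w0 h0 fd.
have am : a <= a + w / 2 by lra.
have mb : a + w / 2 <= a + w by lra.
have cm : c <= c + h / 2 by lra.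
have me : c + h / 2 <= c + h by lra.
rewrite (rect_int_splitx am mb); [|lra|]; last first.
  by move=> x hx; split; apply: fd => //; rewrite lexx /=; lra.
rewrite (rect_int_splity am cm me); last first.
  by move=> y hy; split; apply: fd => //; apply/andP; split; lra.
rewrite (rect_int_splity mb cm me); last first.
  by move=> y hy; split; apply: fd => //; apply/andP; split; lra.
have -> : a + w = a + w / 2 + w / 2 by field.
have -> : c + h = c + h / 2 + h / 2 by field.
set j1 := rect_int f a _ c _; set j2 := rect_int f a _ _ (_ + _ + _).
set j3 := rect_int f _ _ c _; set j4 := rect_int f _ _ _ (_ + _ + _).
have T : `|j1 + j2 + (j3 + j4)| <= `|j1| + `|j2| + `|j3| + `|j4|.
  rewrite [leRHS](_ : _ = `|j1| + `|j2| + (`|j3| + `|j4|)); last by ring.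
  by apply: le_trans (ler_normD _ _) _; apply: lerD; exact: ler_normD.
case: (lerP (`|j1 + j2 + (j3 + j4)|) (4 * `|j1|)) => [k1|k1].
  by exists a, c; split => //; lra.
case: (lerP (`|j1 + j2 + (j3 + j4)|) (4 * `|j2|)) => [k2|k2].
  by exists a, (c + h / 2); split => //; lra.
case: (lerP (`|j1 + j2 + (j3 + j4)|) (4 * `|j3|)) => [k3|k3].
  by exists (a + w / 2), c; split => //; lra.
by exists (a + w / 2), (c + h / 2); split => //; lra.
Qed.

Lemma expr_small (q x : R) : 0 <= q < 1 -> 0 < x ->
  exists N, forall n, (N <= n)%N -> q ^+ n < x.
Proof.
move=> /andP[q0 q1] x0.
have /cvg_expr/cvgrPdist_lt/(_ x x0) [N _ H] : `|q| < 1 by rewrite ger0_norm.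
exists N => n Nn; have := H n Nn.
by rewrite /= sub0r normrN; apply: le_lt_trans; exact: ler_norm.
Qed.

Theorem goursat_rect f a b c e : a <= b -> c <= e -> diff_rect f a b c e ->
  rect_int f a b c e = 0.
Proof.
move=> ab ce fd.
pose w n : R := (b - a) / 2 ^+ n; pose h n : R := (e - c) / 2 ^+ n.
have p2 n : 0 < 2 ^+ n :> R by rewrite exprn_gt0.
have w0 n : 0 <= w n by rewrite divr_ge0 ?subr_ge0 // ltW.
have h0 n : 0 <= h n by rewrite divr_ge0 ?subr_ge0 // ltW.
have wS n : w n.+1 = w n / 2 by rewrite /w exprS; field; rewrite gt_eqF.
have hS n : h n.+1 = h n / 2 by rewrite /h exprS; field; rewrite gt_eqF.
pose inR n (s : R * R) := [/\ a <= s.1, s.1 + w n <= b, c <= s.2 & s.2 + h n <= e].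
pose I n (s : R * R) := rect_int f s.1 (s.1 + w n) s.2 (s.2 + h n).
have step n (s : R * R) : {s' : R * R | inR n s ->
    [/\ s.1 <= s'.1, s'.1 + w n.+1 <= s.1 + w n, s.2 <= s'.2,
        s'.2 + h n.+1 <= s.2 + h n & `|I n s| <= 4 * `|I n.+1 s'|]}.
  apply: cid; have [[s1 s2 s3 s4]|ns] := pselect (inR n s); last by exists s.
  have [|a' [c' [h1 h2 h3 h4 h5]]] := @rect_int_quarter f s.1 s.2 _ _ (w0 n) (h0 n).
    by move=> x y hx hy; apply: fd; lra.
  by exists (a', c') => _; rewrite /I !wS !hS.
pose S := fix S n := if n is m.+1 then sval (step m (S m)) else (a, c).
have SR n : inR n (S n).
  elim: n => [|n IH].
    by rewrite /inR /= /w /h expr0 !divr1 !subrKC.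
  have [] := svalP (step n (S n)) IH => h1 h2 h3 h4 _; case: IH => k1 k2 k3 k4.
  by split; rewrite /=; lra.
have SS n := svalP (step n (S n)) (SR n).
have [x hx] : exists x, forall n, (S n).1 <= x <= (S n).1 + w n.
  by apply: nested_point => // n; case: (SS n).
have [y hy] : exists y, forall n, (S n).2 <= y <= (S n).2 + h n.
  by apply: nested_point => // n; case: (SS n).
have J n : `|rect_int f a b c e| <= 4 ^+ n * `|I n (S n)|.
  elim: n => [|n IH].
    by rewrite expr0 mul1r /I /= /w /h expr0 !divr1 !subrKC.
  apply: le_trans IH _; rewrite exprSr -mulrA ler_pM2l ?exprn_gt0 //.
  by case: (SS n).
have [||A fA] := fd x y.
- by have := hx 0%N; rewrite /= /w expr0 divr1 subrKC.
- by have := hy 0%N; rewrite /= /h expr0 divr1 subrKC.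
apply/eqP; rewrite -normr_le0; apply/ler_addgt0Pr => eps eps0; rewrite add0r.
set d := (b - a) + (e - c).
have d0 : 0 <= d by rewrite /d; lra.
have d1 : 0 < d + 1 by lra.
(* Undoing [N] subdivisions costs [4^N], while diameter and perimeter each shrink by [2^N]; what
   remains is [2 eta d^2]. Using [d + 1] keeps the quotient meaningful for a rectangle reduced to a
   point. *)
pose eta := eps / (2 * (d + 1) ^+ 2).
have eta0 : 0 < eta by rewrite divr_gt0 // mulr_gt0 // exprn_gt0.
have [del del0 H] := fA eta eta0.
have half01 : 0 <= (2^-1 : R) < 1.
  by apply/andP; split; [rewrite invr_ge0|rewrite invf_lt1 // ltr1n].
have [N HN] := @expr_small (2^-1) _ half01 (divr_gt0 del0 d1).
have := HN N (leqnn N); rewrite exprVn ltr_pdivlMr // => sm.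
apply: le_trans (J N) _.
have [s1 s2 s3 s4] := SR N.
have dist u v : (S N).1 <= u <= (S N).1 + w N -> (S N).2 <= v <= (S N).2 + h N ->
    cabs (Complex u v - Complex x y) <= d / 2 ^+ N.
  move=> hu hv; apply: le_trans (cabs_le_ReIm _) _; rewrite !cReImE /=.
  have -> : d / 2 ^+ N = w N + h N by rewrite /d /w /h; field; rewrite gt_eqF.
  have := hx N; have := hy N => ? ?.
  by apply: lerD; rewrite ler_norml; lra.
have := @rect_int_approx f (S N).1 ((S N).1 + w N) (S N).2 ((S N).2 + h N)
  (f (Complex x y) - A * Complex x y) A (eta * (d / 2 ^+ N)).
rewrite !lerDl w0 h0 => /(_ isT isT) K.
have {}K : `|I N (S N)| <= 2 * (eta * (d / 2 ^+ N)) * (d / 2 ^+ N).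
  have -> : d / 2 ^+ N = w N + h N by rewrite /d /w /h; field; rewrite gt_eqF.
  rewrite /I; move: K; rewrite ![_ + _ - _]addrC !addKr.
  have -> : d / 2 ^+ N = w N + h N by rewrite /d /w /h; field; rewrite gt_eqF.
  apply.
    by move=> u v hu hv _; apply: fd; lra.
  move=> u v hu hv _; have D := dist u v hu hv.
  have Dd : cabs (Complex u v - Complex x y) < del.
    apply: le_lt_trans D _; apply: le_lt_trans _ sm.
    by rewrite mulrC ler_wpM2l ?invr_ge0 ?ltW //; lra.
  have := H _ Dd; rewrite subrKC.
  have -> : f (Complex u v) - f (Complex x y) - (Complex u v - Complex x y) * A =
    f (Complex u v) - (f (Complex x y) - A * Complex x y + A * Complex u v) by ring.
  move=> /le_trans; apply; rewrite ler_wpM2l ?(ltW eta0) //.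
  have <- : d / 2 ^+ N = w N + h N by rewrite /d /w /h; field; rewrite gt_eqF.
  exact: D.
apply: le_trans (_ : 4 ^+ N * (2 * (eta * (d / 2 ^+ N)) * (d / 2 ^+ N)) <= _).
  by rewrite ler_pM2l // exprn_gt0.
have -> : 4 ^+ N = 2 ^+ N * 2 ^+ N :> R by rewrite -exprMn; congr (_ ^+ _); ring.
have -> : 2 ^+ N * 2 ^+ N * (2 * (eta * (d / 2 ^+ N)) * (d / 2 ^+ N)) = 2 * eta * d ^+ 2.
  by field; rewrite gt_eqF.
have E : eps = 2 * eta * (d + 1) ^+ 2.
  by rewrite /eta; field; rewrite gt_eqF.
have eta2 : 0 <= 2 * eta by lra.
by rewrite [leRHS]E ler_wpM2l //; nra.
Qed.

Definition diff_punctured f (r : R) := forall x y, - r <= x <= r -> - r <= y <= r ->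
  Complex x y != 0 -> cdiff f (Complex x y).

(** The lines [y = -s], [y = s], [x = -s], [x = s] cut the frame between the squares into four
    rectangles that avoid the origin, and Goursat's theorem removes each of them. *)
Lemma rect_int_shrink f (r s : R) : 0 < s -> s <= r -> diff_punctured f r ->
  rect_int f (- r) r (- r) r = rect_int f (- s) s (- s) s.
Proof.
move=> s0 sr fd.
have nzx x y : x != 0 -> Complex x y != 0.
  by apply: contra => /eqP [->].
have nzy x y : y != 0 -> Complex x y != 0.
  by apply: contra => /eqP [_ ->].
have rs : - r <= - s by lra.
have ss : - s <= s by lra.
have rr : - r <= r by lra.
have hr x y : - r <= y <= r -> (x == - r) || (x == r) -> cdiff f (Complex x y).
  move=> hy hx; apply: fd => //.
    by case/orP: hx => /eqP ->; lra.
  by apply: nzx; case/orP: hx => /eqP ->; [rewrite oppr_eq0|]; rewrite gt_eqF //; lra.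
have hs x y : - r <= x <= r -> (y == - s) || (y == s) -> cdiff f (Complex x y).
  move=> hx hy; apply: fd => //.
    by case/orP: hy => /eqP ->; lra.
  by apply: nzy; case/orP: hy => /eqP ->; [rewrite oppr_eq0|]; rewrite gt_eqF //; lra.
rewrite (@rect_int_splity _ _ _ _ (- s)) //; [|lra|]; last first.
  by move=> y hy; split; apply: hr; rewrite ?eqxx ?orbT.
rewrite goursat_rect ?add0r //; last first.
  move=> x y hx hy; apply: fd => //; first by lra.
  by apply: nzy; rewrite lt_eqF //; lra.
rewrite (@rect_int_splity _ _ _ _ s) //; last first.
  by move=> y hy; split; apply: hr; rewrite ?eqxx ?orbT //; lra.
rewrite [X in _ + X]goursat_rect ?addr0 //; last first.
  move=> x y hx hy; apply: fd => //; first by lra.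
  by apply: nzy; rewrite gt_eqF //; lra.
rewrite (@rect_int_splitx _ _ (- s)) //; [|lra|]; last first.
  by move=> x hx; split; apply: hs; rewrite ?eqxx ?orbT.
rewrite goursat_rect ?add0r //; last first.
  move=> x y hx hy; apply: fd => //; try lra.
  by apply: nzx; rewrite lt_eqF //; lra.
rewrite (@rect_int_splitx _ _ s) //; last first.
  by move=> x hx; split; apply: hs; rewrite ?eqxx ?orbT //; lra.
rewrite [X in _ + X]goursat_rect ?addr0 //.
move=> x y hx hy; apply: fd => //; try lra.
by apply: nzx; rewrite gt_eqF //; lra.
Qed.

Lemma goursat_punctured f (r : R) : 0 < r -> diff_punctured f r ->
  (forall e : R, 0 < e -> exists2 del : R, 0 < del & forall h, 0 < cabs h < del ->
     cabs h * cabs (f h) <= e) ->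
  rect_int f (- r) r (- r) r = 0.
Proof.
move=> r0 fd H; apply/eqP; rewrite -normr_le0; apply/ler_addgt0Pr => e e0; rewrite add0r.
(* The square of half side [s] has perimeter [8 s], and its boundary points have modulus at least
   [s], so that [f] is bounded there by [e / (8 s)]. They have modulus at most [2 s], whence
   [del / 3] below. *)
have e8 : 0 < e / 8 by lra.
have [del del0 K] := H _ e8.
set s := Num.min r (del / 3).
have s0 : 0 < s by rewrite lt_min r0 divr_gt0.
have sr : s <= r by rewrite ge_min lexx.
have sd : s <= del / 3 by rewrite ge_min lexx orbT.
rewrite (rect_int_shrink s0 sr fd).
have ss : - s <= s by lra.
have big x y : - s <= x <= s -> - s <= y <= s -> [|| x == - s, x == s, y == - s | y == s] ->
    s <= cabs (Complex x y).
  move=> hx hy hxy.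
  have : s <= `|x| \/ s <= `|y|.
    have ns : `|s| = s by rewrite gtr0_norm.
    by case/or4P: hxy => /eqP ->; rewrite ?normrN ns; [left|left|right|right].
  by case=> /le_trans; apply; [exact: (normRe_le (Complex x y))|exact: (normIm_le (Complex x y))].
apply: le_trans (@rect_int_approx f (- s) s (- s) s 0 0 (e / 8 / s) ss ss _ _) _.
- move=> x y hx hy hxy; apply: fd; try lra.
  by apply: contraTneq (big x y hx hy hxy) => ->; rewrite cabs0 -ltNge.
- move=> x y hx hy hxy; rewrite mul0r addr0 subr0 ler_pdivlMr //.
  have b := big x y hx hy hxy.
  have : cabs (Complex x y) * cabs (f (Complex x y)) <= e / 8.
    apply: K; rewrite (lt_le_trans s0 b) andTb.
    apply: le_lt_trans (cabs_le_ReIm _) _ => /=.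
    have : `|x| <= s by rewrite ler_norml.
    have : `|y| <= s by rewrite ler_norml.
    lra.
  by apply: le_trans; rewrite mulrC ler_wpM2r // cabs_ge0.
- rewrite le_eqVlt; apply/orP; left; apply/eqP; field; by rewrite gt_eqF.
Qed.

End Goursat.

(** * Cauchy estimates *)

Section CauchyEstimate.
Variable R : realType.
Implicit Types (f : R[i] -> R[i]) (w h : R[i]).

(** Subtracting [1/h] from the difference quotient divided by [m h] leaves a function [g] with
    [h * g h] tending to 0, so its integral over a small square vanishes. The integral of [1/h] has
    imaginary part [2 pi], but the crude lower bound 1 per edge is enough: balanced against the
    bound [2 M] for the increment of [f] it gives [cabs m <= 4 M / s], and [s = r / 3] keeps the
    square inside the disc. *)
Lemma cderiv_bound f w m (r M : R) : 0 < r ->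
  (forall h, cabs h < r -> cdiff f (w + h)) ->
  (forall h, cabs h < r -> cabs (f (w + h)) <= M) ->
  cderiv f w m -> cabs m <= 12 * M / r.
Proof.
move=> r0 fd fM fm.
have M0 : 0 <= M.
  by apply: le_trans (fM 0 _); rewrite ?cabs_ge0 // cabs0.
rewrite leNgt; apply/negP => mb.
have mp : 0 < cabs m by apply: le_lt_trans mb; rewrite divr_ge0 ?mulr_ge0 // ltW.
have m0 : m != 0 by apply: contraTneq mp => ->; rewrite cabs0 ltxx.
set s := r / 3.
have s0 : 0 < s by rewrite divr_gt0.
have ns : - s <= s by lra.
pose g h := (f (w + h) - f w) * (m * h ^+ 2)^-1 - h^-1.
have inr x y : - s <= x <= s -> - s <= y <= s -> cabs (Complex x y) < r.
  move=> hx hy; apply: le_lt_trans (cabs_le_ReIm _) _; rewrite [complex.Re _]/= [complex.Im _]/=.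
  have : `|x| <= s by rewrite ler_norml.
  have : `|y| <= s by rewrite ler_norml.
  rewrite /s; lra.
have gd : diff_punctured g s.
  move=> x y hx hy; set z := Complex x y => z0.
  have [a fa] := fd z (inr x y hx hy).
  have d1 : cderiv (fun h => f (w + h) + (- f w)) z (1 * a + 0).
    apply: cderivD.
      apply: (@cderiv_comp _ f (fun h => w + h)) => //.
      have := cderiv_affine 1 w z; congr cderiv; apply: funext => h.
      by rewrite mul1r addrC.
    have := cderiv_affine 0 (- f w) z; congr cderiv; apply: funext => h.
    by rewrite mul0r add0r.
  have d2 : cderiv (fun h => h) z 1.
    have := cderiv_affine 1 0 z; congr cderiv; apply: funext => h.
    by rewrite mul1r addr0.
  have d3 : cderiv (fun h => m * h ^+ 2) z (m * (1 * z + z * 1)).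
    have := cderivM (cderiv_affine 0 m z) (cderivM d2 d2).
    rewrite !(mul0r, add0r) => h; have -> // : (fun h => m * h ^+ 2) = (fun h => (0 * h + m) * (h * h)).
    by apply: funext => k; rewrite mul0r add0r expr2.
  have mz : m * z ^+ 2 != 0 by rewrite mulf_neq0 // expf_neq0.
  have d4 := cderivM d1 (cderivV d3 mz).
  have d5 := cderivM (cderiv_affine 0 (-1) z) (cderivV d2 z0).
  eexists; have := cderivD d4 d5; congr cderiv; apply: funext => h.
  by rewrite /g mul0r add0r mulN1r.
have gs : forall e : R, 0 < e -> exists2 del : R, 0 < del & forall h, 0 < cabs h < del ->
     cabs h * cabs (g h) <= e.
  move=> e e0; have [del del0 K] := fm (e * cabs m) (mulr_gt0 e0 mp).
  exists del => // h /andP[h0 hd]; have := K h hd.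
  have hn : h != 0 by apply: contraTneq h0 => ->; rewrite cabs0 ltxx.
  have E : f (w + h) - f w - h * m = (h * g h) * (m * h).
    by rewrite /g; field; rewrite m0 hn.
  rewrite E cabsM [cabs (m * h)]cabsM cabsM -[leRHS]mulrA ler_pM2r //.
  by rewrite mulr_gt0.
have Z := goursat_punctured s0 gd gs.
(* With the sign given by the orientation, the integrand is at most [B] on each of the four edges.
   Since the integral is 0, [B] cannot be negative, which is the estimate. *)
set B := 2 * M / (cabs m * s ^+ 2) - (2 * s)^-1.
have invE x y : (Complex x y)^-1 = Complex (x / (x ^+ 2 + y ^+ 2)) (- (y / (x ^+ 2 + y ^+ 2))).
  by [].
have ReC (u v : R) : complex.Re (Complex u v) = u by [].
have ImC (u v : R) : complex.Im (Complex u v) = v by [].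
have KB x y : - s <= x <= s -> - s <= y <= s -> s ^+ 2 <= x ^+ 2 + y ^+ 2 ->
    cabs ((f (w + Complex x y) - f w) * (m * (Complex x y) ^+ 2)^-1) <= 2 * M / (cabs m * s ^+ 2).
  move=> hx hy hxy; have c2 : s ^+ 2 <= cabs (Complex x y) ^+ 2 by rewrite cabs_sqr.
  rewrite cabsM cabsV cabsM cabsX; apply: ler_pM; rewrite ?cabs_ge0 //.
  - by rewrite invr_ge0 mulr_ge0 ?cabs_ge0 // exprn_ge0 // cabs_ge0.
  - have h1 := fM _ (inr x y hx hy).
    have h2 : cabs (f w) <= M by rewrite -{1}(addr0 w) fM // cabs0.
    by apply: le_trans (cabsD _ _) _; rewrite cabsN; lra.
  - have s2 : 0 < s ^+ 2 by rewrite exprn_gt0.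
    have c20 := lt_le_trans s2 c2.
    by rewrite lef_pV2 ?posrE; [rewrite ler_pM2l|exact: mulr_gt0 mp c20|exact: mulr_gt0 mp s2].
have half x y : x ^+ 2 = s ^+ 2 -> - s <= y <= s -> (2 * s)^-1 <= s / (x ^+ 2 + y ^+ 2).
  move=> xs hy; have s2 : 0 < s ^+ 2 by rewrite exprn_gt0.
  have y2 : 0 <= y ^+ 2 <= s ^+ 2 by rewrite sqr_ge0 /=; nra.
  rewrite xs ler_pdivlMr; last by lra.
  rewrite ler_pdivrMl ?mulr_gt0 //; nra.
have sS : - s <= s <= s by lra.
have Ss : - s <= - s <= s by lra.
have sq_ge (a b : R) : a ^+ 2 = s ^+ 2 -> s ^+ 2 <= a ^+ 2 + b ^+ 2 /\ s ^+ 2 <= b ^+ 2 + a ^+ 2.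
  by move=> ->; have := sqr_ge0 b; lra.
have sN : (- s) ^+ 2 = s ^+ 2 by rewrite sqrrN.
have nzx x y : x ^+ 2 = s ^+ 2 -> Complex x y != 0.
  move=> xs; apply: contraTneq s0 => -[x0 _]; move: xs; rewrite x0 expr0n => /esym/eqP.
  by rewrite sqrf_eq0 => /eqP ->; rewrite ltxx.
have nzy x y : y ^+ 2 = s ^+ 2 -> Complex x y != 0.
  move=> xs; apply: contraTneq s0 => -[_ x0]; move: xs; rewrite x0 expr0n => /esym/eqP.
  by rewrite sqrf_eq0 => /eqP ->; rewrite ltxx.
have ss2 : s - - s = 2 * s by ring.
have e1 : - (B * (2 * s)) <= - sint (fun y => complex.Re (g (Complex s y))) (- s) s.
  have := @sint_le_affine _ (fun y => complex.Re (g (Complex s y))) B 0 (- s) s ns _ _.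
  rewrite !mul0r addr0 ss2 => T; rewrite lerN2; apply: T => y hy.
    by apply: cdiff_edge_re; apply: gd => //; exact: nzx.
  have [q _] := sq_ge s y erefl; have := KB s y sS hy q; have := half s y erefl hy.
  rewrite /g invE mul0r addr0 cReD cReN /B ReC => h1 h2.
  have := Re_le_cabs ((f (w + Complex s y) - f w) * (m * Complex s y ^+ 2)^-1); lra.
have e2 : - (B * (2 * s)) <= sint (fun y => complex.Re (g (Complex (- s) y))) (- s) s.
  have := @sint_ge_affine _ (fun y => complex.Re (g (Complex (- s) y))) (- B) 0 (- s) s ns _ _.
  rewrite !mul0r addr0 ss2 mulNr => T; apply: T => y hy.
    by apply: cdiff_edge_re; apply: gd => //; exact: nzx.
  have [q _] := sq_ge (- s) y sN; have := KB (- s) y Ss hy q; have := half (- s) y sN hy.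
  rewrite /g invE mul0r addr0 cReD cReN /B ReC mulNr => h1 h2.
  have := normRe_le ((f (w + Complex (- s) y) - f w) * (m * Complex (- s) y ^+ 2)^-1).
  by rewrite ler_norml; lra.
have e3 : - (B * (2 * s)) <= - sint (fun x => complex.Im (g (Complex x (- s)))) (- s) s.
  have := @sint_le_affine _ (fun x => complex.Im (g (Complex x (- s)))) B 0 (- s) s ns _ _.
  rewrite !mul0r addr0 ss2 => T; rewrite lerN2; apply: T => y hy.
    by apply: cdiff_edge_im; apply: gd => //; exact: nzy.
  have [_ q] := sq_ge (- s) y sN; have := KB y (- s) hy Ss q; have := half (- s) y sN hy.
  rewrite /g invE mul0r addr0 cImD cImN /B ImC mulNr [(- s) ^+ 2 + _]addrC => h1 h2.
  have := normIm_le ((f (w + Complex y (- s)) - f w) * (m * Complex y (- s) ^+ 2)^-1).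
  by rewrite ler_norml; lra.
have e4 : - (B * (2 * s)) <= sint (fun x => complex.Im (g (Complex x s))) (- s) s.
  have := @sint_ge_affine _ (fun x => complex.Im (g (Complex x s))) (- B) 0 (- s) s ns _ _.
  rewrite !mul0r addr0 ss2 mulNr => T; apply: T => y hy.
    by apply: cdiff_edge_im; apply: gd => //; exact: nzy.
  have [_ q] := sq_ge s y erefl; have := KB y s hy sS q; have := half s y erefl hy.
  rewrite /g invE mul0r addr0 cImD cImN /B ImC [s ^+ 2 + _]addrC => h1 h2.
  have := normIm_le ((f (w + Complex y s) - f w) * (m * Complex y s ^+ 2)^-1).
  by rewrite ler_norml; lra.
have Bs : 0 <= B * (2 * s).
  move: Z e1 e2 e3 e4; rewrite /rect_int.
  set a1 := sint _ _ _; set a2 := sint _ _ _; set a3 := sint _ _ _; set a4 := sint _ _ _.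
  lra.
move: Bs; rewrite pmulr_lge0 ?mulr_gt0 // /B subr_ge0 ler_pdivlMr ?mulr_gt0 ?exprn_gt0 //.
have -> : (2 * s)^-1 * (cabs m * s ^+ 2) = cabs m * s / 2 by field; rewrite gt_eqF.
move: mb; rewrite ltr_pdivrMr // /s; lra.
Qed.
End CauchyEstimate.

(** * Lipschitz bounds for bounded functions and a Harnack inequality *)

Section CauchyLipschitz.
Variable R : realType.
Implicit Types (f : R[i] -> R[i]) (w h : R[i]).

Lemma is_derive_epsilon (p : R -> R) (s D : R) :
  (forall e : R, 0 < e -> exists2 del : R, 0 < del &
     forall t, `|t| < del -> `|p (s + t) - p s - t * D| <= e * `|t|) ->
  is_derive s 1 p D.
Proof.
move=> H.
have L : h^-1 *: (p (h *: 1 + s) - p s) @[h --> 0^'] --> D.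
  apply/cvgrPdist_le => e /H [del del0 K].
  near=> t.
  have t0 : t != 0 by near: t; exact: nbhs_dnbhs_neq.
  have td : `|t| < del by near: t; exact: dnbhs0_lt.
  have := K t td; rewrite -ler_pdivrMr ?normr_gt0 // -normfV -normrM.
  congr (_ <= _); rewrite -normrN; congr `|_|.
  by rewrite /GRing.scale /= mulr1 (addrC t s); field.
have dp : derivable p s 1 by apply/cvg_ex; exists D.
by apply: DeriveDef => //; apply/cvg_lim.
Unshelve. all: by end_near.
Qed.

Lemma is_derive_cderiv f w h m (s : R) : cderiv f (w + rC s * h) m ->
  is_derive s 1 (fun t => complex.Re (f (w + rC t * h))) (complex.Re (h * m)) /\
  is_derive s 1 (fun t => complex.Im (f (w + rC t * h))) (complex.Im (h * m)).
Proof.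
move=> fm.
have H e : 0 < e -> exists2 del : R, 0 < del & forall t, `|t| < del ->
    cabs (f (w + rC (s + t) * h) - f (w + rC s * h) - rC t * (h * m)) <= e * `|t|.
  move=> e0; have h1 : 0 < 1 + cabs h by have := cabs_ge0 h; lra.
  have [del del0 K] := fm (e / (1 + cabs h)) (divr_gt0 e0 h1).
  exists (del / (1 + cabs h)) => [|t]; first exact: divr_gt0.
  rewrite ltr_pdivlMr // => td.
  have := K (rC t * h); rewrite cabsM cabs_rC => {}K.
  have -> : w + rC (s + t) * h = w + rC s * h + rC t * h by rewrite rCD; ring.
  rewrite mulrA; apply: le_trans (K _) _.
    by apply: le_lt_trans td; rewrite ler_wpM2l //; lra.
  rewrite -mulrA ler_pM2l // ler_pdivrMl // [leRHS]mulrC.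
  by rewrite ler_wpM2l // lerDr.
split; apply: is_derive_epsilon => e /H [del del0 K]; exists del => // t /K;
  apply: le_trans.
  have -> : t * complex.Re (h * m) = complex.Re (rC t * (h * m)).
    by rewrite (cReM (rC t) (h * m)) /= mul0r subr0.
  by rewrite -!cReN -!cReD normRe_le.
have -> : t * complex.Im (h * m) = complex.Im (rC t * (h * m)).
  by rewrite (cImM (rC t) (h * m)) /= mul0r addr0.
by rewrite -!cImN -!cImD normIm_le.
Qed.

Lemma cdiff_bounded_lipschitz f w (r M : R) : 0 < r ->
  (forall h, cabs h < r -> cdiff f (w + h)) ->
  (forall h, cabs h < r -> cabs (f (w + h)) <= M) ->
  forall h, cabs h <= r / 2 -> cabs (f (w + h) - f w) <= 48 * M / r * cabs h.
Proof.
move=> r0 fd fM h hr.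
have hh := cabs_ge0 h.
have r20 : 0 < r / 2 by lra.
have sub (t : R) k : 0 <= t <= 1 -> cabs k < r / 2 -> cabs (rC t * h + k) < r.
  move=> t01 kr; apply: le_lt_trans (cabsD _ _) _; rewrite cabsM cabs_rC ger0_norm; last by lra.
  by have : t * cabs h <= 1 * cabs h; [rewrite ler_wpM2r //; lra|lra].
have D (t : R) : 0 <= t <= 1 -> {m | cderiv f (w + rC t * h) m & cabs m <= 24 * M / r}.
  move=> t01; apply: cid2.
  have [|m fm] := fd (rC t * h).
    by rewrite -[X in cabs X]addr0; apply: sub => //; rewrite cabs0.
  exists m => //.
  have -> : 24 * M / r = 12 * M / (r / 2) by field; rewrite gt_eqF.
  by apply: cderiv_bound fm => // k kr; rewrite -addrA; [apply: fd|apply: fM]; exact: sub.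
pose dm (t : R) := if pselect (0 <= t <= 1) is left H then s2val (D t H) else 0.
have dmP (t : R) : 0 <= t <= 1 -> cderiv f (w + rC t * h) (dm t) /\ cabs (dm t) <= 24 * M / r.
  by move=> t01; rewrite /dm; case: pselect => // H; case: (D t H).
have oo (t : R) : t \in `]0, 1[ -> 0 <= t <= 1.
  by rewrite in_itv /= => /andP[t0 t1]; rewrite !ltW.
have cc (t : R) : `[(0:R), 1]%classic t -> 0 <= t <= 1 by rewrite /= in_itv.
have ct (p : R -> R) (s D' : R) : is_derive s 1 p D' -> {for s, continuous p}.
  by move=> Hd; apply: differentiable_continuous; apply/derivable1_diffP; case: Hd.
have [] := @MVT R (fun t => complex.Re (f (w + rC t * h))) (fun t => complex.Re (h * dm t)) 0 1 ltr01.
- by move=> t /oo /dmP [+ _] => /is_derive_cderiv [].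
- apply: continuous_in_subspaceT => t; rewrite inE => /cc /dmP [/is_derive_cderiv [H _] _].
  exact: ct H.
move=> t1 /oo /dmP [_ b1]; rewrite rC1 rC0 mul1r mul0r addr0 subr0 mulr1 => E1.
have [] := @MVT R (fun t => complex.Im (f (w + rC t * h))) (fun t => complex.Im (h * dm t)) 0 1 ltr01.
- by move=> t /oo /dmP [+ _] => /is_derive_cderiv [].
- apply: continuous_in_subspaceT => t; rewrite inE => /cc /dmP [/is_derive_cderiv [_ H] _].
  exact: ct H.
move=> t2 /oo /dmP [_ b2]; rewrite rC1 rC0 mul1r mul0r addr0 subr0 mulr1 => E2.
apply: le_trans (cabs_le_ReIm _) _; rewrite cReD cReN cImD cImN E1 E2.
have := normRe_le (h * dm t1); have := normIm_le (h * dm t2); rewrite !cabsM => k2 k1.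
have l1 : cabs h * cabs (dm t1) <= cabs h * (24 * M / r) by rewrite ler_wpM2l.
have l2 : cabs h * cabs (dm t2) <= cabs h * (24 * M / r) by rewrite ler_wpM2l.
have -> : 48 * M / r * cabs h = cabs h * (24 * M / r) + cabs h * (24 * M / r) by ring.
lra.
Qed.

(* Cauchy's estimate for the bounded function 1 / (f + conj (f w)). *)
Lemma cdiff_halfplane f w (r : R) : 0 < r ->
  (forall h, cabs h < r -> cdiff f (w + h)) ->
  (forall h, cabs h < r -> 0 < complex.Re (f (w + h))) ->
  forall h, cabs h <= r / 384 ->
  cabs (f (w + h) - f w) <= 384 * (cabs h / r) * complex.Re (f w).
Proof.
move=> r0 fd fp h hr.
have hh := cabs_ge0 h.
have h2 : cabs h < r by lra.
set a := f w; set A := complex.Re a.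
have A0 : 0 < A by rewrite /A /a -(addr0 w) fp // cabs0.
pose g z := (f z + conjc a)^-1.
have ca : complex.Re (conjc a) = A by rewrite /A; case: (a).
have den k : cabs k < r -> A <= cabs (f (w + k) + conjc a).
  by move=> /fp fk; apply: le_trans (Re_le_cabs _); rewrite cReD ca; lra.
have den0 k : cabs k < r -> f (w + k) + conjc a != 0.
  by move=> /den; apply: contraTneq => ->; rewrite cabs0 -ltNge.
have gd k : cabs k < r -> cdiff g (w + k).
  move=> kr; have [m fm] := fd k kr.
  have d1 : cderiv (fun z => f z + conjc a) (w + k) (m + 0).
    apply: cderivD => //.
    have := cderiv_affine 0 (conjc a) (w + k); congr cderiv; apply: funext => z.
    by rewrite mul0r add0r.
  by eexists; apply: cderivV d1 (den0 k kr).
have gM k : cabs k < r -> cabs (g (w + k)) <= A^-1.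
  by move=> kr; rewrite cabsV lef_pV2 ?posrE ?den // (lt_le_trans A0) ?den.
have := @cdiff_bounded_lipschitz g w r A^-1 r0 gd gM h _.
have hr2 : cabs h <= r / 2 by lra.
move=> /(_ hr2).
set u := f (w + h) + conjc a; set v := a + conjc a.
have u0 : u != 0 by exact: den0.
have vE : v = rC (2 * A).
  rewrite /v /A /rC; case: (a) => x y; simpc; congr Complex => /=; ring.
have v0 : v != 0 by rewrite vE rC_eq0 mulf_neq0 ?gt_eqF // pnatr_eq0.
have -> : g (w + h) - g w = (v - u) / (u * v).
  by rewrite /g -/u -/a -/v; field; rewrite u0 v0.
have -> : v - u = a - f (w + h) by rewrite /v /u; ring.
have cv : cabs v = 2 * A by rewrite vE cabs_rC gtr0_norm // mulr_gt0.
set t := 48 * (cabs h / r).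
have -> : 48 * A^-1 / r * cabs h = t / A by rewrite /t; field; rewrite !gt_eqF.
(* The constant is [384 = 8 * 48]: the range of [h] makes [t] at most [1/8], so the term [2 t X] on
   the right can be absorbed on the left. *)
have t4 : t <= 1 / 8.
  have : cabs h / r <= 1 / 384 by rewrite ler_pdivrMr //; lra.
  rewrite /t; lra.
have t0 : 0 <= t by rewrite /t mulr_ge0 // divr_ge0 // ltW.
rewrite cabsM cabsV cabsM cv cabsBC.
have cu : cabs u <= cabs (f (w + h) - a) + 2 * A.
  have -> : u = (f (w + h) - a) + v by rewrite /u /v; ring.
  by rewrite -cv cabsD.
have cu0 := cabs_gt0 u0.
rewrite ler_pdivrMr ?mulr_gt0 //.
have -> : t / A * (cabs u * (2 * A)) = 2 * t * cabs u by field; rewrite gt_eqF.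
have -> : 384 * (cabs h / r) * A = 8 * (t * A) by rewrite /t; ring.
set X := cabs (f (w + h) - a) in cu *; have X0 : 0 <= X by exact: cabs_ge0.
move=> K.
have : 2 * t * cabs u <= 2 * t * (X + 2 * A) by rewrite ler_wpM2l //; lra.
have : t * X <= 1 / 8 * X by rewrite ler_wpM2r.
lra.
Qed.

(** One constant serves both as range and as growth rate, so a step of a [K]-th of the radius at
    most doubles the real part. This matches the dyadic scale of depths: such a step changes the
    level by one. *)
Definition harnack (K : R) := forall f w (r : R), 0 < r ->
  (forall h, cabs h < r -> cdiff f (w + h)) ->
  (forall h, cabs h < r -> 0 < complex.Re (f (w + h))) ->
  forall h, cabs h <= r / K ->
  cabs (f (w + h) - f w) <= K * (cabs h / r) * complex.Re (f w).

Lemma exists_harnack : exists2 K : R, 2 <= K & harnack K.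
Proof. by exists 384; [lra|exact: cdiff_halfplane]. Qed.

End CauchyLipschitz.

(** * Discs in convex domains *)

Section VectorDerivative.
Variables (R : realType) (d : nat).
Implicit Types (g : R[i] -> Cd R d) (z w h : R[i]) (x y nu : Cd R d).

Definition vdiff g z := exists a : Cd R d, forall e : R, 0 < e ->
  exists2 del : R, 0 < del & forall h, cabs h < del ->
    enorm (g (z + h) - g z - h *: a) <= e * cabs h.

Lemma hipZr_real x y (s : R) : hip x (rC s *: y) = rC s * hip x y.
Proof.
rewrite (hipC (rC s *: y) x) hipZl rmorphM /= -hipC; congr (_ * _).
by rewrite /rC oppr0.
Qed.

Lemma vdiff_hip g z y nu : vdiff g z -> cdiff (fun u => hip (g u - y) nu) z.
Proof.
move=> [a ga]; exists (hip a nu) => e e0.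
have n1 : 0 < 1 + enorm nu by have := enorm_ge0 nu; lra.
have [del del0 K] := ga _ (divr_gt0 e0 n1); exists del => // h /K.
have -> : hip (g (z + h) - y) nu - hip (g z - y) nu - h * hip a nu =
   hip (g (z + h) - g z - h *: a) nu by rewrite !hipBl hipZl; ring.
move=> k; apply: le_trans (cabs_hip _ _) _.
apply: le_trans (_ : e / (1 + enorm nu) * cabs h * (1 + enorm nu) <= _).
  by apply: ler_pM => //; rewrite ?enorm_ge0 // lerDr.
by rewrite mulrAC divfK // gt_eqF.
Qed.

Lemma vdiff_lipschitz g z : vdiff g z -> exists2 M : R, 0 < M &
  exists2 del : R, 0 < del & forall h, cabs h < del -> enorm (g (z + h) - g z) <= M * cabs h.
Proof.
move=> [a /(_ 1 ltr01) [del del0 K]]; exists (1 + enorm a).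
  by have := enorm_ge0 a; lra.
exists del => // h /K k.
have := enormD (g (z + h) - g z - h *: a) (h *: a); rewrite subrK enormZ.
by nra.
Qed.

Lemma vdiff_comp g (m : R[i] -> R[i]) z : cdiff m z -> vdiff g (m z) -> vdiff (fun u => g (m u)) z.
Proof.
move=> [b mb] [a ga]; exists (b *: a) => e e0.
have [d0 d00 H0] := cderiv_lipschitz mb.
set B := 1 + cabs b in H0.
have B0 : 0 < B by have := cabs_ge0 b; rewrite /B; lra.
set M := 1 + enorm a.
have M0 : 0 < M by have := enorm_ge0 a; rewrite /M; lra.
have e1 : 0 < e / (2 * B) by rewrite divr_gt0 ?mulr_gt0.
have e2 : 0 < e / (2 * M) by rewrite divr_gt0 ?mulr_gt0.
have [d1 d10 H1] := ga _ e1; have [d2 d20 H2] := mb _ e2.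
have d30 : 0 < d1 / B by rewrite divr_gt0.
exists (Num.min (Num.min d0 d2) (d1 / B)); first by rewrite !lt_min d00 d20 d30.
move=> h; rewrite !lt_min => /andP[/andP[/H0 k0 /H2 k2] h1].
have hB : B * cabs h < d1 by rewrite mulrC -ltr_pdivlMr.
have := H1 _ (le_lt_trans k0 hB); rewrite subrKC => k1.
have -> : g (m (z + h)) - g (m z) - h *: (b *: a) =
  (g (m (z + h)) - g (m z) - (m (z + h) - m z) *: a) + (m (z + h) - m z - h * b) *: a.
  by rewrite !scalerBl scalerA; apply/rowP => i; rewrite !mxE; ring.
apply: le_trans (enormD _ _) _; rewrite enormZ.
have hh := cabs_ge0 h; have a0 := enorm_ge0 a.
have t1 : e / (2 * B) * cabs (m (z + h) - m z) <= e / 2 * cabs h.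
  apply: le_trans (_ : e / (2 * B) * (B * cabs h) <= _).
    by rewrite ler_wpM2l // ltW.
  by rewrite le_eqVlt; apply/orP; left; apply/eqP; field; rewrite gt_eqF.
have t2 : cabs (m (z + h) - m z - h * b) * enorm a <= e / 2 * cabs h.
  apply: le_trans (_ : e / (2 * M) * cabs h * M <= _).
    by apply: ler_pM => //; rewrite ?cabs_ge0 // /M; lra.
  by rewrite le_eqVlt; apply/orP; left; apply/eqP; field; rewrite gt_eqF.
lra.
Qed.

Lemma enorm_mulmx (A : 'M[R[i]]_d) : exists2 K : R, 0 < K & forall v : Cd R d, enorm (v *m A) <= K * enorm v.
Proof.
exists (1 + \sum_i enorm (row i A)).
  have : 0 <= \sum_i enorm (row i A) by apply: sumr_ge0 => i _; exact: enorm_ge0.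
  lra.
move=> v; rewrite mulmx_sum_row.
have : enorm (\sum_i v ord0 i *: row i A) <= \sum_i enorm v * enorm (row i A).
  elim/big_ind2: _ => [|x1 x2 y1 y2 h1 h2|i _]; first by rewrite enorm0.
    exact: le_trans (enormD _ _) (lerD h1 h2).
  rewrite enormZ ler_wpM2r ?enorm_ge0 //.
  rewrite -(ler_pXn2r (_ : 0 < 2)%N) ?nnegrE ?cabs_ge0 ?enorm_ge0 //.
  by rewrite enorm_sqr (bigD1 i) //= lerDl sumr_ge0 // => j _; exact: sqr_ge0.
rewrite -mulr_sumr => /le_trans; apply.
by rewrite mulrC ler_wpM2r ?enorm_ge0 // lerDr.
Qed.

Lemma vdiff_holo (U : set (Cd R d)) (F : Cd R d -> Cd R d) g z :
  holo_on U F -> U (g z) -> vdiff g z -> vdiff (fun u => F (g u)) z.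
Proof.
move=> FU Ug vg; have [N N0 [d0 d00 H0]] := vdiff_lipschitz vg; case: vg => a ga.
have [A FA] := FU _ Ug; have [K K0 AK] := enorm_mulmx A.
exists (a *m A) => e e0.
have e1 : 0 < e / (2 * N) by rewrite divr_gt0 ?mulr_gt0.
have e2 : 0 < e / (2 * K) by rewrite divr_gt0 ?mulr_gt0.
have [d1 d10 H1] := FA _ e1; have [d2 d20 H2] := ga _ e2.
have d30 : 0 < d1 / N by rewrite divr_gt0.
exists (Num.min (Num.min d0 d2) (d1 / N)); first by rewrite !lt_min d00 d20 d30.
move=> h; rewrite !lt_min => /andP[/andP[/H0 k0 /H2 k2] h1].
have hB : N * cabs h < d1 by rewrite mulrC -ltr_pdivlMr.
have := H1 _ (le_lt_trans k0 hB); rewrite subrKC => k1.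
have -> : F (g (z + h)) - F (g z) - h *: (a *m A) =
  (F (g (z + h)) - F (g z) - (g (z + h) - g z) *m A) + (g (z + h) - g z - h *: a) *m A.
  by rewrite (mulmxBl (g (z + h) - g z)) -scalemxAl addrA subrK.
apply: le_trans (enormD _ _) _.
have hh := cabs_ge0 h.
have t1 : e / (2 * N) * enorm (g (z + h) - g z) <= e / 2 * cabs h.
  apply: le_trans (_ : e / (2 * N) * (N * cabs h) <= _).
    by rewrite ler_wpM2l // ltW.
  by rewrite le_eqVlt; apply/orP; left; apply/eqP; field; rewrite gt_eqF.
have t2 : enorm ((g (z + h) - g z - h *: a) *m A) <= e / 2 * cabs h.
  apply: le_trans (AK _) _; apply: le_trans (_ : K * (e / (2 * K) * cabs h) <= _).
    by rewrite ler_wpM2l // ltW.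
  by rewrite le_eqVlt; apply/orP; left; apply/eqP; field; rewrite gt_eqF.
lra.
Qed.

Lemma vdiff_affine x y z : vdiff (fun u => x + u *: y) z.
Proof.
exists y => e e0; exists 1 => // h _.
have -> : x + (z + h) *: y - (x + z *: y) - h *: y = 0.
  by apply/rowP => i; rewrite !mxE; ring.
by rewrite enorm0 mulr_ge0 ?cabs_ge0 // ltW.
Qed.

(** The scalar estimate is applied to the pairing of [g] with its own increment [v], so no factor
    depending on the dimension appears. *)
Lemma vdiff_bounded_lipschitz g w (r M : R) : 0 < r ->
  (forall h, cabs h < r -> vdiff g (w + h)) ->
  (forall h, cabs h < r -> enorm (g (w + h)) <= M) ->
  forall h, cabs h <= r / 2 -> enorm (g (w + h) - g w) <= 48 * M / r * cabs h.
Proof.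
move=> r0 gd gM h hr; set v := g (w + h) - g w.
have [->|v0] := eqVneq v 0.
  have M0 : 0 <= M by apply: le_trans (gM 0 _); rewrite ?enorm_ge0 // cabs0.
  by rewrite enorm0 mulr_ge0 ?cabs_ge0 // divr_ge0 ?mulr_ge0 // ltW.
have vp := enorm_gt0 v0.
have := @cdiff_bounded_lipschitz R (fun u => hip (g u - 0) v) w r (M * enorm v) r0 _ _ h hr.
rewrite -hipBl !subr0 -/v hipxx cabs_rC ger0_norm ?sqr_ge0 // expr2.
have -> : 48 * (M * enorm v) / r * cabs h = (48 * M / r * cabs h) * enorm v by ring.
rewrite ler_pM2r //; apply => k /= kr; first by apply: vdiff_hip; exact: gd.
rewrite subr0; apply: le_trans (cabs_hip _ _) _.
by rewrite ler_wpM2r ?enorm_ge0 // gM.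
Qed.

End VectorDerivative.

(** * Separation of a point from an open convex set *)

Section Convex.
Variables (R : realType) (d : nat).
Implicit Types (D : set (Cd R d)) (x y nu : Cd R d) (s M : R).

(** Pushing [y] away from [x0] by the factor [s] puts it at positive distance from [D]. Then a point
    of [D] that nearly realizes this distance already gives a separating direction, and no closest
    point, hence no compactness, is required; the bound [M] on the diameter says how near is near
    enough. *)
Lemma convex_separation D x0 y s M : convex_set D -> eopen D -> D x0 -> ~ D y -> 1 < s ->
  (forall x x', D x -> D x' -> enorm (x - x') <= M) ->
  exists nu, enorm nu = 1 /\
    forall x, D x -> 0 < complex.Re (hip (x - (x0 + rC s *: (y - x0))) nu).
Proof.
move=> cD oD Dx0 Dy s1 DM.
have [e0 e00 De0] := oD _ Dx0.
set y' := x0 + rC s *: (y - x0).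
have sn : s != 0 by rewrite gt_eqF //; lra.
have sn1 : s - 1 != 0 by rewrite gt_eqF // subr_gt0.
have far x : D x -> (s - 1) * e0 <= enorm (x - y').
  move=> Dx; rewrite leNgt; apply/negP => lt; apply: Dy.
  (* [y] lies on the segment from [q] to [x]; if [x] is too close to [y'], then [q] falls into the
     ball around [x0]. *)
  set q := x0 + rC (s - 1)^-1 *: (y' - x).
  have Dq : D q.
    apply: De0; rewrite /eball /= /q addrAC subrr add0r enormZ cabs_rC.
    by rewrite gtr0_norm ?invr_gt0 ?subr_gt0 // ltr_pdivrMl ?subr_gt0 // enormBC.
  have := cD _ _ Dq Dx (1 - s^-1).
  have s01 : 0 <= 1 - s^-1 <= 1.
    by rewrite subr_ge0 invf_le1 ?gerBl ?invr_ge0; lra.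
  move=> /(_ s01); congr (D _).
  rewrite /q /y' !rCB !rCV rCB rC1 subKr.
  apply/rowP => i; rewrite !mxE; field.
  by rewrite -rC1 -rCB !rC_eq0 sn sn1.
have M0 : 0 <= M by have := DM _ _ Dx0 Dx0; rewrite subrr enorm0.
have d0 : 0 < (s - 1) * e0 by rewrite mulr_gt0 ?subr_gt0.
set E := [set enorm (x - y') | x in D].
have hE : has_inf E.
  by split; [exists (enorm (x0 - y')), x0|exists ((s - 1) * e0) => _ [x Dx <-]; exact: far].
set m := inf E.
have mp : 0 < m.
  apply: lt_le_trans d0 _; apply: lb_le_inf; first by case: hE.
  by move=> _ [x Dx <-]; exact: far.
have mlow x : D x -> m <= enorm (x - y').
  by move=> Dx; apply: ge_inf; [case: hE|exists x].
(* The point at time [t] on the way from [xs] to [x] is also at distance at least [m] from [y'].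
   This [t] makes the quadratic term at most [t * m^2], and [ep] is half of that, so the linear term
   cannot be too negative. *)
set t := m ^+ 2 / (m ^+ 2 + M ^+ 2).
have m2 : 0 < m ^+ 2 by rewrite exprn_gt0.
have M2 : 0 <= M ^+ 2 by rewrite sqr_ge0.
have t0 : 0 < t by rewrite divr_gt0 //; lra.
have t1 : t <= 1 by rewrite ler_pdivrMr; lra.
have tM : t * M ^+ 2 <= m ^+ 2.
  by rewrite /t mulrAC ler_pdivrMr; nra.
set ep := t * m ^+ 2 / 2.
have ep0 : 0 < ep by rewrite divr_gt0 // mulr_gt0.
have [xs Dxs xsm] : exists2 xs, D xs & enorm (xs - y') ^+ 2 < m ^+ 2 + ep.
  have et : 0 < Num.sqrt (m ^+ 2 + ep) - m.
    rewrite subr_gt0 -{1}(gtr0_norm mp) -sqrtr_sqr ltr_sqrt; lra.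
  have [_ [xs Dxs <-] lt] := inf_adherent et hE; exists xs => //.
  rewrite -(@sqr_sqrtr _ (m ^+ 2 + ep)); last by lra.
  by rewrite ltr_pXn2r ?nnegrE ?enorm_ge0 ?sqrtr_ge0 //; rewrite subrKC in lt.
set a := xs - y'.
have ap : 0 < enorm a by apply: lt_le_trans mp (mlow _ Dxs).
exists (rC (enorm a)^-1 *: a); split.
  by rewrite enormZ cabs_rC gtr0_norm ?invr_gt0 // mulVf // gt_eqF.
move=> x Dx; rewrite hipZr_real cReM /= mul0r subr0 pmulr_rgt0 ?invr_gt0 //.
have Dt := cD _ _ Dx Dxs t; have t01 : 0 <= t <= 1 by rewrite (ltW t0).
have := mlow _ (Dt t01).
have -> : rC t *: x + rC (1 - t) *: xs - y' = rC t *: (x - xs) + a.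
  by rewrite /a rCB rC1; apply/rowP => i; rewrite !mxE; ring.
rewrite -(ler_pXn2r (_ : 0 < 2)%N) ?nnegrE ?enorm_ge0 //; last exact: ltW.
rewrite enormD_sqr enormZ cabs_rC (gtr0_norm t0) hipZl cReM /= mul0r subr0.
have -> : x - y' = (x - xs) + a by rewrite /a; apply/rowP => i; rewrite !mxE; ring.
rewrite (hipDl (x - xs) a a) hipxx cReD /=.
set I := complex.Re (hip (x - xs) a).
have xM : enorm (x - xs) ^+ 2 <= M ^+ 2.
  by rewrite ler_pXn2r ?nnegrE ?enorm_ge0 // DM.
have am : m ^+ 2 <= enorm a ^+ 2.
  by rewrite ler_pXn2r ?nnegrE ?enorm_ge0 ?(ltW mp) // mlow.
rewrite exprMn => K.
have K2 : t ^+ 2 * enorm (x - xs) ^+ 2 <= t * m ^+ 2.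
  apply: le_trans (_ : t ^+ 2 * M ^+ 2 <= _); first by rewrite ler_pM2l // exprn_gt0.
  by rewrite expr2 -mulrA ler_pM2l.
have : 0 < t * (2 * (I + enorm a ^+ 2)).
  have : t * m ^+ 2 <= t * enorm a ^+ 2 by rewrite ler_pM2l.
  rewrite /ep -/a in xsm; nra.
by rewrite pmulr_rgt0 // pmulr_rgt0.
Qed.

(** The value of the functional bounds the depth from above: moving back by that value along [nu]
    reaches the separating hyperplane. *)
Lemma separated_notin D x0 x nu : enorm nu = 1 ->
  (forall x, D x -> 0 < complex.Re (hip (x - x0) nu)) ->
  0 <= complex.Re (hip (x - x0) nu) ->
  exists y, ~ D y /\ enorm (y - x) <= complex.Re (hip (x - x0) nu).
Proof.
move=> n1 H; set c := complex.Re _ => c0.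
exists (x - rC c *: nu); split.
  move=> /H; have -> : x - rC c *: nu - x0 = (x - x0) - rC c *: nu.
    by apply/rowP => i; rewrite !mxE; ring.
  rewrite hipBl hipZl hipxx n1 expr1n rC1 mulr1 cReD cReN -/c /= subrr.
  by rewrite ltxx.
have -> : x - rC c *: nu - x = - (rC c *: nu) by apply/rowP => i; rewrite !mxE; ring.
by rewrite enormN enormZ n1 mulr1 cabs_rC ger0_norm.
Qed.

End Convex.

(** * Displacement of a disc in terms of the depth of its centre *)

Section DiscsInConvex.
Variables (R : realType) (d : nat).
Variable K : R.
Hypotheses (K2 : 2 <= K) (HK : harnack K).
Implicit Types (D : set (Cd R d)) (x y v nu : Cd R d) (g f : R[i] -> Cd R d) (C M mu : R).

(** Depth at most [2^-n], with a witness in the complement in place of an infimum. *)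
Definition low D x (n : nat) := exists y, ~ D y /\ enorm (y - x) <= 2^-1 ^+ n.

(** The line-type estimate on the dyadic scale, to be used with [mu = 2^(-1/L)]. The exit point is
    recorded through its complex coefficient [c], because a complex functional will be evaluated
    along the line. *)
Definition line_thin D C mu := forall x v n, D x -> v != 0 -> low D x n ->
  exists c : R[i], ~ D (x + c *: v) /\ enorm (c *: v) <= C * mu ^+ n.

(** A functional separating [D] from the point at [2 c v] has modulus [2 |c| |L|] at [g w], where
    [L] is its value on the increment [v]. Harnack bounds [|L|] by [K |u| / r] times this, and [L]
    cancels: [|c|] is at least [r / (2 K |u|)], so [v] is much shorter than [c v]. *)
Lemma disc_step D M g w (r H : R) (u c : R[i]) : convex_set D -> eopen D ->
  (forall x x', D x -> D x' -> enorm (x - x') <= M) ->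
  0 < r -> (forall h, cabs h < r -> vdiff g (w + h)) ->
  (forall h, cabs h < r -> D (g (w + h))) ->
  cabs u <= r / K -> 0 <= H ->
  ~ D (g w + c *: (g (w + u) - g w)) -> enorm (c *: (g (w + u) - g w)) <= H ->
  enorm (g (w + u) - g w) <= 2 * K * H * (cabs u / r).
Proof.
move=> cD oD DM r0 gd gD ur H0 Dq qH.
have K0 : 0 < K by apply: lt_le_trans K2.
set v := g (w + u) - g w in Dq qH *.
have Dw : D (g w) by rewrite -(addr0 w); apply: gD; rewrite cabs0.
have s12 : 1 < 2 :> R by rewrite ltr1n.
have [nu [nu1 pos]] := convex_separation cD oD Dw Dq s12 DM.
set y' := g w + _ in pos.
have vd h : cabs h < r -> cdiff (fun z => hip (g z - y') nu) (w + h).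
  by move=> hr; apply: vdiff_hip; exact: gd.
have vp h : cabs h < r -> 0 < complex.Re (hip (g (w + h) - y') nu).
  by move=> hr; apply: pos; exact: gD.
have := @HK (fun z => hip (g z - y') nu) w r r0 vd vp u ur.
rewrite -hipBl.
have -> : g (w + u) - y' - (g w - y') = v by rewrite /v; apply/rowP => i; rewrite !mxE; ring.
have E : g w - y' = - (rC 2 * c) *: v.
  by rewrite /y'; apply/rowP => i; rewrite !mxE; ring.
set t := cabs u / r; set L := hip v nu => B.
have pw : 0 < complex.Re (hip (g w - y') nu) by apply: pos.
have t0 : 0 <= t by rewrite divr_ge0 ?cabs_ge0 // ltW.
have B1 : cabs L <= K * t * (2 * cabs c * cabs L).
  apply: le_trans B _; apply: ler_wpM2l; first by rewrite mulr_ge0 // ltW.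
  apply: le_trans (Re_le_cabs _) _.
  rewrite E hipZl cabsM cabsN cabsM cabs_rC ger0_norm //.
have L0 : 0 < cabs L.
  rewrite cabs_gt0 //; apply: contraTneq pw => L0.
  by rewrite E hipZl -/L L0 mulr0 ltxx.
have B2 : 1 <= 2 * K * t * cabs c.
  rewrite -(ler_pM2r L0) mul1r; apply: le_trans B1 _.
  by rewrite le_eqVlt; apply/orP; left; apply/eqP; ring.
have vn : 0 <= enorm v by exact: enorm_ge0.
rewrite enormZ in qH.
apply: le_trans (_ : 2 * K * t * cabs c * enorm v <= _).
  by rewrite -[X in X <= _]mul1r ler_wpM2r.
have -> : 2 * K * H * t = 2 * K * t * H by ring.
have Kt : 0 <= 2 * K * t := mulr_ge0 (mulr_ge0 (ler0n _ 2) (ltW K0)) t0.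
by rewrite -mulrA ler_wpM2l.
Qed.

Notation theta := (1 - K^-1).

(* Harnack along w (1 - theta^j) / (1 - theta^J), j <= J: the supporting
   functional at most doubles at each step, so the steps have length at most
   2 C mu^(J + k - j - 1). *)
Lemma disc_interior_move D C M mu g (r : R) (J k : nat) : convex_set D -> eopen D ->
  (forall x x', D x -> D x' -> enorm (x - x') <= M) ->
  0 <= C -> 0 < mu < 1 -> line_thin D C mu ->
  0 < r -> (forall z, cabs z < r -> vdiff g z) -> (forall z, cabs z < r -> D (g z)) ->
  low D (g 0) (J + k) ->
  forall w, cabs w <= r * (1 - theta ^+ J) ->
  enorm (g w - g 0) <= 2 * C / (1 - mu) * mu ^+ k.
Proof.
move=> cD oD DM C0 /andP[mu0 mu1] thin r0 gd gD [y [Dy yx]] w wr.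
have K0 : 0 < K by apply: lt_le_trans K2.
have Kn0 : K != 0 by rewrite gt_eqF.
have KV0 : 0 < K^-1 by rewrite invr_gt0.
have KV2 : K^-1 <= 1 / 2 by rewrite div1r lef_pV2 ?posrE.
have th0 : 0 < theta by lra.
have th1 : theta < 1 by lra.
have p0 n : 0 < theta ^+ n by rewrite exprn_gt0.
have p1 n : theta ^+ n <= 1 by rewrite exprn_ile1 // ltW.
have m0 n : 0 < mu ^+ n by rewrite exprn_gt0.
have R0 n : 0 <= 2 * C / (1 - mu) * mu ^+ n.
  by rewrite mulr_ge0 ?(ltW (m0 n)) // divr_ge0 ?mulr_ge0 // subr_ge0 ltW.
case: J wr yx => [|J] wr yx.
  have -> : w = 0.
    by apply: cabs0_eq0; apply/eqP; rewrite eq_le cabs_ge0 andbT; move: wr; rewrite expr0 subrr mulr0.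
  by rewrite subrr enorm0.
have q1 : 0 < 1 - theta ^+ J.+1.
  by rewrite subr_gt0 exprS; apply: le_lt_trans th1; rewrite ler_piMr // ltW.
(* With these parameters [p j] keeps a distance of at least [r theta^j] from the circle of radius
   [r], and the next step is at most a [K]-th of that, which is the range of Harnack's inequality.
   For [J = 0] the denominator would vanish, hence the case split above. *)
pose s (j : nat) : R := (1 - theta ^+ j) / (1 - theta ^+ J.+1).
pose p j := rC (s j) * w.
have s0 : s 0%N = 0 by rewrite /s expr0 subrr mul0r.
have sJ : s J.+1 = 1 by rewrite /s divff // gt_eqF.
have pr j : cabs (p j) <= r * (1 - theta ^+ j).
  rewrite /p cabsM cabs_rC ger0_norm; last by rewrite divr_ge0 ?subr_ge0 // ltW.
  rewrite /s mulrAC ler_pdivrMr // [leRHS]mulrAC mulrC ler_wpM2r // subr_ge0 //.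
have pS j : cabs (p j.+1 - p j) <= r * theta ^+ j / K.
  have -> : p j.+1 - p j = rC (theta ^+ j / K / (1 - theta ^+ J.+1)) * w.
    rewrite /p -mulrBl -rCB; congr (rC _ * _); rewrite /s exprS.
    by field; rewrite Kn0 andbT gt_eqF.
  rewrite cabsM cabs_rC ger0_norm; last by rewrite !divr_ge0 // ltW.
  rewrite mulrAC ler_pdivrMr //.
  have -> : r * theta ^+ j / K * (1 - theta ^+ J.+1) = theta ^+ j / K * (r * (1 - theta ^+ J.+1)) by ring.
  by rewrite ler_wpM2l // divr_ge0 // ltW.
have s12 : 1 < 2 :> R by rewrite ltr1n.
have D0 : D (g 0) by apply: gD; rewrite cabs0.
have [nu [nu1 pos]] := convex_separation cD oD D0 Dy s12 DM.
set y' := g 0 + _ in pos.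
pose psi z := hip (g z - y') nu.
(* The factor 2 comes from separating at twice the distance to [y]. Because of it, index [n + 1] at
   [p j] only certifies [low] at level [n], and this is why the step to [p j.+1] is measured by
   [mu^n]. *)
suff H (j n : nat) : (n + j = J.+1 + k)%N -> (j <= J.+1)%N ->
    complex.Re (psi (p j)) <= 2 * 2^-1 ^+ n /\
    enorm (g (p j) - g 0) <= 2 * C / (1 - mu) * mu ^+ n.
  have [] := H J.+1 k (addnC _ _) (leqnn _).
  by rewrite /p sJ rC1 mul1r.
elim: j n => [|j IH] n; first rewrite addn0 => -> _.
  rewrite /p s0 rC0 mul0r subrr enorm0; split => //.
  apply: le_trans (Re_le_cabs _) _; apply: le_trans (cabs_hip _ _) _.
  rewrite nu1 mulr1.
  have -> : g 0 - y' = - (rC 2 *: (y - g 0)).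
    by rewrite /y'; apply/rowP => i; rewrite !mxE; ring.
  by rewrite enormN enormZ cabs_rC ger0_norm // ler_wpM2l.
rewrite addnS -addSn => nj jJ.
have [IH1 IH2] := IH n.+1 nj (ltnW jJ).
set rj := r * theta ^+ j.
have rj0 : 0 < rj by rewrite mulr_gt0.
have inb h : cabs h < rj -> cabs (p j + h) < r.
  move=> hr; apply: le_lt_trans (cabsD _ _) _.
  by have := pr j; rewrite /rj in hr; lra.
have Dj : D (g (p j)) by rewrite -(addr0 (p j)); apply: gD; apply: inb; rewrite cabs0.
have lowj : low D (g (p j)) n.
  have [|q [Dq qE]] := separated_notin nu1 pos (_ : 0 <= complex.Re (psi (p j))).
    by apply/ltW/pos.
  exists q; split=> //; apply: le_trans qE _; apply: le_trans IH1 _.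
  by rewrite exprS mulrA divff ?mul1r // pnatr_eq0.
pose u := p j.+1 - p j.
have uE : p j + u = p j.+1 by rewrite /u; ring.
have ur : cabs u <= rj / K by exact: pS.
have urj : cabs u < rj.
  by apply: le_lt_trans ur _; rewrite gtr_pMr //; lra.
have gdj h : cabs h < rj -> vdiff g (p j + h) by move=> /inb; exact: gd.
have gDj h : cabs h < rj -> D (g (p j + h)) by move=> /inb; exact: gD.
split.
  have vd h : cabs h < rj -> cdiff psi (p j + h).
    by move=> hr; apply: vdiff_hip; exact: gdj.
  have vp h : cabs h < rj -> 0 < complex.Re (psi (p j + h)).
    by move=> hr; apply: pos; exact: gDj.
  have := @HK psi (p j) rj rj0 vd vp u ur; rewrite uE => B.
  have P0 : 0 < complex.Re (psi (p j)) by apply: pos.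
  have u1 : K * (cabs u / rj) <= 1.
    by rewrite mulrA ler_pdivrMr // mul1r mulrC -ler_pdivlMr.
  have B1 : cabs (psi (p j.+1) - psi (p j)) <= complex.Re (psi (p j)).
    by apply: le_trans B _; rewrite -[leRHS]mul1r ler_wpM2r // ltW.
  have := Re_le_cabs (psi (p j.+1) - psi (p j)); rewrite cReD cReN.
  have -> : 2^-1 ^+ n = 2 * 2^-1 ^+ n.+1 :> R by rewrite exprS mulrA divff ?mul1r // pnatr_eq0.
  lra.
apply: le_trans (enormB_le _ (g (p j)) _) _.
have step : enorm (g (p j.+1) - g (p j)) <= 2 * (C * mu ^+ n).
  have [->|v0] := eqVneq (g (p j.+1) - g (p j)) 0.
    by rewrite enorm0 !mulr_ge0 // ltW.
  have [c [Dc cE]] := thin _ _ _ Dj v0 lowj.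
  have := @disc_step D M g (p j) rj (C * mu ^+ n) u c cD oD DM rj0 gdj gDj ur.
  rewrite uE => /(_ (mulr_ge0 C0 (ltW (m0 n))) Dc cE) /le_trans; apply.
  have u1 : cabs u / rj <= K^-1 by rewrite ler_pdivrMr // mulrC.
  have Cm : 0 <= 2 * K * (C * mu ^+ n) by rewrite !mulr_ge0 // ltW.
  apply: le_trans (ler_wpM2l Cm u1) _.
  by rewrite le_eqVlt; apply/orP; left; apply/eqP; field; exact: Kn0.
have -> : 2 * C / (1 - mu) * mu ^+ n = 2 * (C * mu ^+ n) + 2 * C / (1 - mu) * mu ^+ n.+1.
  by rewrite exprS; field; rewrite subr_eq0 eq_sym lt_eqF.
exact: lerD.
Qed.

End DiscsInConvex.

(** * Discs that stay in a chart *)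

Section Localization.
Variables (R : realType) (d : nat).
Variable K : R.
Hypotheses (K2 : 2 <= K) (HK : harnack K).
Notation theta := (1 - K^-1).

(* Let r be the largest radius with f(r D) inside the ball; the chart estimate
   keeps f close to f 0 on |w| <= r (1 - theta^J), and Cauchy's estimate for the
   bounded map f controls the remaining layer unless 1 - r is O(theta^J). *)
Lemma disc_localization (Om V D : set (Cd R d)) (Phi : Cd R d -> Cd R d) (xi : Cd R d)
    (tau M M' Cb C mu A : R) (J k : nat) (f : R[i] -> Cd R d) :
  (forall x, Om x -> enorm x <= M) -> 0 < tau ->
  holo_on V Phi -> D = Phi @` (V `&` Om) -> eopen D -> convex_set D ->
  (forall x x', D x -> D x' -> enorm (x - x') <= M') ->
  0 < Cb -> (forall p q, V p -> V q -> enorm (p - q) <= Cb * enorm (Phi p - Phi q)) ->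
  eball xi tau `<=` V -> 0 <= C -> 0 < mu < 1 -> line_thin D C mu ->
  Cb * (2 * C / (1 - mu) * mu ^+ k) <= tau / 8 ->
  4 <= A -> 96 * M <= tau / 8 * A ->
  disc_holo f -> (forall w, cabs w < 1 -> Om (f w)) ->
  enorm (f 0 - xi) < tau / 2 -> low D (Phi (f 0)) (J + k) ->
  forall w, cabs w < 1 - A * theta ^+ J -> enorm (f w - f 0) < tau / 2.
Proof.
move=> OmM tau0 hPhi DE oD cD DM Cb0 bil tauV C0 mu01 thin small A4 AM fh fOm f0xi lowf w wr.
have K0 : 0 < K by apply: lt_le_trans K2.
have KV0 : 0 < K^-1 by rewrite invr_gt0.
have KV2 : K^-1 <= 1 / 2 by rewrite div1r lef_pV2 ?posrE.
have th0 : 0 < theta by lra.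
have th1 : theta < 1 by lra.
set tJ := theta ^+ J in wr *.
have tJ0 : 0 < tJ by rewrite exprn_gt0.
have tJ1 : tJ <= 1 by rewrite exprn_ile1 // ltW.
rewrite ltNge; apply/negP => wbig.
set E := [set r : R | 0 <= r <= 1 /\ forall z, cabs z < r -> enorm (f z - f 0) < tau / 2].
have E0 : E 0.
  split; first by rewrite lexx ler01.
  by move=> z; rewrite ltNge cabs_ge0.
have hE : has_sup E by split; [exists 0|exists 1 => r [/andP[_ ->]]].
set r := sup E.
have r0 : 0 <= r by apply: sup_upper_bound.
have Er z : cabs z < r -> enorm (f z - f 0) < tau / 2.
  by move=> zr; have [s [_ Es] /Es] := sup_gt (proj1 hE) zr.
have rw : r <= cabs w.
  apply: ge_sup; first by exists 0.
  by move=> s [_ Es]; rewrite leNgt; apply/negP => /Es; rewrite ltNge wbig.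
have r1 : r < 1 - A * tJ by apply: le_lt_trans wr.
have AtJ : 4 * tJ <= A * tJ by rewrite ler_pM2r.
have fin z : cabs z < r -> V (f z).
  move=> /Er zr; apply: tauV; rewrite /eball /=.
  by apply: le_lt_trans (enormB_le _ (f 0) _) _; lra.
have f0V : V (f 0) by apply: tauV; rewrite /eball /=; lra.
have inner z : cabs z <= r * (1 - tJ) -> enorm (f z - f 0) <= tau / 8.
  move=> zr; have [r00|r00] := eqVneq r 0.
    have -> : z = 0.
      by apply: cabs0_eq0; apply/eqP; rewrite eq_le cabs_ge0 andbT; move: zr; rewrite r00 mul0r.
    by rewrite subrr enorm0; lra.
  have rp : 0 < r by rewrite lt_neqAle eq_sym r00.
  have zr' : cabs z < r by apply: le_lt_trans zr _; rewrite gtr_pMr //; lra.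
  have := @disc_interior_move R d K K2 HK D C M' mu (fun u => Phi (f u)) r J k cD oD DM C0 mu01 thin rp.
  have H1 u : cabs u < r -> vdiff (fun u => Phi (f u)) u.
    move=> ur; apply: (vdiff_holo hPhi); first exact: fin.
    by apply: fh; lra.
  have H2 u : cabs u < r -> D (Phi (f u)).
    move=> ur; rewrite DE; exists (f u) => //; split; first exact: fin.
    by apply: fOm; lra.
  move=> /(_ H1 H2 lowf z zr) B.
  apply: le_trans (bil _ _ (fin _ zr') f0V) _.
  by apply: le_trans small; rewrite ler_wpM2l // ltW.
have outer z : cabs z < r + tJ -> enorm (f z - f 0) < tau / 2.
  clear -OmM tau0 A4 AM fh fOm r0 r1 tJ0 tJ1 AtJ inner.
  clearbody r; clearbody tJ => zr; have rt : 0 < r + tJ by lra.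
  (* Scaling by [s] brings [z] back into the inner region and moves it by at most [2 tJ]. A disc of
     radius [A tJ] is available there: [A >= 4] makes the move at most half of it, and Cauchy's
     estimate gives [48 M / (A tJ) * (2 tJ) = 96 M / A], at most [tau / 8]. *)
  set s := r * (1 - tJ) / (r + tJ).
  have s0 : 0 <= s by rewrite divr_ge0 ?mulr_ge0 //; lra.
  have sz : cabs (rC s * z) <= r * (1 - tJ).
    rewrite cabsM cabs_rC ger0_norm // /s mulrAC ler_pdivrMr //.
    by rewrite ler_wpM2l ?mulr_ge0 //; lra.
  have rr : r * (1 - tJ) <= r by rewrite ler_piMr //; lra.
  have zs : cabs (z - rC s * z) <= 2 * tJ.
    have -> : z - rC s * z = rC ((tJ + r * tJ) / (r + tJ)) * z.
      rewrite -{1}(mul1r z) -mulrBl -rC1 -rCB; congr (rC _ * _).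
      by rewrite /s; field; rewrite gt_eqF.
    have q0 : 0 <= tJ + r * tJ by rewrite addr_ge0 ?mulr_ge0 // ltW.
    rewrite cabsM cabs_rC ger0_norm ?divr_ge0 // ?(ltW rt) //.
    rewrite mulrAC ler_pdivrMr //.
    apply: le_trans (_ : (tJ + r * tJ) * (r + tJ) <= _); first by rewrite ler_wpM2l // ltW.
    rewrite ler_pM2r // mulr_natl mulr2n lerD2l ler_piMl //; [exact: ltW|lra].
  have den : A * tJ <= 1 - cabs (rC s * z) by lra.
  have den0 : 0 < 1 - cabs (rC s * z) by have := mulr_gt0 (lt_le_trans (ltr0n _ 4) A4) tJ0; lra.
  have inb h : cabs h < 1 - cabs (rC s * z) -> cabs (rC s * z + h) < 1.
    by move=> hr; apply: le_lt_trans (cabsD _ _) _; lra.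
  have := @vdiff_bounded_lipschitz R d f (rC s * z) _ M den0 _ _ (z - rC s * z) _.
  rewrite subrKC.
  have H1 h : cabs h < 1 - cabs (rC s * z) -> vdiff f (rC s * z + h) by move=> /inb /fh.
  have H2 h : cabs h < 1 - cabs (rC s * z) -> enorm (f (rC s * z + h)) <= M.
    by move=> /inb /fOm /OmM.
  have H3 : cabs (z - rC s * z) <= (1 - cabs (rC s * z)) / 2 by lra.
  move=> /(_ H1 H2 H3) B.
  have M0 : 0 <= M by apply: le_trans (OmM (f 0) _); rewrite ?enorm_ge0 //; apply: fOm; rewrite cabs0.
  have B2 : 48 * M / (1 - cabs (rC s * z)) * cabs (z - rC s * z) <= tau / 8.
    rewrite mulrAC ler_pdivrMr //.
    apply: le_trans (_ : 48 * M * (2 * tJ) <= _); first by rewrite ler_wpM2l // mulr_ge0.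
    apply: le_trans (_ : tau / 8 * (A * tJ) <= _); last by rewrite ler_wpM2l //; lra.
    have : 0 <= tJ by exact: ltW.
    nra.
  apply: le_lt_trans (enormB_le _ (f (rC s * z)) _) _.
  have := inner _ sz; lra.
suff : r + tJ <= r by lra.
apply: sup_upper_bound => //; split => //.
by apply/andP; split; lra.
Qed.

End Localization.

(** * Kobayashi chains *)

Section PoincareRadius.
Variable R : realType.
Implicit Types (b s t x y : R).

Definition rho b : R := ln ((1 + b) / (1 - b)) / 2.

Lemma rho0_rho (z : R[i]) : rho0 z = rho (cabs z).
Proof. by []. Qed.

Lemma rho0E : rho 0 = 0.
Proof. by rewrite /rho addr0 subr0 divr1 ln1 mul0r. Qed.

Lemma rhoB_le x y : 0 <= x -> x <= y -> y <= 1 / 2 -> rho y - rho x <= 2 * (y - x).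
Proof.
move=> x0 xy y1.
have E : (1 + y) / (1 - y) / ((1 + x) / (1 - x)) = 1 + 2 * (y - x) / ((1 - y) * (1 + x)).
  by field; rewrite !gt_eqF //; lra.
have P : 0 < (1 - y) * (1 + x) by rewrite mulr_gt0 //; lra.
have : ln ((1 + y) / (1 - y)) - ln ((1 + x) / (1 - x)) <= 2 * (y - x) / ((1 - y) * (1 + x)).
  rewrite -ln_div ?posrE ?divr_gt0 //; try lra.
  rewrite E; apply: le_ln1Dx; apply: (@lt_le_trans _ _ 0) => //.
  by rewrite divr_ge0 ?(ltW P) //; lra.
have : 2 * (y - x) / ((1 - y) * (1 + x)) <= 4 * (y - x).
  have Q : 1 / 2 <= (1 - y) * (1 + x) by nra.
  have yx : 0 <= 4 * (y - x) by lra.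
  by rewrite ler_pdivrMr //; have := ler_wpM2l yx Q; lra.
rewrite /rho; lra.
Qed.

Lemma le_rho x : 0 <= x < 1 -> x <= 2 * rho x.
Proof.
move=> /andP[x0 x1]; rewrite /rho.
have -> : 2 * (ln ((1 + x) / (1 - x)) / 2) = ln ((1 + x) / (1 - x)) by field.
have -> : (1 + x) / (1 - x) = ((1 - x) / (1 + x))^-1 by rewrite invf_div.
have P : 0 < (1 - x) / (1 + x) by rewrite divr_gt0 //; lra.
rewrite lnV ?posrE // lerNr.
have -> : (1 - x) / (1 + x) = 1 + (- (2 * x) / (1 + x)) by field; rewrite gt_eqF //; lra.
apply: le_trans (le_ln1Dx _) _.
  by rewrite ltr_pdivlMr; lra.
by rewrite ler_pdivrMr; nra.
Qed.

Lemma rho_ge0 x : 0 <= x < 1 -> 0 <= rho x.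
Proof. by move=> /[dup] /le_rho; lra. Qed.

(** Restricting a disc to radius [r] turns the parameter [x] into [x / r]. The relative loss is
    linear in [1 - r] because [x] stays away from 1, where [rho] blows up. *)
Lemma rho_div x r : 0 <= x <= 1 / 4 -> 1 / 2 <= r <= 1 ->
  rho (x / r) <= rho x + 8 * (1 - r) * rho x.
Proof.
move=> /andP[x0 x4] /andP[r2 r1].
have r0 : 0 < r by lra.
have xr : x / r <= 1 / 2 by rewrite ler_pdivrMr //; lra.
have xx : x <= x / r by rewrite ler_pdivlMr // ler_piMr.
have := rhoB_le x0 xx xr.
have : x / r - x <= 2 * (x * (1 - r)).
  have -> : x / r - x = x * (1 - r) / r by field; rewrite gt_eqF.
  rewrite ler_pdivrMr // mulrAC -[leLHS]mul1r; apply: ler_pM => //.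
    by rewrite mulr_ge0 //; lra.
  by lra.
have x1 : 0 <= x < 1 by lra.
have := le_rho x1; have : 0 <= 1 - r by lra.
nra.
Qed.

Lemma rho_mobius s t : 0 <= s -> s <= t -> t < 1 ->
  rho t - rho s = rho ((t - s) / (1 - s * t)).
Proof.
move=> s0 st t1.
have s1 : s < 1 by lra.
have p : 0 < 1 - s * t by nra.
have P1 : 0 < (1 + t) / (1 - t) by rewrite divr_gt0 //; lra.
have P2 : 0 < (1 + s) / (1 - s) by rewrite divr_gt0 //; lra.
rewrite /rho -mulrBl -ln_div ?posrE //; congr (ln _ / _).
field; do ?[apply/andP; split]; rewrite gt_eqF //; nra.
Qed.

End PoincareRadius.

Section Mobius.
Variable R : realType.
Implicit Types (s t : R) (w : R[i]).

(** The automorphism of the unit disc that preserves the real axis and sends 0 to [s], for real [s]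
    of modulus less than 1. *)
Definition mob s w := (w + rC s) / (1 + rC s * w).

Lemma mob_sqr s w :
  cabs (1 + rC s * w) ^+ 2 - cabs (w + rC s) ^+ 2 = (1 - s ^+ 2) * (1 - cabs w ^+ 2).
Proof. by rewrite !cabs_sqr; case: w => a b; rewrite !cReImE /=; ring. Qed.

Lemma mob_den s w : `|s| < 1 -> cabs w < 1 -> 1 + rC s * w != 0.
Proof.
move=> s1 w1; apply: contraTneq w1 => E.
have := cabsD (1 + rC s * w) (- (rC s * w)).
rewrite addrK E cabs0 cabs1 add0r cabsN cabsM cabs_rC -leNgt => h.
have := cabs_ge0 w; have := normr_ge0 s; nra.
Qed.

Lemma mob_lt1 s w : `|s| < 1 -> cabs w < 1 -> cabs (mob s w) < 1.
Proof.
move=> s1 w1; have n0 := mob_den s1 w1.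
rewrite cabsM cabsV ltr_pdivrMr ?cabs_gt0 // mul1r.
rewrite -(ltr_pXn2r (_ : 0 < 2)%N) ?nnegrE ?cabs_ge0 // -subr_gt0 mob_sqr.
have w0 := cabs_ge0 w; have s0 := normr_ge0 s.
by rewrite -(real_normK (num_real s)) mulr_gt0 // subr_gt0 expr_lt1.
Qed.

Lemma mob_cdiff s w : `|s| < 1 -> cabs w < 1 -> cdiff (mob s) w.
Proof.
move=> s1 w1.
have d2 : cderiv (fun w => 1 + rC s * w) w (rC s).
  by have := cderiv_affine (rC s) 1 w; congr cderiv; apply: funext => z; rewrite addrC.
have := cderivM (cderiv_affine 1 (rC s) w) (cderivV d2 (mob_den s1 w1)).
set a := _ + _ => H; exists a; move: H; congr cderiv; apply: funext => z.
by rewrite /mob mul1r.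
Qed.

Lemma mob0 s : mob s 0 = rC s.
Proof. by rewrite /mob add0r mulr0 addr0 divr1. Qed.

Lemma mob_rC s t : 0 < 1 + s * t -> mob s (rC t) = rC ((t + s) / (1 + s * t)).
Proof.
by move=> h; rewrite /mob -rCD -rCM -rC1 -rCD -rCV -rCM.
Qed.

End Mobius.

Section Chains.
Variables (R : realType) (T : Type).
Implicit Types (H : T -> T -> R -> Prop) (x y z : T) (s t : R).

(** The cost is an index of the inductive family, so that concatenation, reversal and refinement are
    plain inductions; [chain_seq] and [seq_chain] translate to and from the indexed families in
    [kob]. *)
Inductive chain H : T -> T -> R -> Prop :=
| chain_nil x : chain H x x 0
| chain_cons x y z s t : H x y s -> chain H y z t -> chain H x z (s + t).

Lemma chain1 H x y t : H x y t -> chain H x y t.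
Proof. by move=> h; rewrite -(addr0 t); apply: chain_cons h (chain_nil _ _). Qed.

Lemma chain_cat H x y z s t : chain H x y s -> chain H y z t -> chain H x z (s + t).
Proof.
move=> c; elim: c t => {x y s} [x t|x y y' s s' h _ IH t c]; first by rewrite add0r.
by rewrite -addrA; apply: chain_cons h (IH _ c).
Qed.

Lemma chain_map H H' x y t : (forall x y t, H x y t -> chain H' x y t) ->
  chain H x y t -> chain H' x y t.
Proof.
move=> HH; elim=> {x y t} [x|x y z s t h _ IH]; first exact: chain_nil.
exact: chain_cat (HH _ _ _ h) IH.
Qed.

Lemma chain_sym H x y t : (forall x y t, H x y t -> H y x t) ->
  chain H x y t -> chain H y x t.
Proof.
move=> HH; elim=> {x y t} [x|x y z s t h _ IH]; first exact: chain_nil.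
by rewrite addrC; apply: chain_cat IH (chain1 (HH _ _ _ h)).
Qed.

Lemma chain_seq H x y t : chain H x y t -> exists n (z : nat -> T) (r : nat -> R),
  [/\ z 0%N = x, z n = y, forall i, (i < n)%N -> H (z i) (z i.+1) (r i) &
      t = \sum_(i < n) r i].
Proof.
elim=> {x y t} [x|x y z s t h _ [n [w [r [w0 wn wH ->]]]]].
  by exists 0%N, (fun=> x), (fun=> 0); split => //; rewrite big_ord0.
exists n.+1, (fun i => if i is j.+1 then w j else x), (fun i => if i is j.+1 then r j else s).
split => //; last by rewrite big_ord_recl.
by case=> [_|i]; [rewrite w0|rewrite ltnS; exact: wH].
Qed.

Lemma seq_chain H (z : nat -> T) (r : nat -> R) i j : (i <= j)%N ->
  (forall k, (i <= k < j)%N -> H (z k) (z k.+1) (r k)) ->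
  chain H (z i) (z j) (\sum_(i <= k < j) r k).
Proof.
elim: j => [|j IH]; first by rewrite leqn0 => /eqP -> _; rewrite big_geq //; exact: chain_nil.
rewrite leq_eqVlt => /predU1P[->|]; first by rewrite big_geq //; move=> _; exact: chain_nil.
rewrite ltnS => ij Hk; rewrite big_nat_recr //.
apply: chain_cat (IH ij _) _.
  by move=> k /andP[ik kj]; apply: Hk; rewrite ik ltnW.
by apply: chain1; apply: Hk; rewrite ij ltnSn.
Qed.

End Chains.

(** * Hops along analytic discs and the Kobayashi distance *)

Section Hops.
Variables (R : realType) (d : nat).
Implicit Types (Om : set (Cd R d)) (f : R[i] -> Cd R d) (x y p q : Cd R d) (e s t b : R).

(* The end point of the disc parameter can be taken on the nonnegative real axis. *)
Definition hop Om e x y t := exists f b,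
  [/\ disc_holo f, (forall w, cabs w < 1 -> Om (f w)), (0 <= b <= e) && (b < 1),
      f 0 = x /\ f (rC b) = y & t = rho b].

Lemma disc_holo_comp f (m : R[i] -> R[i]) : disc_holo f ->
  (forall w, cabs w < 1 -> cabs (m w) < 1 /\ cdiff m w) -> disc_holo (fun w => f (m w)).
Proof. by move=> fh mh z /mh [m1 md]; apply: vdiff_comp md (fh _ m1). Qed.

Lemma cdiff_scale (a : R[i]) w : cdiff (fun z => a * z) w.
Proof.
exists a; have := cderiv_affine a 0 w; congr cderiv; apply: funext => z.
by rewrite addr0.
Qed.

Lemma hop_mobius Om e f s t : disc_holo f -> (forall w, cabs w < 1 -> Om (f w)) ->
  0 <= s -> s <= t -> t < 1 -> (t - s) / (1 - s * t) <= e ->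
  hop Om e (f (rC s)) (f (rC t)) (rho t - rho s).
Proof.
move=> fh fOm s0 st t1 te.
have s1 : `|s| < 1 by rewrite ger0_norm //; lra.
have p : 0 < 1 - s * t by nra.
exists (fun w => f (mob s w)), ((t - s) / (1 - s * t)); split.
- by apply: disc_holo_comp => // w w1; split; [exact: mob_lt1|exact: mob_cdiff].
- by move=> w w1; apply: fOm; exact: mob_lt1.
- rewrite te andbT; apply/andP; split; first by rewrite divr_ge0 //; lra.
  by rewrite ltr_pdivrMr //; nra.
- rewrite mob0 mob_rC; last first.
    have : 0 <= s * ((t - s) / (1 - s * t)) by rewrite mulr_ge0 // divr_ge0 //; lra.
    by lra.
  split => //; congr (f (rC _)); field.
  have -> : 1 - s * t + s * (t - s) = 1 - s ^+ 2 by ring.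
  apply/andP; split; rewrite gt_eqF //; nra.
- exact: rho_mobius.
Qed.

(** Equally spaced points on the radius up to [b] have pseudo-hyperbolic distance at most
    [(b / m) / (1 - b)], and the costs telescope, so refining a hop is free. *)
Lemma hop_subdivide Om e f b : 0 < e -> disc_holo f -> (forall w, cabs w < 1 -> Om (f w)) ->
  0 <= b < 1 -> chain (hop Om e) (f 0) (f (rC b)) (rho b).
Proof.
move=> e0 fh fOm /andP[b0 b1].
have eb : 0 < e * (1 - b) by rewrite mulr_gt0 //; lra.
set m := (Num.truncn (b / (e * (1 - b)))).+1.
have mP : b / (e * (1 - b)) < m%:R by rewrite /m Num.Theory.truncnS_gt.
have m0 : 0 < m%:R :> R by rewrite ltr0n.
have mb : b / m%:R <= e * (1 - b).
  by rewrite ler_pdivrMr // mulrC -ler_pdivrMr // ltW.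
suff H j : (j <= m)%N -> chain (hop Om e) (f 0) (f (rC (j%:R * (b / m%:R)))) (rho (j%:R * (b / m%:R))).
  by have := H m (leqnn _); rewrite mulrCA divff ?mulr1 // gt_eqF.
elim: j => [_|j IH jm]; first by rewrite mul0r rho0E; exact: chain_nil.
set c := b / m%:R in mb IH *.
have c0 : 0 <= c by rewrite divr_ge0 // ltW.
have cb : j.+1%:R * c <= b.
  have -> : b = m%:R * c by rewrite /c mulrCA divff ?mulr1 // gt_eqF.
  by rewrite ler_wpM2r // ler_nat.
have jE : j.+1%:R * c = j%:R * c + c by rewrite -addn1 natrD mulrDl mul1r.
have jc : 0 <= j%:R * c by rewrite mulr_ge0.
have -> : rho (j.+1%:R * c) = rho (j%:R * c) + (rho (j.+1%:R * c) - rho (j%:R * c)) by ring.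
apply: chain_cat (IH (ltnW jm)) _; apply: chain1; apply: hop_mobius => //; rewrite ?jE.
- by rewrite lerDl.
- by rewrite -jE; lra.
- have p : 1 - b <= 1 - j%:R * c * (j%:R * c + c) by rewrite -jE; nra.
  rewrite ler_pdivrMr; last by lra.
  have -> : j%:R * c + c - j%:R * c = c by ring.
  by apply: le_trans mb _; rewrite ler_pM2l.
Qed.

(** The automorphism [w |-> mob b (- w)] exchanges 0 and [b]. *)
Lemma hop_sym Om e x y t : hop Om e x y t -> hop Om e y x t.
Proof.
move=> [f [b [fh fOm /andP[/andP[b0 be] b1] [<- <-] ->]]].
have s1 : `|b| < 1 by rewrite ger0_norm.
have Nw (w : R[i]) : cabs w < 1 -> cabs (-1 * w) < 1 by rewrite mulN1r cabsN.
exists (fun w => f (mob b (-1 * w))), b; split => //.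
- apply: disc_holo_comp => // w /Nw w1; split; first exact: mob_lt1.
  have [m1 H1] := mob_cdiff s1 w1; have [m2 H2] := cdiff_scale (-1) w.
  by eexists; apply: cderiv_comp H2 H1.
- by move=> w /Nw w1; apply: fOm; exact: mob_lt1.
- by rewrite b0 be.
- rewrite mulr0 mob0 mulN1r -rCN mob_rC; last by nra.
  by rewrite addNr mul0r.
Qed.

Lemma hop_widen Om Om' e e' x y t : (Om `<=` Om') -> e <= e' -> hop Om e x y t -> hop Om' e' x y t.
Proof.
move=> OO ee [f [b [fh fOm /andP[/andP[b0 be] b1] fxy ->]]].
exists f, b; split => //; first by move=> w /fOm /OO.
by rewrite b0 b1 (le_trans be).
Qed.

Lemma hop_ge0 Om e x y t : hop Om e x y t -> 0 <= t.
Proof. by move=> [f [b [_ _ /andP[/andP[b0 _] b1] _ ->]]]; rewrite rho_ge0 // b0. Qed.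

Lemma chain_hop_fine Om e x y t : 0 < e -> chain (hop Om 1) x y t -> chain (hop Om e) x y t.
Proof.
move=> e0; apply: chain_map => {}x {}y {}t [f [b [fh fOm /andP[/andP[b0 _] b1] [<- <-] ->]]].
by apply: hop_subdivide; rewrite // b0.
Qed.

Lemma chain_hop_sym Om e x y t : chain (hop Om e) x y t -> chain (hop Om e) y x t.
Proof. by apply: chain_sym => {}x {}y {}t; exact: hop_sym. Qed.

Lemma chain_hop_widen Om Om' e e' x y t : (Om `<=` Om') -> e <= e' ->
  chain (hop Om e) x y t -> chain (hop Om' e') x y t.
Proof. by move=> OO ee; apply: chain_map => {}x {}y {}t /(hop_widen OO ee); exact: chain1. Qed.

Lemma chain_hop_ge0 Om e x y t : chain (hop Om e) x y t -> 0 <= t.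
Proof.
move=> c; elim: c => {x y t} [x|x y z s t h _ t0]; first by rewrite lexx.
by rewrite addr_ge0 // (hop_ge0 h).
Qed.

Lemma disc_hop Om f (b : R[i]) : disc_holo f -> (forall w, cabs w < 1 -> Om (f w)) ->
  cabs b < 1 -> hop Om 1 (f 0) (f b) (rho0 b).
Proof.
move=> fh fOm b1.
have [u [u1 ub]] : exists u : R[i], cabs u = 1 /\ u * rC (cabs b) = b.
  have [->|b0] := eqVneq b 0; first by exists 1; rewrite cabs1 cabs0 mulr0.
  have n0 : rC (cabs b) != 0 by rewrite rC_eq0 gt_eqF // cabs_gt0.
  exists (b / rC (cabs b)); rewrite divfK //; split => //.
  by rewrite cabsM cabsV cabs_rC ger0_norm ?cabs_ge0 // divff // gt_eqF // cabs_gt0.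
exists (fun w => f (u * w)), (cabs b); split => //.
- by apply: disc_holo_comp => // w w1; rewrite cabsM u1 mul1r; split => //; exact: cdiff_scale.
- by move=> w w1; apply: fOm; rewrite cabsM u1 mul1r.
- by rewrite cabs_ge0 b1 ltW.
- by rewrite mulr0 ub.
Qed.

(** With [e = 1] the size restriction in [hop] is void, so together with [kob_chain] this identifies
    [kob] with the infimum of the chain costs. *)
Lemma chain_kob Om p q t : chain (hop Om 1) p q t -> (kob Om p q <= t%:E)%E.
Proof.
move=> c; have [n [z [r [z0 zn hz ->]]]] := chain_seq c.
pose P i (fb : (R[i] -> Cd R d) * R) := (i < n)%N ->
  [/\ disc_holo fb.1, (forall w, cabs w < 1 -> Om (fb.1 w)), 0 <= fb.2 < 1,
      fb.1 0 = z i /\ fb.1 (rC fb.2) = z i.+1 & r i = rho fb.2].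
have ex i : {fb | P i fb}.
  apply: cid; have [lt|ge] := boolP (i < n)%N; last by exists (fun=> 0, 0) => lt; rewrite lt in ge.
  have [f [b [h1 h2 /andP[/andP[b0 _] b1] h4 h5]]] := hz i lt.
  by exists (f, b) => _; split => //=; rewrite b0.
apply: ereal_inf_lbound; exists n, z, (fun i => (sval (ex i)).1), (fun i => rC (sval (ex i)).2).
split => //.
  move=> i /(svalP (ex i)) [h1 h2 /andP[b0 b1] [h4 h5] _].
  by split => //; rewrite cabs_rC ger0_norm.
congr (_%:E); apply: eq_bigr => i _.
have [_ _ /andP[b0 b1] _ ->] := svalP (ex i) (ltn_ord i).
by rewrite rho0_rho cabs_rC ger0_norm.
Qed.

Lemma kob_chain Om p q (t : \bar R) : (kob Om p q < t)%E ->
  exists s, chain (hop Om 1) p q s /\ (s%:E < t)%E.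
Proof.
move=> /ereal_inf_lt [_ [n [z [f [b [z0 zn hz ->]]]]] lt].
exists (\sum_(i < n) rho0 (b i)); split => //.
rewrite -z0 -zn -(big_mkord xpredT (fun i => rho0 (b i))).
apply: seq_chain => // k /andP[_ /hz [h1 h2 h3 <- <-]].
exact: disc_hop.
Qed.

Lemma kob_ge0 Om p q : (0 <= kob Om p q)%E.
Proof.
rewrite leNgt; apply/negP => /kob_chain [s [/chain_hop_ge0 s0]].
by rewrite lte_fin ltNge s0.
Qed.

Lemma kob_subset Om Om' p q : Om `<=` Om' -> (kob Om' p q <= kob Om p q)%E.
Proof.
move=> OO; rewrite leNgt; apply/negP => /kob_chain [s [/(chain_hop_widen OO (lexx 1))]].
by move=> /chain_kob; rewrite leNgt => /negP.
Qed.

End Hops.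

(** * Chains of bounded cost inside a convex chart *)

Section ChartChains.
Variables (R : realType) (d : nat).
Implicit Types (Om V D : set (Cd R d)) (Phi Psi : Cd R d -> Cd R d) (a b o x y : Cd R d).

(** The affine disc with direction [2 (b - a)] stays in the ball and meets [b] at parameter [1/2];
    the price is the same for every radius. *)
Lemma ball_hop Om V Phi Psi a b (r : R) : holo_on (Phi @` V) Psi ->
  (forall x, V x -> Psi (Phi x) = x) -> 0 < r -> eball a r `<=` Phi @` (V `&` Om) ->
  enorm (b - a) <= r / 2 -> hop (Om `&` V) 1 (Psi a) (Psi b) (rho (1 / 2)).
Proof.
move=> hPsi PsiK r0 ball ba.
have inb (w : R[i]) : cabs w < 1 -> eball a r (a + w *: (rC 2 *: (b - a))).
  move=> w1; rewrite /eball /= addrAC subrr add0r !enormZ cabs_rC ger0_norm //.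
  have b0 := enorm_ge0 (b - a); have w0 := cabs_ge0 w; nra.
exists (fun w => Psi (a + w *: (rC 2 *: (b - a)))), (1 / 2); split.
- move=> w /inb/ball [z [Vz _] zE]; apply: (@vdiff_holo _ _ _ Psi (fun u => a + u *: (rC 2 *: (b - a))) _ hPsi); last exact: vdiff_affine.
  by exists z.
- by move=> w /inb/ball [z [Vz Oz] <-]; rewrite PsiK.
- by apply/andP; split; [apply/andP; split|]; lra.
- rewrite scale0r addr0; split => //; congr Psi.
  rewrite scalerA -rCM (_ : 1 / 2 * 2 = 1) ?rC1 ?scale1r ?subrKC //; by field.
- by [].
Qed.

(** The homothety with centre [a] and ratio [s] carries the ball around [o] onto this ball. *)
Lemma convex_ball_join D a o (r s : R) : convex_set D -> D a -> eball o r `<=` D ->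
  0 < s <= 1 -> eball (a + rC s *: (o - a)) (s * r) `<=` D.
Proof.
move=> cD Da ball /andP[s0 s1] y; rewrite /eball /=; set v := y - _ => vr.
have Dv : D (o + rC s^-1 *: v).
  apply: ball; rewrite /eball /= addrAC subrr add0r enormZ cabs_rC gtr0_norm ?invr_gt0 //.
  by rewrite ltr_pdivrMl.
have s01 : 0 <= s <= 1 by rewrite (ltW s0).
have := cD _ _ Dv Da s s01; congr (D _).
rewrite scalerDr scalerA -rCM divff ?gt_eqF // rC1 scale1r /v rCB rC1.
by apply/rowP => i; rewrite !mxE; ring.
Qed.

(* The points a + q^j (o - a) with q = 1 - r / (2 M): consecutive ones are half
   a radius apart inside the convex hull of a and the ball around o. *)
Lemma convex_chain_bound (r M : R) : 0 < r -> r <= M ->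
  exists2 c : R, 0 < c & forall Om V Phi Psi o,
    holo_on (Phi @` V) Psi -> (forall x, V x -> Psi (Phi x) = x) ->
    convex_set (Phi @` (V `&` Om)) ->
    (forall x y, (Phi @` (V `&` Om)) x -> (Phi @` (V `&` Om)) y -> enorm (x - y) <= M) ->
    eball o r `<=` Phi @` (V `&` Om) ->
    forall a b m, eball a (2^-1 ^+ m) `<=` Phi @` (V `&` Om) ->
      eball b (2^-1 ^+ m) `<=` Phi @` (V `&` Om) ->
      exists t, chain (hop (Om `&` V) 1) (Psi a) (Psi b) t /\ t <= c * m.+1%:R.
Proof.
move=> r0 rM; have M0 : 0 < M by lra.
have c00 : 0 < rho (1 / 2 : R).
  by have := @le_rho R (1 / 2) (_ : _); lra.
set c0 := rho (1 / 2) in c00.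
set k := r / (2 * M).
have k0 : 0 < k by rewrite divr_gt0 // mulr_gt0.
have k1 : k <= 1 / 2.
  by rewrite /k ler_pdivrMr ?mulr_gt0 //; lra.
set q := 1 - k.
have q01 : 0 <= q < 1 by rewrite /q; lra.
have h2 : 0 < 2^-1 :> R by rewrite invr_gt0.
have [N1 HN1] := expr_small q01 h2.
have [N2 HN2] := expr_small q01 (divr_gt0 h2 M0).
have q1 := HN1 N1 (leqnn _); have q2 := HN2 N2 (leqnn _).
(* Each block of [N1] steps halves the distance to [a], and [N2] further steps make up for the
   diameter [M]. After [n m] steps one is within half of [2^-m] of [a], where a last hop centred at
   [a] applies; [n] being affine, the cost is linear in the level. *)
pose n m := (N1 * m + N2)%N.
have q0 : 0 < q by rewrite /q; lra.
have nP m : q ^+ n m * M <= 2^-1 ^+ m / 2.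
  rewrite exprD exprM -mulrA; apply: ler_pM.
  - by rewrite exprn_ge0 // exprn_ge0 // ltW.
  - by rewrite mulr_ge0 ?exprn_ge0 // ltW.
  - by rewrite lerXn2r ?nnegrE ?exprn_ge0 ?(ltW h2) ?(ltW q0) // ltW.
  - by rewrite -ler_pdivlMr // ltW.
exists (2 * ((N1 + N2).+1)%:R * c0); first by apply: mulr_gt0 c00; rewrite mulr_gt0.
move=> Om V Phi Psi o hPsi PsiK cD DM ball.
set D := Phi @` (V `&` Om) in cD DM ball *.
have Do : D o by apply: ball; rewrite /eball /= subrr enorm0.
suff H a m : eball a (2^-1 ^+ m) `<=` D ->
    chain (hop (Om `&` V) 1) (Psi o) (Psi a) ((n m).+1%:R * c0).
  move=> a b m /H Ha /H Hb.
  exists ((n m).+1%:R * c0 + (n m).+1%:R * c0); split.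
    by apply: chain_cat Hb; exact: chain_hop_sym.
  have : ((n m).+1 <= (N1 + N2).+1 * m.+1)%N.
    rewrite /n mulSn mulnDl addSn ltnS; apply: leq_trans (leq_addl _ _).
    by apply: leq_add; rewrite ?leq_mul // leq_pmulr.
  rewrite -(ler_nat R) natrM => /(ler_wpM2r (ltW c00)); lra.
move=> ball_a.
have p2 : 0 < 2^-1 ^+ m :> R by rewrite exprn_gt0.
have Da : D a by apply: ball_a; rewrite /eball /= subrr enorm0.
pose z j := a + rC (q ^+ j) *: (o - a).
have qj j : 0 < q ^+ j <= 1 by rewrite exprn_gt0 //= exprn_ile1 ?(ltW q0) // /q; lra.
have zb j : eball (z j) (q ^+ j * r) `<=` D by exact: convex_ball_join.
have oa : enorm (o - a) <= M by exact: DM.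
have C j : chain (hop (Om `&` V) 1) (Psi o) (Psi (z j)) (j%:R * c0).
  elim: j => [|j IH]; first by rewrite /z expr0 rC1 scale1r subrKC mul0r; exact: chain_nil.
  rewrite -addn1 natrD mulrDl mul1r; apply: chain_cat IH _; apply: chain1; rewrite addn1.
  have qr : 0 < q ^+ j * r by rewrite mulr_gt0 // exprn_gt0.
  apply: (ball_hop hPsi PsiK qr (zb j)).
  have -> : z j.+1 - z j = - (rC (q ^+ j * k) *: (o - a)).
    have -> : q ^+ j * k = q ^+ j - q ^+ j.+1 by rewrite exprS /q; ring.
    by rewrite /z rCB; apply/rowP => i; rewrite !mxE; ring.
  have qk : 0 < q ^+ j * k by apply: mulr_gt0 => //; rewrite exprn_gt0.
  rewrite enormN enormZ cabs_rC (gtr0_norm qk) -!mulrA ler_pM2l ?exprn_gt0 //.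
  rewrite mulrA -/k; apply: le_trans (ler_wpM2l (ltW k0) oa) _.
  by rewrite le_eqVlt; apply/orP; left; apply/eqP; rewrite /k; field; rewrite gt_eqF.
rewrite -addn1 natrD mulrDl mul1r; apply: chain_cat (C _) _.
apply: chain1; apply: hop_sym.
apply: (ball_hop hPsi PsiK p2 ball_a).
rewrite /z addrAC subrr add0r enormZ cabs_rC gtr0_norm ?exprn_gt0 //.
by apply: le_trans (nP m); rewrite ler_pM2l // exprn_gt0.
Qed.

End ChartChains.

(** * Interior balls of uniform radius, and their images under charts *)

Section UniformBalls.
Variables (R : realType) (d : nat).
Implicit Types (Om V D : set (Cd R d)) (x y o xi : Cd R d).

Lemma enorm_le_sum x : enorm x <= \sum_(i < d) cabs (x ord0 i).
Proof.
have S0 : 0 <= \sum_(i < d) cabs (x ord0 i) by apply: sumr_ge0 => i _; exact: cabs_ge0.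
rewrite -(ler_pXn2r (_ : 0 < 2)%N) ?nnegrE ?enorm_ge0 // enorm_sqr [leRHS]expr2 mulr_suml.
apply: ler_sum => i _; rewrite expr2 ler_wpM2l ?cabs_ge0 //.
by rewrite (bigD1 i) //= lerDl sumr_ge0 // => j _; exact: cabs_ge0.
Qed.

Lemma coord_le_enorm x i : cabs (x ord0 i) <= enorm x.
Proof.
rewrite -(ler_pXn2r (_ : 0 < 2)%N) ?nnegrE ?enorm_ge0 ?cabs_ge0 // enorm_sqr.
by rewrite (bigD1 i) //= lerDl sumr_ge0 // => j _; exact: sqr_ge0.
Qed.

(** The inverse of [1] plus the sum of the inverses serves as a minimum and also covers an empty
    [T]. *)
Lemma finite_lower_bound (T : finType) (r : T -> R) : (forall c, 0 < r c) ->
  exists2 r0, 0 < r0 & forall c, r0 <= r c.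
Proof.
move=> rp; pose S := 1 + \sum_c (r c)^-1.
have S0 : 0 < S.
  by rewrite ltr_pwDl // sumr_ge0 // => c _; rewrite invr_ge0 ltW.
exists S^-1; first by rewrite invr_gt0.
move=> c; rewrite -[leRHS]invrK lef_pV2 ?posrE ?invr_gt0 // /S (bigD1 c) //=.
rewrite addrCA lerDl addr_ge0 // sumr_ge0 // => j _.
by rewrite invr_ge0 ltW.
Qed.

(* Total boundedness of Om, via the cells of a grid of mesh eta. *)
Lemma uniform_interior_ball Om (s : R) : eopen Om -> ebounded Om -> 0 < s ->
  exists2 r : R, 0 < r & forall x, Om x ->
    exists o, enorm (o - x) < s /\ eball o r `<=` Om.
Proof.
move=> oO [M OM] s0.
pose M1 := `|M| + 1.
have M10 : 0 < M1 by rewrite ltr_pwDr.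
(* Points of one cell differ by less than [eta] in each real coordinate, hence by at most [2 d eta]
   in norm; [d + 1] makes this less than [s] even for [d = 0]. *)
pose eta := s / (2 * (d%:R + 1)).
have d1 : 0 < d%:R + 1 :> R by rewrite ltr_wpDl.
have eta0 : 0 < eta by rewrite divr_gt0 // mulr_gt0.
pose N := (Num.truncn (2 * M1 / eta)).+1.
pose cl (u : R) : 'I_N.+1 := inord (Num.truncn ((u + M1) / eta)).
have clP (u v : R) : `|u| <= M1 -> `|v| <= M1 -> cl u = cl v -> `|u - v| < eta.
  have B (t : R) : `|t| <= M1 -> 0 <= (t + M1) / eta /\ (Num.truncn ((t + M1) / eta) < N.+1)%N.
    rewrite ler_norml => /andP[t1 t2].
    have p : 0 <= (t + M1) / eta by rewrite divr_ge0 ?(ltW eta0) //; lra.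
    split=> //; rewrite ltnS /N; apply: leqW; apply: Num.Theory.le_truncn.
    by rewrite ler_pM2r ?invr_gt0 //; lra.
  move=> /B [u0 uN] /B [v0 vN] /(congr1 val); rewrite /= !inordK // => E.
  have := Num.Theory.truncn_itv u0; have := Num.Theory.truncn_itv v0; rewrite E.
  set n := Num.truncn _ => /andP[v1 v2] /andP[u1 u2].
  have n1 : n.+1%:R = n%:R + 1 :> R by rewrite -natr1.
  have : `|(u + M1) / eta - (v + M1) / eta| < 1 by rewrite ltr_norml; lra.
  rewrite -mulrBl normrM normfV (gtr0_norm eta0) ltr_pdivrMr // mul1r.
  by congr (`|_| < _); ring.
pose cell x : {ffun 'I_d -> 'I_N.+1 * 'I_N.+1} :=
  [ffun i => (cl (complex.Re (x ord0 i)), cl (complex.Im (x ord0 i)))].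
have cellP x y : Om x -> Om y -> cell x = cell y -> enorm (x - y) < s.
  move=> Ox Oy E; apply: le_lt_trans (enorm_le_sum _) _.
  have xM z i : Om z -> cabs (z ord0 i) <= M1.
    move=> /OM zM; apply: le_trans (coord_le_enorm z i) (le_trans zM _).
    by rewrite /M1; have := ler_norm M; lra.
  apply: le_lt_trans (_ : \sum_(i < d) 2 * eta < _).
    apply: ler_sum => i _; rewrite !mxE; have := congr1 (fun g : {ffun _} => g i) E.
    rewrite !ffunE => -[E1 E2].
    have := clP _ _ (le_trans (normRe_le _) (xM x i Ox)) (le_trans (normRe_le _) (xM y i Oy)) E1.
    have := clP _ _ (le_trans (normIm_le _) (xM x i Ox)) (le_trans (normIm_le _) (xM y i Oy)) E2.
    rewrite -cReN -cReD -cImN -cImD => k1 k2.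
    by apply: le_trans (cabs_le_ReIm _) _; lra.
  rewrite sumr_const card_ord -[_ *+ d]mulr_natl.
  have eta2 : 0 < 2 * eta by lra.
  have -> : s = (d%:R + 1) * (2 * eta) by rewrite /eta; field; rewrite gt_eqF.
  by rewrite ltr_pM2r // ltrDl.
(* One point and one ball are chosen per nonempty cell; the dummy radius 1 of an empty cell only has
   to be positive for the finite minimum. *)
have ex c : {p : Cd R d * R | 0 < p.2 /\ ((exists x, Om x /\ cell x = c) ->
    [/\ Om p.1, cell p.1 = c & eball p.1 p.2 `<=` Om])}.
  apply: cid; have [[x [Ox xc]]|nx] := pselect (exists x, Om x /\ cell x = c).
    by have [e e0 He] := oO _ Ox; exists (x, e).
  by exists (0, 1); split => // /nx.
have [r r0 rP] := @finite_lower_bound _ (fun c => (sval (ex c)).2) (fun c => proj1 (svalP (ex c))).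
exists r => // x Ox.
have [_ H] := svalP (ex (cell x)); have [|H1 H2 H3] := H; first by exists x.
exists (sval (ex (cell x))).1; split; first exact: cellP.
by move=> y yr; apply: H3; apply: lt_le_trans yr (rP _).
Qed.

(** The intervals of radius [K (T - s)] around [phi s] meet pairwise; the supremum of their left
    ends lies in all of them, which yields the limit together with its rate. *)
Lemma lipschitz_limit (phi : R -> R) (K T : R) : 0 < T ->
  (forall s t, 0 <= s < T -> 0 <= t < T -> `|phi s - phi t| <= K * `|s - t|) ->
  exists l, forall s, 0 <= s < T -> `|phi s - l| <= K * (T - s).
Proof.
move=> T0 H.
set E := [set phi s - K * (T - s) | s in [set s | 0 <= s < T]].
have ub s : 0 <= s < T -> ubound E (phi s + K * (T - s)).
  move=> sT _ [t /= tT <-]; have := H t s tT sT; rewrite ler_norml => /andP[_].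
  have K0 : 0 <= K.
    have h0 : 0 <= (0 : R) < T by rewrite lexx.
    have h1 : 0 <= T / 2 < T by lra.
    have := le_trans (normr_ge0 _) (H 0 (T / 2) h0 h1).
    by rewrite sub0r normrN gtr0_norm ?divr_gt0 // pmulr_lge0 // divr_gt0.
  have kt : 0 <= K * (T - t) by rewrite mulr_ge0 //; lra.
  have ks : 0 <= K * (T - s) by rewrite mulr_ge0 //; lra.
  by case: (lerP s t) => st; lra.
have h0 : 0 <= (0 : R) < T by rewrite lexx.
have hE : has_sup E.
  by split; [exists (phi 0 - K * (T - 0)), 0|exists (phi 0 + K * (T - 0)); exact: ub].
exists (sup E) => s sT; rewrite ler_norml; apply/andP; split.
  have : sup E <= phi s + K * (T - s) by apply: ge_sup; [case: hE|exact: ub].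
  lra.
have : phi s - K * (T - s) <= sup E by apply: sup_upper_bound => //; exists s.
lra.
Qed.

Lemma lipschitz_limit_vec (phi : R -> Cd R d) (K T : R) : 0 < T ->
  (forall s t, 0 <= s < T -> 0 <= t < T -> enorm (phi s - phi t) <= K * `|s - t|) ->
  exists l, forall s, 0 <= s < T -> enorm (phi s - l) <= 2 * d%:R * K * (T - s).
Proof.
move=> T0 H.
have Hc i s t : 0 <= s < T -> 0 <= t < T -> cabs (phi s ord0 i - phi t ord0 i) <= K * `|s - t|.
  by move=> sT tT; have := coord_le_enorm (phi s - phi t) i; rewrite !mxE => /le_trans; apply; exact: H.
have HR i : {l | forall s, 0 <= s < T -> `|complex.Re (phi s ord0 i) - l| <= K * (T - s)}.
  apply: cid; apply: lipschitz_limit => // s t sT tT.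
  by apply: le_trans (Hc i s t sT tT); rewrite -cReN -cReD normRe_le.
have HI i : {l | forall s, 0 <= s < T -> `|complex.Im (phi s ord0 i) - l| <= K * (T - s)}.
  apply: cid; apply: lipschitz_limit => // s t sT tT.
  by apply: le_trans (Hc i s t sT tT); rewrite -cImN -cImD normIm_le.
exists (\row_i Complex (sval (HR i)) (sval (HI i))) => s sT.
apply: le_trans (enorm_le_sum _) _.
apply: le_trans (_ : \sum_(i < d) 2 * (K * (T - s)) <= _); last first.
  rewrite sumr_const card_ord -[_ *+ d]mulr_natl.
  by rewrite le_eqVlt; apply/orP; left; apply/eqP; ring.
apply: ler_sum => i _; rewrite !mxE; apply: le_trans (cabs_le_ReIm _) _.
rewrite cReD cReN cImD cImN [complex.Re (Complex _ _)]/= [complex.Im (Complex _ _)]/=.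
have := svalP (HR i) s sT; have := svalP (HI i) s sT; lra.
Qed.

Lemma bilipschitz_ball_image V (Phi Psi : Cd R d -> Cd R d) o (C r : R) : 0 < C -> 0 < r ->
  eopen (Phi @` V) -> (forall x, V x -> Psi (Phi x) = x) ->
  (forall p q, V p -> V q -> enorm (p - q) <= C * enorm (Phi p - Phi q)) ->
  (forall p q, V p -> V q -> enorm (Phi p - Phi q) <= C * enorm (p - q)) ->
  eball o r `<=` V -> eball (Phi o) (r / (2 * C)) `<=` Phi @` (eball o r).
Proof.
move=> C0 r0 oV PsiK lo up ball y; rewrite /eball /= => yo.
set v := y - Phi o in yo *.
have vr : C * enorm v < r / 2.
  by move: yo; rewrite ltr_pdivlMr ?mulr_gt0 //; lra.
have v0 := enorm_ge0 v.
have Vo : V o by apply: ball; rewrite /eball /= subrr enorm0.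
pose yt (t : R) := Phi o + rC t *: v.
have ytB s t : enorm (yt s - yt t) = `|s - t| * enorm v.
  rewrite /yt -cabs_rC -enormZ; congr enorm.
  by rewrite rCB; apply/rowP => i; rewrite !mxE; ring.
have yt0 : yt 0 = Phi o by rewrite /yt rC0 scale0r addr0.
have yt1 : yt 1 = y by rewrite /yt rC1 scale1r /v subrKC.
pose I := Phi @` V.
have xP t : I (yt t) -> V (Psi (yt t)) /\ Phi (Psi (yt t)) = yt t.
  by move=> [x Vx <-]; rewrite PsiK.
set S := [set t : R | 0 <= t <= 1 /\ forall s, 0 <= s <= t -> I (yt s)].
have S0 : S 0.
  split; first by rewrite lexx ler01.
  by move=> s; rewrite -eq_le => /eqP <-; rewrite yt0; exists o.
have hS : has_sup S by split; [exists 0|exists 1 => t [/andP[_ ->]]].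
set T := sup S.
have T0 : 0 <= T by apply: sup_upper_bound.
have T1 : T <= 1 by apply: ge_sup; [exists 0|move=> t [/andP[_ ->]]].
have ST s : 0 <= s < T -> I (yt s).
  move=> /andP[s0 sT]; have [t [_ Ht] st] := sup_gt (proj1 hS) sT.
  by apply: Ht; rewrite s0 ltW.
have [x [xo xT]] : exists x, eball o r x /\ Phi x = yt T.
  have [T00|Tn0] := eqVneq T 0.
    by exists o; rewrite T00 yt0 /eball /= subrr enorm0.
  have Tp : 0 < T by rewrite lt_neqAle eq_sym Tn0.
  have Hl s t : 0 <= s < T -> 0 <= t < T ->
      enorm (Psi (yt s) - Psi (yt t)) <= C * enorm v * `|s - t|.
    move=> /ST /xP [V1 E1] /ST /xP [V2 E2]; apply: le_trans (lo _ _ V1 V2) _.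
    by rewrite E1 E2 (ytB s t) -mulrA (mulrC (enorm v)).
  have [l Hlim] := lipschitz_limit_vec Tp Hl.
  set Q := 2 * d%:R * (C * enorm v) in Hlim.
  have Q0 : 0 <= Q by rewrite !mulr_ge0 // ltW.
  have nearT e : 0 < e -> exists2 s, 0 <= s < T & T - s < e.
    move=> e0; exists (Num.max 0 (T - e / 2)).
      by rewrite le_max lexx /= gt_max Tp /= gtrBl divr_gt0.
    by rewrite ltrBlDr -ltrBlDl lt_max; apply/orP; right; lra.
  have lo_r : enorm (l - o) <= r / 2.
    apply/ler_addgt0Pr => e e0.
    have eQ : 0 < e / (Q + 1) by rewrite divr_gt0 //; lra.
    have [s sT se] := nearT _ eQ.
    have [V1 E1] := xP _ (ST _ sT).
    have l1 := Hlim s sT; have l2 := lo _ _ V1 Vo.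
    rewrite E1 -yt0 ytB subr0 in l2.
    have : C * (`|s| * enorm v) <= C * enorm v.
      rewrite ler_pM2l // ler_piMl // ger0_norm; first by lra.
      by case/andP: sT.
    move: se; rewrite ltr_pdivlMr; last by lra.
    have := enormB_le l (Psi (yt s)) o; rewrite (enormBC l (Psi (yt s))).
    have : 0 <= T - s by lra.
    lra.
  have lb : eball o r l by rewrite /eball /=; lra.
  have Vl := ball _ lb.
  exists l; split => //.
  suff Z : enorm (Phi l - yt T) <= 0.
    apply/eqP; rewrite -subr_eq0; apply/eqP; apply: enorm0_eq0.
    by apply/eqP; rewrite eq_le Z enorm_ge0.
  apply/ler_addgt0Pr => e e0; rewrite add0r.
  have P0 : 0 < C * Q + enorm v + 1 by have := mulr_ge0 (ltW C0) Q0; lra.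
  have [s sT se] := nearT (e / (C * Q + enorm v + 1)) (divr_gt0 e0 P0).
  have [V1 E1] := xP _ (ST _ sT).
  have l1 := Hlim s sT; have l2 := up _ _ Vl V1; rewrite E1 in l2.
  apply: (@le_trans _ _ (enorm (Phi l - yt s) + `|s - T| * enorm v)).
    by rewrite -(ytB s T) enormB_le.
  have -> : `|s - T| = T - s by rewrite ltr0_norm ?opprB // subr_lt0; case/andP: sT.
  move: se; rewrite ltr_pdivlMr // => se.
  have : C * enorm (l - Psi (yt s)) <= C * (Q * (T - s)) by rewrite ler_pM2l // enormBC.
  lra.
have [T1'|Tn1] := eqVneq T 1; first by exists x => //; rewrite xT T1' yt1.
have Tl1 : T < 1 by rewrite lt_neqAle Tn1.
have IT : I (yt T) by exists x => //; exact: ball.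
have [e e0 He] := oV _ IT.
set t := Num.min 1 (T + e / (2 * (enorm v + 1))).
have w0 : 0 < e / (2 * (enorm v + 1)) by rewrite divr_gt0 // mulr_gt0 //; lra.
have Tt : T < t by rewrite lt_min Tl1 ltrDl.
suff St : S t by have := sup_upper_bound hS St; rewrite leNgt Tt.
split.
  by rewrite ge_min lexx andbT (le_trans T0) // ltW.
move=> s /andP[s0 st]; have [sT|Ts] := ltP s T; first by apply: ST; rewrite s0.
apply: He; rewrite /eball /= ytB ger0_norm ?subr_ge0 //.
have : s - T <= e / (2 * (enorm v + 1)).
  by have : t <= T + e / (2 * (enorm v + 1)) by [rewrite ge_min lexx orbT]; lra.
rewrite ler_pdivlMr ?mulr_gt0 //; last by lra.
have : 0 <= s - T by lra.
nra.
Qed.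

End UniformBalls.

(** * Chains near the boundary *)

Section LevelSums.
Variable R : realType.
Implicit Types (lam c e : R) (r : nat -> R) (lev : nat -> nat).

Lemma geometric_tail (q : R) (i j : nat) : 0 <= q < 1 -> (i <= j)%N ->
  \sum_(i <= n < j) q ^+ n <= q ^+ i / (1 - q).
Proof.
move=> /andP[q0 q1] ij; rewrite ler_pdivlMr ?subr_gt0 //.
have -> : (\sum_(i <= n < j) q ^+ n) * (1 - q) = q ^+ i - q ^+ j.
  elim: j ij => [|j IH]; first by rewrite leqn0 => /eqP ->; rewrite big_geq // mul0r subrr.
  rewrite leq_eqVlt => /predU1P[->|]; first by rewrite big_geq // mul0r subrr.
  by rewrite ltnS => ij; rewrite big_nat_recr //= mulrDl IH // exprS; ring.
by rewrite lerBlDr lerDl exprn_ge0.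
Qed.

Lemma bernoulli_bound (x : R) n : 0 <= x -> 1 + n%:R * x <= (1 + x) ^+ n.
Proof.
move=> x0; elim: n => [|n IH]; first by rewrite mul0r addr0 expr0.
have n0 : 0 <= n%:R :> R by exact: ler0n.
rewrite exprS -natr1; apply: le_trans (_ : (1 + x) * (1 + n%:R * x) <= _).
  by have := mulr_ge0 n0 (mulr_ge0 x0 x0); lra.
by rewrite ler_wpM2l // addr_ge0.
Qed.

(** A slightly larger ratio absorbs the linear factor: [nu / lam = 1 + x], and Bernoulli's
    inequality bounds [(n + 1) * min(1, x)] by [(1 + x)^n]. *)
Lemma linear_geometric lam : 0 < lam < 1 -> exists B nu : R,
  [/\ 0 < B, 0 < nu < 1 & forall n, lam ^+ n * n.+1%:R <= B * nu ^+ n].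
Proof.
move=> /andP[l0 l1]; set nu := (1 + lam) / 2; set x := nu / lam - 1.
have nu0 : 0 < nu by rewrite /nu; lra.
have x0 : 0 < x by rewrite subr_gt0 ltr_pdivlMr // mul1r /nu; lra.
set y := Num.min 1 x.
have y0 : 0 < y by rewrite lt_min ltr01.
exists y^-1, nu; split; first by rewrite invr_gt0.
  by rewrite nu0 /nu; lra.
move=> n; rewrite mulrC -ler_pdivlMr ?exprn_gt0 // -mulrA -expr_div_n.
have -> : nu / lam = 1 + x by rewrite /x; ring.
rewrite mulrC ler_pdivlMr //; apply: le_trans (bernoulli_bound n (ltW x0)).
have y1 : y <= 1 by rewrite ge_min lexx.
have yx : y <= x by rewrite ge_min lexx orbT.
have := ler_wpM2l (ler0n R n) yx; rewrite -natr1; lra.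
Qed.

(** All visits lie between the first one [a] and the last one [b]. By positivity the whole stretch
    from [a] to [b] dominates them; the extra 1 pays for the hop that starts at [b]. *)
Lemma sum_one_level r lev (m n : nat) c : 0 <= c ->
  (forall i, (i < m)%N -> 0 <= r i <= 1) ->
  (forall i j, (i <= j < m)%N -> lev i = n -> lev j = n -> \sum_(i <= k < j) r k <= c) ->
  \sum_(0 <= i < m | lev i == n) r i <= c + 1.
Proof.
move=> c0 r01 H.
have [[S0 _]|[a [b [ab bm la lb S]]]] :
    (\sum_(0 <= i < m | lev i == n) r i = 0 /\ forall i, (i < m)%N -> lev i != n) \/
    exists a b, [/\ (a <= b)%N, (b < m)%N, lev a = n, lev b = n &
      \sum_(0 <= i < m | lev i == n) r i <= \sum_(a <= k < b.+1) r k].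
- elim: m r01 {H} => [|m IH] r01; first by left; rewrite big_geq.
  have r01' i : (i < m)%N -> 0 <= r i <= 1 by move=> im; apply: r01; rewrite ltnW.
  rewrite big_mkcond big_nat_recr //= -big_mkcond.
  have [lm|lm] := eqVneq (lev m) n; last first.
    rewrite addr0; have [[-> h]|[a [b [ab bm la lb S]]]] := IH r01'; [left|right].
      by split => // i; rewrite ltnS leq_eqVlt => /predU1P[->|/h].
    by exists a, b; split => //; exact: ltnW.
  right; have [[-> h]|[a [b [ab bm la lb S]]]] := IH r01'.
    by exists m, m; rewrite add0r big_nat1; split.
  exists a, m; split => //; first by rewrite (leq_trans ab) // ltnW.
  rewrite big_nat_recr ?(leq_trans ab) 1?ltnW //= lerD2r; apply: le_trans S _.
  rewrite (@big_cat_nat _ _ _ b.+1 a m) //=; last by rewrite (leq_trans ab).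
  rewrite lerDl big_nat_cond sumr_ge0 // => i /andP[/andP[_ /r01' /andP[]]] //.
- by rewrite S0; lra.
- apply: le_trans S _; rewrite big_nat_recr //=; apply: lerD.
    by apply: H => //; rewrite ab.
  by have /andP[] := r01 b bm.
Qed.

(** Regrouping by level leaves the tail of a convergent series. The threshold [J0] is chosen before
    the chain, which may be arbitrarily long. *)
Lemma level_sum lam c e : 0 < lam < 1 -> 0 <= c -> 0 < e -> exists J0, forall m r lev,
  (forall i, (i < m)%N -> 0 <= r i <= 1) -> (forall i, (i < m)%N -> (J0 <= lev i)%N) ->
  (forall i j, (i <= j < m)%N -> lev i = lev j -> \sum_(i <= k < j) r k <= c * (lev i).+1%:R) ->
  \sum_(0 <= i < m) lam ^+ lev i * r i <= e.
Proof.
move=> lam01 c0 e0; have [B [nu [B0 nu01 HB]]] := linear_geometric lam01.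
have /andP[l0 l1] := lam01; have /andP[n0 n1] := nu01.
have c1 : 0 < c + 1 by lra.
have nu01' : 0 <= nu < 1 by rewrite ltW.
have e1 : 0 < e * (1 - nu) / ((c + 1) * B).
  by rewrite divr_gt0 ?mulr_gt0 // subr_gt0.
have [J0 HJ] := expr_small nu01' e1.
exists J0 => m r lev r01 levJ H.
have {}HJ : (c + 1) * B * (nu ^+ J0 / (1 - nu)) <= e.
  have := HJ J0 (leqnn _); rewrite ltr_pdivlMr ?mulr_gt0 // => h.
  by rewrite mulrA ler_pdivrMr ?subr_gt0 // mulrC ltW.
(* Any bound for the finitely many levels would do: it makes the outer sum finite and disappears in
   the tail estimate. *)
set N := (J0 + \sum_(0 <= i < m) (lev i).+1)%N.
have levN i : (i < m)%N -> (J0 <= lev i < N)%N.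
  move=> im; rewrite levJ //= /N (bigD1_seq i) ?iota_uniq ?mem_index_iota //=.
  by rewrite addnA addnC addnA; apply: leq_trans (leq_addl _ _) .
have -> : \sum_(0 <= i < m) lam ^+ lev i * r i =
    \sum_(J0 <= n < N) \sum_(0 <= i < m | lev i == n) lam ^+ n * r i.
  under [RHS]eq_bigr do rewrite big_mkcond.
  rewrite exchange_big /= big_nat_cond [RHS]big_nat_cond; apply: eq_bigr => i.
  rewrite andbT => /andP[_ /levN iN].
  rewrite (bigD1_seq (lev i)) ?iota_uniq ?mem_index_iota //= eqxx big1 ?addr0 // => n.
  by rewrite eq_sym => /negPf ->.
apply: le_trans HJ; apply: le_trans (_ : \sum_(J0 <= n < N) (c + 1) * B * nu ^+ n <= _).
  apply: ler_sum => n _; rewrite -mulr_sumr.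
  have n1' : 0 <= c * n.+1%:R by rewrite mulr_ge0.
  have S : \sum_(0 <= i < m | lev i == n) r i <= c * n.+1%:R + 1.
    by apply: sum_one_level => // i j ij lin ljn; rewrite -lin; apply: H; rewrite ?ljn.
  have S2 : \sum_(0 <= i < m | lev i == n) r i <= (c + 1) * n.+1%:R.
    apply: le_trans S _; rewrite mulrDl mul1r lerD2l -[X in X <= _]/(1%:R) ler_nat //.
  apply: le_trans (ler_wpM2l (exprn_ge0 n (ltW l0)) S2) _.
  by rewrite mulrCA -mulrA ler_pM2l // mulrC.
rewrite -mulr_sumr ler_pM2l ?mulr_gt0 //.
by apply: geometric_tail => //; rewrite leq_addr.
Qed.

End LevelSums.

(** * Localization of a single hop *)

Section HopLocalization.
Variables (R : realType) (d : nat).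
Implicit Types (D Om V : set (Cd R d)) (x y xi : Cd R d).

Lemma not_low_ball D x n : ~ low D x n -> eball x (2^-1 ^+ n) `<=` D.
Proof.
move=> nl y yx; apply: contrapT => Dy; apply: nl; exists y; split=> //.
by apply: ltW.
Qed.

(** The level is the largest index at which [low] holds; openness of [D] bounds these indices.
    Maximality gives the ball of half the radius. *)
Lemma exists_level D x n : eopen D -> D x -> low D x n ->
  exists m, [/\ (n <= m)%N, low D x m & eball x (2^-1 ^+ m.+1) `<=` D].
Proof.
move=> oD Dx ln; have [e e0 De] := oD _ Dx.
have h01 : 0 <= (2^-1 : R) < 1 by rewrite invr_ge0 ler0n invf_lt1 ?ltr1n // ltr0n.
have [N HN] := expr_small h01 e0.
have bd i : `[< low D x i >] -> (i <= N)%N.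
  move=> /asboolP [y [Dy yx]]; rewrite leqNgt; apply/negP => /ltnW Ni.
  by apply: Dy; apply: De; apply: le_lt_trans yx (HN i Ni).
have ex : exists i, `[< low D x i >] by exists n; apply/asboolP.
case: (ex_maxnP ex bd) => m /asboolP lm max; exists m; split=> //.
  by apply: max; apply/asboolP.
by apply: not_low_ball => lS; have := max m.+1 (asboolT lS); rewrite ltnn.
Qed.

(** Both conclusions come from one disc: rescaled to the radius on which it stays in the chart, it
    is a hop of [Om]&[V]; on radius [1/2] it obeys [disc_step], which bounds the displacement. *)
Lemma hop_localize (K : R) Om V D (Phi : Cd R d -> Cd R d) xi
    (tau M M' Cb C mu A : R) (J k : nat) x y t :
  2 <= K -> harnack K ->
  (forall x, Om x -> enorm x <= M) -> 0 < tau ->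
  holo_on V Phi -> D = Phi @` (V `&` Om) -> eopen D -> convex_set D ->
  (forall x x', D x -> D x' -> enorm (x - x') <= M') ->
  0 < Cb -> (forall p q, V p -> V q -> enorm (p - q) <= Cb * enorm (Phi p - Phi q)) ->
  eball xi tau `<=` V -> 0 <= C -> 0 < mu < 1 -> line_thin D C mu ->
  Cb * (2 * C / (1 - mu) * mu ^+ k) <= tau / 8 ->
  4 <= A -> 96 * M <= tau / 8 * A ->
  hop Om (1 / (2 * K)) x y t -> enorm (x - xi) < tau / 2 -> low D (Phi x) (J + k) ->
  A * (1 - K^-1) ^+ J <= 1 / 2 ->
  (exists t', hop (Om `&` V) 1 x y t' /\ t' <= t + 8 * A * (1 - K^-1) ^+ J * t) /\
  enorm (y - x) <= Cb * (8 * K * C * mu ^+ (J + k)) * t.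
Proof.
move=> K2 HK OmM tau0 hPhi DE oD cD DM Cb0 bil tauV C0 mu01 thin small A4 AM.
move=> [f [b [fh fOm /andP[/andP[b0 be] b1] [<- <-] ->]]] xxi lowx AJ.
have loc := disc_localization K2 HK OmM tau0 hPhi DE oD cD DM Cb0 bil tauV C0 mu01 thin
  small A4 AM fh fOm xxi lowx.
set r := 1 - A * (1 - K^-1) ^+ J in loc *.
have K0 : 0 < K by lra.
have KV : K^-1 <= 1 / 2 by rewrite div1r lef_pV2 ?posrE.
have th0 : 0 <= 1 - K^-1 by lra.
have r2 : 1 / 2 <= r <= 1.
  have : 0 <= A * (1 - K^-1) ^+ J by rewrite mulr_ge0 ?exprn_ge0 //; lra.
  rewrite /r; lra.
have fV w : cabs w < r -> V (f w).
  move=> /loc wr; apply: tauV; rewrite /eball /=.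
  by apply: le_lt_trans (enormB_le _ (f 0) _) _; lra.
(* This is the range of Harnack's inequality on the disc of radius [1/2], and the reason for the hop
   size [1 / (2 K)]. *)
have bK : b <= 1 / 2 * K^-1 by move: be; rewrite div1r invfM mulrC; lra.
have b4 : b <= 1 / 4 by lra.
have b01 : 0 <= b < 1 by rewrite b0.
have h20 : (0 : R) < 1 / 2 by rewrite divr_gt0.
have half w : cabs w < 1 / 2 -> cabs w < r by move=> w2; apply: lt_le_trans w2 _; case/andP: r2.
have half1 w : cabs w < 1 / 2 -> cabs w < 1.
  by move=> w2; apply: lt_trans w2 _; rewrite div1r invf_lt1 // ltr1n.
have h0 : V (f 0) by apply: fV; apply: half; rewrite cabs0.
have hb : V (f (rC b)).
  apply: fV; apply: half; rewrite cabs_rC ger0_norm //.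
  by apply: le_lt_trans b4 _; rewrite !div1r ltf_pV2 ?posrE // ltr_nat.
split.
  exists (rho (b / r)); split; last first.
    apply: le_trans (@rho_div R b r _ _) _; [by rewrite b0|by []|].
    have -> : 1 - r = A * (1 - K^-1) ^+ J by rewrite /r; ring.
    by rewrite [8 * (A * _)]mulrA lexx.
  have r0 : 0 < r by lra.
  have rw (w : R[i]) : cabs w < 1 -> cabs (rC r * w) < r.
    by move=> w1; rewrite cabsM cabs_rC gtr0_norm // gtr_pMr.
  exists (fun w => f (rC r * w)), (b / r); split.
  - apply: disc_holo_comp => // w /rw wr; split; last exact: cdiff_scale.
    by apply: lt_le_trans wr _; lra.
  - move=> w /rw wr; split; last exact: fV.
    by apply: fOm; apply: lt_le_trans wr _; lra.
  - have br : b / r <= 1 / 2 by rewrite ler_pdivrMr //; lra.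
    by rewrite divr_ge0 ?(ltW r0) //=; apply/andP; split; lra.
  - by rewrite mulr0 -rCM mulrCA divff ?mulr1 // gt_eqF.
  - by [].
have [E|nE] := eqVneq (Phi (f (rC b)) - Phi (f 0)) 0.
  apply: le_trans (bil _ _ hb h0) _; rewrite E enorm0 mulr0.
  have m0 : 0 <= mu ^+ (J + k) by rewrite exprn_ge0 //; case/andP: mu01 => /ltW.
  have KC : 0 <= 8 * K * C by rewrite !mulr_ge0 // ltW.
  exact: mulr_ge0 (mulr_ge0 (ltW Cb0) (mulr_ge0 KC m0)) (rho_ge0 b01).
have Dh (h : R[i]) : cabs h < 1 / 2 -> D (Phi (f (0 + h))).
  move=> h2; rewrite add0r DE; exists (f h) => //; split; first by apply: fV; exact: half.
  by apply: fOm; exact: half1.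
have vh (h : R[i]) : cabs h < 1 / 2 -> vdiff (fun w => Phi (f w)) (0 + h).
  move=> h2; rewrite add0r; apply: (@vdiff_holo _ _ V Phi f h hPhi); first by apply: fV; exact: half.
  by apply: fh; exact: half1.
have D0 : D (Phi (f 0)) by rewrite -{1}(addr0 0); apply: Dh; rewrite cabs0.
have [c [Dc cE]] := thin _ _ _ D0 nE lowx.
have m0 : 0 <= mu ^+ (J + k) by rewrite exprn_ge0 //; case/andP: mu01 => /ltW.
have := @disc_step R d K K2 HK D M' (fun w => Phi (f w)) 0 (1 / 2) (C * mu ^+ (J + k)) (rC b) c
  cD oD DM h20 vh Dh.
rewrite add0r cabs_rC ger0_norm // => /(_ bK (mulr_ge0 C0 m0) Dc cE) S.
apply: le_trans (bil _ _ hb h0) _; rewrite -mulrA ler_pM2l //.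
apply: le_trans S _.
have := le_rho b01.
have -> : 2 * K * (C * mu ^+ (J + k)) * (b / (1 / 2)) = (4 * K * C * mu ^+ (J + k)) * b by field.
have -> : 8 * K * C * mu ^+ (J + k) * rho b = (4 * K * C * mu ^+ (J + k)) * (2 * rho b) by ring.
have KC : 0 <= 4 * K * C by rewrite !mulr_ge0 // ltW.
by move=> h; rewrite ler_wpM2l // mulr_ge0.
Qed.

End HopLocalization.

(** * Localization of an initial part of a chain *)

Section Prefix.
Variables (R : realType) (d : nat).
Implicit Types (D Om V : set (Cd R d)) (x y p q xi : Cd R d).

(* The two times a nearly minimal chain visits a given level are joined inside
   the chart at cost linear in the level, so level_sum bounds both the total
   extra cost and the Euclidean displacement. *)
Lemma localize_prefix Om V D (Phi : Cd R d -> Cd R d) xi (tau lam E e c eta : R)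
    (k J0 : nat) p q (t0 : R) :
  D = Phi @` (V `&` Om) -> eopen D -> 0 < tau -> eball xi tau `<=` V ->
  0 < lam < 1 -> 0 <= E -> e <= 1 -> 0 <= c ->
  (forall x y t, hop Om e x y t -> t <= 1) ->
  (forall x y t J, hop Om e x y t -> enorm (x - xi) < tau / 2 -> low D (Phi x) (J + k) ->
     (J0 <= J)%N -> (exists t', hop (Om `&` V) 1 x y t' /\ t' <= t + E * lam ^+ J * t) /\
     enorm (y - x) <= E * lam ^+ J * t) ->
  (forall x y J, V x -> V y -> eball (Phi x) (2^-1 ^+ (J + k).+1) `<=` D ->
     eball (Phi y) (2^-1 ^+ (J + k).+1) `<=` D ->
     exists s, chain (hop (Om `&` V) 1) x y s /\ s <= c * J.+1%:R) ->
  (forall m (r : nat -> R) lev, (forall i, (i < m)%N -> 0 <= r i <= 1) ->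
     (forall i, (i < m)%N -> (J0 <= lev i)%N) ->
     (forall i j, (i <= j < m)%N -> lev i = lev j ->
        \sum_(i <= n < j) r n <= (c + 1) * (lev i).+1%:R) ->
     \sum_(0 <= i < m) lam ^+ lev i * r i <= eta) ->
  E * eta <= tau / 4 ->
  enorm (p - xi) < tau / 4 ->
  chain (hop Om e) p q t0 -> (forall s, chain (hop Om 1) p q s -> t0 <= s + 1) ->
  exists a s S, [/\ chain (hop (Om `&` V) 1) p a s, s <= S + E * eta,
    chain (hop Om 1) a q (t0 - S) &
    (a = q /\ S = t0) \/ (enorm (a - xi) < tau / 2 /\ ~ low D (Phi a) (J0 + k))].
Proof.
move=> DE oD tau0 tauV /andP[l0 l1] E0 e1 c0 small step upper levsum Eeta pxi ch nearmin.
have [N [z [r [z0 zN hz t0E]]]] := chain_seq ch.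
have t0S : t0 = \sum_(0 <= i < N) r i by rewrite t0E big_mkord.
have hop1 i : (i < N)%N -> hop Om 1 (z i) (z i.+1) (r i).
  by move=> /hz; exact: hop_widen.
have r01 i : (i < N)%N -> 0 <= r i <= 1.
  by move=> /hz h; rewrite (hop_ge0 h) (small _ _ _ h).
(* Near-minimality passes to subchains: the piece from [z i] to [z j] is exchanged for a competitor
   and the rest of the chain is kept. *)
have sub i j s : (i <= j <= N)%N -> chain (hop Om 1) (z i) (z j) s ->
    \sum_(i <= n < j) r n <= s + 1.
  move=> /andP[ij jN] c1.
  have ca : chain (hop Om 1) p (z i) (\sum_(0 <= n < i) r n).
    by rewrite -z0; apply: seq_chain => // n /andP[_ ni]; apply: hop1; exact: leq_trans ni (leq_trans ij jN).
  have cb : chain (hop Om 1) (z j) q (\sum_(j <= n < N) r n).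
    by rewrite -zN; apply: seq_chain => // n /andP[_ ni]; exact: hop1.
  have := nearmin _ (chain_cat ca (chain_cat c1 cb)).
  rewrite t0S (@big_cat_nat _ _ _ i 0 N) ?(leq_trans ij) //=.
  rewrite (@big_cat_nat _ _ _ j i N) //=; lra.
pose good i := enorm (z i - xi) < tau / 2 /\ low D (Phi (z i)) (J0 + k).
have [m [mN gm mE]] : exists m, [/\ (m <= N)%N, forall i, (i < m)%N -> good i & m = N \/ ~ good m].
  have ex : exists i, (i == N) || `[< ~ good i >] by exists N; rewrite eqxx.
  case: (ex_minnP ex) => m mP mmin; exists m; split.
  - by apply: mmin; rewrite eqxx.
  - move=> i im; apply: contrapT => ng; have := mmin i; rewrite (asboolT ng) orbT => /(_ isT).
    by rewrite leqNgt im.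
  - by case/orP: mP => [/eqP ->|/asboolP]; [left|right].
have Vz i : good i -> V (z i).
  by move=> [h _]; apply: tauV; rewrite /eball /=; lra.
have levP i : {n | (i < m)%N -> [/\ (J0 <= n)%N, low D (Phi (z i)) (n + k) &
    eball (Phi (z i)) (2^-1 ^+ (n + k).+1) `<=` D]}.
  apply: cid; have [im|im] := boolP (i < m)%N; last by exists 0%N.
  have gi := gm i im; have iN := leq_trans im mN.
  have Dz : D (Phi (z i)).
    rewrite DE; exists (z i) => //; split; first exact: Vz.
    have [f [b [_ fOm _ [<- _] _]]] := hop1 i iN.
    by apply: fOm; rewrite cabs0.
  have [n [nJ ln bn]] := exists_level oD Dz (proj2 gi).
  have kn : (k <= n)%N := leq_trans (leq_addl J0 k) nJ.
  by exists (n - k)%N => _; rewrite subnK //; split => //; rewrite leq_subRL // addnC.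
pose lev i := sval (levP i).
have bound : \sum_(0 <= i < m) lam ^+ lev i * r i <= eta.
  apply: levsum.
  - by move=> i im; apply: r01; exact: leq_trans im mN.
  - by move=> i im; have [] := svalP (levP i) im.
  - move=> i j /andP[ij jm] lij; have im : (i < m)%N := leq_ltn_trans ij jm.
    have [_ _ b1] := svalP (levP i) im; have [_ _ b2] := svalP (levP j) jm.
    rewrite -/(lev i) in b1; rewrite -/(lev j) -lij in b2.
    have [s [cs sc]] := upper _ _ _ (Vz i (gm i im)) (Vz j (gm j jm)) b1 b2.
    have cs1 : chain (hop Om 1) (z i) (z j) s.
      by apply: chain_hop_widen cs => // u [].
    have ijN : (i <= j <= N)%N by rewrite ij ltnW // (leq_trans jm).
    have := sub i j s ijN cs1.
    (* The slack 1 of near-minimality is absorbed into the linear bound, which is why the constant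
       is [c + 1]. *)
    have : 1%:R <= (lev i).+1%:R :> R by rewrite ler_nat.
    rewrite mulrDl mul1r; lra.
have st i : {t' | (i < m)%N -> hop (Om `&` V) 1 (z i) (z i.+1) t' /\
     t' <= r i + E * lam ^+ lev i * r i}.
  apply: cid; have [im|im] := boolP (i < m)%N; last by exists 0.
  have [lJ ll _] := svalP (levP i) im.
  have [[t' H] _] := step _ _ _ _ (hz i (leq_trans im mN)) (proj1 (gm i im)) ll lJ.
  by exists t'.
have move_le j : (j <= m)%N -> enorm (z j - p) <= E * \sum_(0 <= i < j) lam ^+ lev i * r i.
  elim: j => [|j IH] jm; first by rewrite big_geq // mulr0 z0 subrr enorm0.
  apply: le_trans (enormB_le _ (z j) _) _.
  rewrite big_nat_recr //= mulrDr addrC; apply: lerD; first by apply: IH; exact: ltnW.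
  have [lJ ll _] := svalP (levP j) jm.
  have [_] := step _ _ _ _ (hz j (leq_trans jm mN)) (proj1 (gm j jm)) ll lJ.
  by rewrite -mulrA.
(* The hop that leaves the last good point is included in [move_le], so even the first bad point is
   within [tau / 4 + tau / 4] of [xi]; it can only be bad by its depth. *)
have zm : enorm (z m - xi) < tau / 2.
  have := move_le m (leqnn _); have := ler_wpM2l E0 bound.
  by have := enormB_le (z m) p xi; lra.
exists (z m), (\sum_(0 <= i < m) sval (st i)), (\sum_(0 <= i < m) r i); split.
- rewrite -z0; apply: seq_chain => // i /andP[_ im].
  by have [] := svalP (st i) im.
- apply: le_trans (_ : \sum_(0 <= i < m) (r i + E * (lam ^+ lev i * r i)) <= _).
    rewrite big_nat_cond [leRHS]big_nat_cond; apply: ler_sum => i.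
    rewrite andbT => /andP[_ im]; rewrite mulrA.
    by have [] := svalP (st i) im.
  by rewrite big_split /= lerD2l -mulr_sumr ler_wpM2l.
- rewrite t0S (@big_cat_nat _ _ _ m 0 N) //= addrAC subrr add0r -zN.
  by apply: seq_chain => // i /andP[_ iN]; exact: hop1.
- case: mE => [->|ng]; first by left.
  by right; split => // lm; apply: ng.
Qed.

End Prefix.

(** * From the good atlas to uniform constants *)

Section Charts.
Variables (R : realType) (d : nat).
Implicit Types (D Om V : set (Cd R d)) (x y p q xi : Cd R d).

(** For [L = 0] the only derivative that may be nonzero is the defining function itself, which
    vanishes on the hypersurface. The attained equality supplies the point and the nonzero
    direction. *)
Lemma line_type_gt0 Om L : finite_local_line_type Om L -> (0 < L)%N.
Proof.
case=> _ [Vf [Phif [_ [W [HW [xi [bxi [x [Wx Sx [U [r [_ [v v0 _]]]]]]]]]]]]].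
rewrite lt0n; apply/eqP => L0; subst L.
have [_ _ /(_ x Wx Sx) [U' [r' [[_ Ux _ r0 _] H]]]] := HW xi bxi.
have [c [_ [j]]] := H v v0; rewrite leqn0 => /eqP ->; rewrite /iterD /=.
by rewrite (iffLR (r0 x Ux) Sx) eqxx.
Qed.

(** The factor 2 pays for replacing an infimum, which may not be attained, by an actual exit
    point. *)
Lemma line_thin_root D (C : R) L : 0 < C -> (0 < L)%N ->
  (forall p v, D p -> v != 0 ->
     (edist_line D p v <= C%:E * poweR (edist_c D p) (L%:R^-1))%E) ->
  line_thin D (2 * C) (powR 2^-1 L%:R^-1).
Proof.
move=> C0 L0 H x v n Dx v0 [y [Dy yx]].
set mu := powR _ _.
have h0 : 0 <= 2^-1 :> R by rewrite invr_ge0.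
have h0' : 0 < 2^-1 :> R by rewrite invr_gt0.
have m0 : 0 < mu by rewrite powR_gt0.
have muE : mu ^+ n = powR (2^-1 ^+ n) L%:R^-1.
  by rewrite -powR_mulrn ?(ltW m0) // -!powRrM mulrC powRrM powR_mulrn.
have dle : (edist_c D x <= (2^-1 ^+ n)%:E)%E.
  by apply: le_trans (_ : ((enorm (y - x))%:E <= _)%E); [apply: ereal_inf_lbound; exists y|rewrite lee_fin].
have dge : (0 <= edist_c D x)%E.
  by apply: le_ereal_inf_tmp => _ [z _ <-]; rewrite lee_fin enorm_ge0.
have lt : (edist_line D x v < (2 * C * mu ^+ n)%:E)%E.
  apply: le_lt_trans (H x v Dx v0) _.
  move: dle dge; case: (edist_c D x) => // t; rewrite !lee_fin => tle tge.
  rewrite poweR_EFin -EFinM lte_fin; apply: le_lt_trans (_ : C * mu ^+ n < _).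
    by rewrite ler_pM2l // muE ge0_ler_powR ?nnegrE ?exprn_ge0 // invr_ge0.
  by rewrite ltr_pM2r ?exprn_gt0 //; lra.
have [_ [q [[c ->] Dq] <-]] := ereal_inf_lt lt; rewrite lte_fin => qx.
exists c; split => //; apply/ltW; move: qx.
by rewrite addrAC subrr add0r.
Qed.

Lemma powR_half_root (L : nat) : (0 < L)%N -> 0 < powR (2^-1 : R) L%:R^-1 < 1.
Proof.
move=> L0; set mu := powR _ _.
have h0' : 0 < 2^-1 :> R by rewrite invr_gt0.
have m0 : 0 < mu by rewrite powR_gt0.
rewrite m0 /= ltNge; apply/negP => m1.
have : mu ^+ L = 2^-1.
  rewrite -powR_mulrn ?(ltW m0) // -powRrM mulVf ?powRr1 ?(ltW h0') //.
  by rewrite pnatr_eq0 -lt0n.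
have : 1 <= mu ^+ L by rewrite exprn_ege1.
move=> + E; rewrite E; lra.
Qed.

Lemma chart_image_open Om V (Phi : Cd R d -> Cd R d) (C : R) : eopen Om -> eopen V ->
  eopen (Phi @` V) -> 0 < C ->
  (forall p q, V p -> V q -> enorm (p - q) <= C * enorm (Phi p - Phi q)) ->
  eopen (Phi @` (V `&` Om)).
Proof.
move=> oO oV oPV C0 lo _ [x [Vx Ox] <-].
have [e1 e10 H1] := oO x Ox; have [e2 e20 H2] := oPV _ (imageP Phi Vx).
exists (Num.min e2 (e1 / C)); first by rewrite lt_min e20 divr_gt0.
move=> y; rewrite /eball /= lt_min => /andP[/H2 [z Vz <-] h].
exists z => //; split=> //; apply: H1; rewrite /eball /=.
apply: le_lt_trans (lo _ _ Vz Vx) _.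
by move: h; rewrite ltr_pdivlMr // mulrC.
Qed.

(** The prefixes followed from the two ends may overlap. Going from [p] backwards along the second
    remainder to [b], across to [a] and along the first remainder to [q] is a competing chain, so
    near-minimality gives [S1 + S2 <= t0 + c + 1]. With one more [c] for the connection, [2 h] for
    the localized prefixes and [t0 < kob + 1], this is the stated constant. *)
Lemma kob_le_of_prefix Om U (P : Cd R d -> Prop) (e h c : R) p q :
  U `<=` Om -> 0 < e -> 0 <= h -> 0 <= c ->
  (forall x y t0, (x = p /\ y = q) \/ (x = q /\ y = p) -> chain (hop Om e) x y t0 ->
     (forall s, chain (hop Om 1) x y s -> t0 <= s + 1) ->
     exists a s S, [/\ chain (hop U 1) x a s, s <= S + h,
       chain (hop Om 1) a y (t0 - S) & (a = y /\ S = t0) \/ P a]) ->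
  (forall a b, P a -> P b -> exists s, chain (hop U 1) a b s /\ s <= c) ->
  (kob U p q <= kob Om p q + (2 * c + 2 * h + 2)%:E)%E.
Proof.
move=> UO e0 h0 c0 prefix join.
have [kfin|] := boolP (kob Om p q == +oo%E); first by rewrite (eqP kfin) addye // leey.
case kE : (kob Om p q) (kob_ge0 Om p q) => [rk| |] // _ _.
have lt1 : (kob Om p q < (rk + 1)%:E)%E by rewrite kE lte_fin ltrDl.
have [t0 [ch1 t0r]] := kob_chain lt1; rewrite lte_fin in t0r.
have ch := chain_hop_fine e0 ch1.
have nearmin s : chain (hop Om 1) p q s -> t0 <= s + 1.
  by move=> /chain_kob; rewrite kE lee_fin; lra.
have nearmin' s : chain (hop Om 1) q p s -> t0 <= s + 1.
  by move=> /chain_hop_sym; exact: nearmin.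
rewrite -EFinD.
suff [s [cs sle]] : exists s, chain (hop U 1) p q s /\ s <= rk + (2 * c + 2 * h + 2).
  by apply: le_trans (chain_kob cs) _; rewrite lee_fin.
have [a [s1 [S1 [c1 s1S ra Pa]]]] := prefix p q t0 (or_introl (conj erefl erefl)) ch nearmin.
have [b [s2 [S2 [c2 s2S rb Pb]]]] :=
  prefix q p t0 (or_intror (conj erefl erefl)) (chain_hop_sym ch) nearmin'.
case: Pa => [[aq S1t]|Pa].
  by exists s1; rewrite -aq; split => //; lra.
case: Pb => [[bp S2t]|Pb].
  by exists s2; rewrite -bp; split; [exact: chain_hop_sym|lra].
have [s3 [c3 s3le]] := join a b Pa Pb.
exists (s1 + (s3 + s2)); split.
  by apply: chain_cat c1 (chain_cat c3 _); exact: chain_hop_sym.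
have c3' : chain (hop Om 1) b a s3.
  by apply: chain_hop_sym; apply: chain_hop_widen c3.
have := nearmin _ (chain_cat (chain_hop_sym rb) (chain_cat c3' ra)); lra.
Qed.

End Charts.

Theorem theorem16p3 (R : realType) (d : nat) (Om : set (Cd R d)) (L : nat)
  (Vf : Cd R d -> set (Cd R d)) (Phif : Cd R d -> Cd R d -> Cd R d) :
  eopen Om -> ebounded Om ->
  locally_convexifiable Om -> finite_local_line_type Om L ->
  lc_atlas Om Vf Phif -> good_atlas Om Vf Phif L ->
  exists K del : R, [/\ 0 < K, 0 < del &
    forall xi, ebdry Om xi -> forall p q : Cd R d,
      Om p -> Om q -> enorm (p - xi) < del -> enorm (q - xi) < del ->
      (kob Om p q <= kob (Om `&` Vf xi) p q /\
       kob (Om `&` Vf xi) p q <= kob Om p q + K%:E)%E].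
Proof.
move=> oO bO _ fll atlas [C [tau [C0 tau0 good]]].
have L0 := line_type_gt0 fll.
have [M0 OM0] := bO; set M := `|M0| + 1.
have OM x : Om x -> enorm x <= M.
  by move=> /OM0; have := ler_norm M0; rewrite /M; lra.
have Mp : 0 < M by rewrite ltr_pwDr.
set M' := C * (2 * M).
have M'p : 0 < M' by rewrite /M' !mulr_gt0.
have mu01 := @powR_half_root R L L0; set mu := powR _ _ in mu01.
have /andP[mu0 mu1] := mu01.
have mu01' : 0 <= mu < 1 by rewrite ltW.
have [K K2 HK] := exists_harnack R.
have K0 : 0 < K by apply: lt_le_trans K2.
have KV0 : 0 < K^-1 by rewrite invr_gt0.
have KV : K^-1 <= 1 / 2 by rewrite div1r lef_pV2 ?posrE.
set th := 1 - K^-1.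
have th0 : 0 < th by rewrite /th; lra.
have th1 : th < 1 by rewrite /th; lra.
have th01 : 0 <= th < 1 by rewrite ltW.
have tau8 : 0 < tau / 8 by rewrite divr_gt0.
(* The [k] levels of reserve keep the accumulated displacement inside a disc below [tau / 8]; they
   are lost in every later depth index. *)
have [k Hk] : exists k, C * (2 * (2 * C) / (1 - mu) * mu ^+ k) <= tau / 8.
  have P : 0 < C * (2 * (2 * C) / (1 - mu)) by rewrite mulr_gt0 // divr_gt0 ?mulr_gt0 // subr_gt0.
  have [k Hk] := expr_small mu01' (divr_gt0 tau8 P).
  exists k; have := Hk k (leqnn _); rewrite ltr_pdivlMr // => /ltW.
  by congr (_ <= _); ring.
pose A := 4 + 96 * M / (tau / 8).
have A4 : 4 <= A by rewrite lerDl divr_ge0 ?mulr_ge0 // ltW.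
have AM : 96 * M <= tau / 8 * A.
  have -> : tau / 8 * A = tau / 2 + 96 * M by rewrite /A; field; rewrite gt_eqF.
  lra.
have A0 : 0 < A by lra.
(* A single rate for both errors: [th] governs the extra cost of a hop and [mu] its displacement.
   Likewise [E] adds up the two constants. *)
set lam := Num.max mu th.
have mulam : mu <= lam by rewrite le_max lexx.
have thlam : th <= lam by rewrite le_max lexx orbT.
have lam01 : 0 < lam < 1 by rewrite gt_max mu1 th1 andbT (lt_le_trans mu0).
have lam0 : 0 <= lam by rewrite ltW //; case/andP: lam01.
set E2 := C * (8 * K * (2 * C)).
have E20 : 0 < E2 by rewrite /E2 !mulr_gt0.
pose E := 8 * A + E2.
have E0 : 0 < E by rewrite addr_gt0 // mulr_gt0.
have tau4 : 0 < tau / 4 by rewrite divr_gt0.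
(* Every boundary point has a point of [Om] within [tau / 4], hence a ball of this common radius
   inside [Om] and close by; its image will be the hub [o] of the chains in the chart. *)
have [r r0 Hr] := uniform_interior_ball oO bO tau4.
set r' := Num.min r (tau / 4).
have r'0 : 0 < r' by rewrite lt_min r0.
set r1 := r' / (2 * C).
have r10 : 0 < r1 by rewrite divr_gt0 // mulr_gt0.
have r1M : r1 <= M' + r1 by rewrite lerDr ltW.
have [c1 c10 Hc1] := convex_chain_bound d r10 r1M.
(* The factor [k + 2] absorbs the shift of levels: [J + k + 2 <= (k + 2) (J + 1)]. *)
set c := c1 * k.+2%:R.
have c0 : 0 <= c by rewrite mulr_ge0 // ltW.
have cc0 : 0 <= c + 1 by rewrite addr_ge0.
(* The budget [E * eta = tau / 4] bounds both the displacement along a prefix and its extra cost,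
   hence the summand [tau / 2] in the final constant. *)
set eta := tau / 4 / E.
have eta0 : 0 < eta by rewrite divr_gt0.
have Eeta : E * eta = tau / 4 by rewrite /eta mulrCA divff ?mulr1 // gt_eqF.
have A2 : 0 < 1 / (2 * A) by rewrite divr_gt0 // mulr_gt0.
(* From [J1] on, the radius left to a disc is at least [1/2]; from [J2] on, the level sums are below
   [eta]. *)
have [J1 HJ1] := expr_small th01 A2.
have [J2 HJ2] := level_sum lam01 cc0 eta0.
pose J0 := maxn J1 J2.
pose e : R := 1 / (2 * K).
have eE : e = K^-1 / 2 by rewrite /e; field; rewrite gt_eqF.
have e0 : 0 < e by rewrite eE divr_gt0.
have e1 : e <= 1 by rewrite eE; clear -KV KV0; lra.
(* The cost of joining two points of depth at least [2^-(J0 + k)], where both prefixes may stop. *)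
set cd := c1 * (J0 + k).+1%:R.
have cd0 : 0 <= cd by rewrite mulr_ge0 // ltW.
exists (2 * cd + tau / 2 + 2), (tau / 4); split => //.
  by clear -cd0 tau0; lra.
move=> xi bxi p q Op Oq pxi qxi; split; first by apply: kob_subset => x [].
have [oV Vxi [_ hPhi _ oPV [Psi [hPsi PsiK]]] cD] := atlas xi bxi.
have [tauV thin0 bilip] := good xi bxi.
set V := Vf xi in oV Vxi hPhi oPV hPsi PsiK cD tauV thin0 bilip *.
set Phi := Phif xi in hPhi oPV hPsi PsiK cD thin0 bilip.
have up x y : V x -> V y -> enorm (Phi x - Phi y) <= C * enorm (x - y).
  by move=> Vx Vy; have [] := bilip x y Vx Vy.
have lo x y : V x -> V y -> enorm (x - y) <= C * enorm (Phi x - Phi y).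
  by move=> Vx Vy; have [+ _] := bilip x y Vx Vy; rewrite ler_pdivrMl.
have oD := chart_image_open oO oV oPV C0 lo.
set D := Phi @` (V `&` Om) in oD cD thin0.
have thin : line_thin D (2 * C) mu by exact: line_thin_root.
have DM x y : D x -> D y -> enorm (x - y) <= M'.
  move=> [u [Vu Ou] <-] [v [Vv Ov] <-]; apply: le_trans (up _ _ Vu Vv) _.
  rewrite ler_pM2l //; apply: le_trans (enormD _ _) _; rewrite enormN.
  by rewrite mulr_natl mulr2n lerD // OM.
have [o oball] : exists o, eball o r1 `<=` D.
  have [x [Ox xxi]] := (proj1 bxi) _ tau4.
  have [o [ox oO']] := Hr x Ox.
  have r'r : r' <= r by rewrite ge_min lexx.
  have r'4 : r' <= tau / 4 by rewrite ge_min lexx orbT.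
  have oV' : eball o r' `<=` V.
    move=> y yo; apply: tauV; rewrite /eball /= in yo *.
    have := enormB_le y o xi; have := enormB_le o x xi.
    by clear -yo ox xxi r'4 tau0; lra.
  exists (Phi o) => y /(bilipschitz_ball_image C0 r'0 oPV PsiK lo up oV') [z zo <-].
  exists z => //; split; first exact: oV'.
  by apply: oO'; apply: lt_le_trans zo r'r.
have half_V x : enorm (x - xi) < tau / 2 -> V x.
  by move=> xxi; apply: tauV; apply: lt_trans xxi _; rewrite ltr_pdivrMr // ltr_pMr // ltr1n.
have DM1 x y : D x -> D y -> enorm (x - y) <= M' + r1.
  by move=> Dx Dy; apply: le_trans (DM x y Dx Dy) _; rewrite lerDl ltW.
have join x y m : V x -> V y -> eball (Phi x) (2^-1 ^+ m) `<=` D ->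
    eball (Phi y) (2^-1 ^+ m) `<=` D ->
    exists s, chain (hop (Om `&` V) 1) x y s /\ s <= c1 * m.+1%:R.
  move=> Vx Vy bx by'; have := Hc1 Om V Phi Psi o hPsi PsiK cD DM1 oball _ _ m bx by'.
  by rewrite !PsiK.
have small x y t : hop Om e x y t -> t <= 1.
  move=> [f [b [_ _ /andP[/andP[b0 be] _] _ ->]]].
  have b2 : b <= 1 / 2 by rewrite eE in be; clear -be KV KV0; lra.
  have := rhoB_le (lexx 0) b0 b2; rewrite rho0E !subr0; clear -b2; lra.
have powle (u : R) n : 0 <= u -> u <= lam -> u ^+ n <= lam ^+ n.
  by move=> u0 ul; rewrite lerXn2r ?nnegrE.
have step x y t J : hop Om e x y t -> enorm (x - xi) < tau / 2 -> low D (Phi x) (J + k) ->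
    (J0 <= J)%N -> (exists t', hop (Om `&` V) 1 x y t' /\ t' <= t + E * lam ^+ J * t) /\
    enorm (y - x) <= E * lam ^+ J * t.
  move=> h xxi lx JJ.
  have AJ : A * th ^+ J <= 1 / 2.
    have := HJ1 J (leq_trans (leq_maxl _ _) JJ); rewrite ltr_pdivlMr ?mulr_gt0 //; clear; lra.
  have C20 : 0 <= 2 * C by rewrite mulr_ge0 // ltW.
  have [[t' [h' ht']] mv] := hop_localize K2 HK OM tau0 hPhi (erefl D) oD cD DM C0 lo tauV C20
    mu01 thin Hk A4 AM h xxi lx AJ.
  have t0 := hop_ge0 h.
  have lJ : 0 <= lam ^+ J by rewrite exprn_ge0.
  have k1 : th ^+ J <= lam ^+ J by apply: powle => //; exact: ltW.
  have k2 : mu ^+ (J + k) <= lam ^+ J.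
    apply: le_trans (powle mu J (ltW mu0) mulam).
    by rewrite exprD ler_piMr ?exprn_ge0 ?(ltW mu0) // exprn_ile1 // ltW.
  split.
    exists t'; split => //; apply: le_trans ht' _; rewrite lerD2l ler_wpM2r //.
    apply: le_trans (_ : 8 * A * lam ^+ J <= _); first by rewrite ler_wpM2l // mulr_ge0 // ltW.
    by rewrite ler_wpM2r // /E ?lerDl ?lerDr ?(ltW E20) // mulr_ge0 // ltW.
  apply: le_trans mv _; rewrite ler_wpM2r //.
  have -> : C * (8 * K * (2 * C) * mu ^+ (J + k)) = E2 * mu ^+ (J + k) by rewrite /E2; ring.
  apply: le_trans (_ : E2 * lam ^+ J <= _); first by rewrite ler_wpM2l // ltW.
  by rewrite ler_wpM2r // /E lerDr mulr_ge0 // ltW.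
have upper x y J : V x -> V y -> eball (Phi x) (2^-1 ^+ (J + k).+1) `<=` D ->
    eball (Phi y) (2^-1 ^+ (J + k).+1) `<=` D ->
    exists s, chain (hop (Om `&` V) 1) x y s /\ s <= c * J.+1%:R.
  move=> Vx Vy bx by'; have [s [cs sc]] := join x y _ Vx Vy bx by'.
  exists s; split => //; apply: le_trans sc _; rewrite /c -mulrA ler_pM2l // -natrM ler_nat.
  by rewrite mulnS (addnC J) -!addSn leq_add2l leq_pmull.
have levsum m (rr : nat -> R) lev : (forall i, (i < m)%N -> 0 <= rr i <= 1) ->
     (forall i, (i < m)%N -> (J0 <= lev i)%N) ->
     (forall i j, (i <= j < m)%N -> lev i = lev j ->
        \sum_(i <= n < j) rr n <= (c + 1) * (lev i).+1%:R) ->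
     \sum_(0 <= i < m) lam ^+ lev i * rr i <= eta.
  move=> h1 h2 h3; apply: HJ2 => // i /h2; exact: leq_trans (leq_maxr _ _).
have Eeta' : E * eta <= tau / 4 by rewrite Eeta.
have prefix x y t := localize_prefix (p := x) (q := y) (t0 := t) (erefl D) oD tau0 tauV lam01
  (ltW E0) e1 c0 small step upper levsum Eeta'.
have Ee0 : 0 <= E * eta by apply: mulr_ge0; exact: ltW.
have Kc : 2 * cd + tau / 2 + 2 = 2 * cd + 2 * (E * eta) + 2 by rewrite Eeta; field.
rewrite Kc; apply: (@kob_le_of_prefix _ _ Om (Om `&` V)
  (fun a => enorm (a - xi) < tau / 2 /\ ~ low D (Phi a) (J0 + k)) e) => //.
- by move=> x y t0 [[-> ->]|[-> ->]]; exact: prefix.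
- move=> a b [axi la] [bxi' lb].
  by apply: join; [exact: half_V|exact: half_V|exact: not_low_ball|exact: not_low_ball].
Qed.
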